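(* Let $L/K$ be a separable field extension of degree $2p$, $p$ an odd prime, $\widetilde{L}/K$ its normal closure and $G\simeq \mathrm{Gal}(\widetilde{L}/K)$. The extension $L/K$ has a Hopf Galois structure of dihedral type if and only if $G$ is isomorphic to either (i) the semidirect product $(C_p\times C_p)\rtimes C_m$ of the direct product of two cyclic groups of order $p$ and a cyclic group of even order $m$ dividing $p-1$; or (ii) the semidirect product $(C_p\times C_p)\rtimes (C_2\times C_m)$ of the direct product of two cyclic groups of order $p$ and the direct product of a cyclic group of order $2$ and a cyclic group of even order $m$ dividing $p-1$; or (iii) the semidirect product $C_{2p}\rtimes C_m$ of a cyclic group of order $2p$ and a cyclic group of order $m$ dividing $p-1$; or (iv) the semidirect product $C_p\rtimes C_m$ of a cyclic group of order $p$ and a cyclic group of even order $m$ dividing $p-1$. The number of structures (Hopf Galois structures of dihedral type on $L/K$, in these cases) is always $2$.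
   Context: A Hopf Galois structure on a finite field extension $L/K$ is a pair $(H,\mu)$, where $H$ is a finite cocommutative $K$-Hopf algebra and $\mu$ is a Hopf action of $H$ on $L$, i.e. a $K$-linear map $\mu: H\to \operatorname{End}_K(L)$ giving $L$ a left $H$-module algebra structure and inducing a $K$-vector space isomorphism $L\otimes_K H\to \operatorname{End}_K(L)$. Hopf Galois structures are counted up to isomorphism. Let $L/K$ be separable of degree $g$, $\widetilde{L}$ its Galois (normal) closure, $G=\mathrm{Gal}(\widetilde{L}/K)$, $G'=\mathrm{Gal}(\widetilde{L}/L)$, and let $\lambda:G\hookrightarrow S_g$ be the monomorphism given by the action of $G$ on the left cosets $G/G'$, where the symmetric group $S_g$ is identified with the group of permutations of $G/G'$. By the Greither–Pareigis theorem, Hopf Galois structures on $L/K$ are in bijection with regular subgroups $N$ of $S_g$ normalized by $\lambda(G)$. The type of a Hopf Galois structure is the isomorphism class of the corresponding group $N$; dihedral type means that $N$ is isomorphic to the dihedral group $D_{2p}$ of order $2p$. $C_n$ denotes the cyclic group of order $n$. *)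

(* Defs.v *)
From HB Require Import structures.
From mathcomp Require Import all_boot all_order all_algebra.
From mathcomp Require Import all_fingroup all_solvable all_field.

Set Implicit Arguments.
Unset Strict Implicit.
Unset Printing Implicit Defensive.

Import GRing.Theory VectorInternalTheory.
Local Open Scope ring_scope.

Section TensorProduct.
Variable K : fieldType.

(* U (x)_K V for finite-dimensional U and V, in coordinates: the (i, j) entry *)
(* is the coefficient on e_i (x) f_j, for the canonical bases of U and V.     *)
(* The lemmas [tens_linearl], [tens_linearr], [tliftE] and [tens_span] are    *)
(* the universal property.                                                    *)
Definition tensor (U V : vectType K) := 'M[K]_(dim U, dim V).

Definition tens (U V : vectType K) (u : U) (v : V) : tensor U V :=
  (v2r u)^T *m v2r v.

Definition stdbasis (U : vectType K) (i : 'I_(dim U)) : U :=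
  r2v (delta_mx 0 i).

(* The linear extension of a bilinear f: writing T = sum of the u (x) v,      *)
(* [tlift f T] is the sum of the f u v.  Thus [tlift (fun a b => E) (comul h)]*)
(* is the Sweedler notation for the sum of E over h_(1) = a, h_(2) = b.       *)
Definition tlift (U V : vectType K) (W : lmodType K) (f : U -> V -> W)
    (T : tensor U V) : W :=
  \sum_i \sum_j T i j *: f (stdbasis i) (stdbasis j).

Lemma tens_linearl (U V : vectType K) (v : V) :
  linear (fun u : U => tens u v).
Proof. by move=> a x y; rewrite /tens !linearP /= mulmxDl -scalemxAl. Qed.

Lemma tens_linearr (U V : vectType K) (u : U) : linear (@tens U V u).
Proof. by move=> a x y; rewrite /tens linearP /= mulmxDr -scalemxAr. Qed.

Lemma stdbasisE (U : vectType K) (u : U) :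
  u = \sum_i v2r u 0 i *: stdbasis i.
Proof.
rewrite -[LHS]v2rK [in LHS](row_sum_delta (v2r u)) linear_sum.
by apply: eq_bigr => i _; rewrite linearZ.
Qed.

Lemma tliftE (U V : vectType K) (W : lmodType K) (f : U -> V -> W) :
  (forall u, linear (f u)) -> (forall v, linear (f^~ v)) ->
  forall u v, tlift f (tens u v) = f u v.
Proof.
move=> fr fl u v.
pose ar u := GRing.isLinear.Build _ _ _ _ (f u) (fr u).
pose Fr u : {linear V -> W} := HB.pack (f u) (ar u).
pose al v := GRing.isLinear.Build _ _ _ _ (f^~ v) (fl v).
pose Fl v : {linear U -> W} := HB.pack (f^~ v) (al v).
rewrite [in RHS](stdbasisE u) -[RHS]/(Fl v _) linear_sum.
apply: eq_bigr => i _; rewrite linearZ /= [in RHS](stdbasisE v).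
rewrite -[f _ _]/(Fr _ _) linear_sum scaler_sumr.
apply: eq_bigr => j _; rewrite linearZ /= scalerA.
by rewrite mxE big_ord_recl big_ord0 addr0 !mxE.
Qed.

Lemma tens_span (U V : vectType K) (T : tensor U V) :
  T = tlift (@tens U V) T.
Proof.
rewrite [LHS]matrix_sum_delta; apply: eq_bigr => i _; apply: eq_bigr => j _.
by congr (_ *: _); rewrite /tens !r2vK trmx_delta mul_delta_mx.
Qed.

End TensorProduct.

Record hopfAlgebra (K : fieldType) := HopfAlgebra {
  hopf_alg :> falgType K;
  comul : {linear hopf_alg -> tensor hopf_alg hopf_alg};
  counit : {linear hopf_alg -> K^o};
  antipode : {linear hopf_alg -> hopf_alg};
  comulA : forall h,
    tlift (fun a b => tlift (fun a1 a2 => tens a1 (tens a2 b)) (comul a))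
      (comul h) =
    tlift (fun a b => tens a (comul b)) (comul h);
  counitl : forall h, tlift (fun a b => counit a *: b) (comul h) = h;
  counitr : forall h, tlift (fun a b => counit b *: a) (comul h) = h;
  comul1 : comul 1 = tens 1 1;
  comulM : forall g h,
    comul (g * h) =
    tlift (fun a b => tlift (fun c d => tens (a * c) (b * d)) (comul h))
      (comul g);
  counit1 : counit 1 = 1;
  counitM : forall g h, counit (g * h) = counit g * counit h;
  antipodel : forall h,
    tlift (fun a b => antipode a * b) (comul h) = (counit h : K) *: 1;
  antipoder : forall h,
    tlift (fun a b => a * antipode b) (comul h) = (counit h : K) *: 1
}.

Arguments comul {K} {H} : rename.
Arguments counit {K} {H} : rename.
Arguments antipode {K} {H} : rename.

Definition cocommutative (K : fieldType) (H : hopfAlgebra K) :=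
  forall h : H, tlift (fun a b => tens b a) (comul h) = comul h.

Record hopfGalois (K : fieldType) (L : fieldExtType K) := HopfGalois {
  hg_hopf :> hopfAlgebra K;
  hg_act : {linear hg_hopf -> 'End(L)};
  hg_cocomm : cocommutative hg_hopf;
  hg_act1 : hg_act 1 = \1%VF;
  hg_actM : forall g h, hg_act (g * h) = (hg_act g \o hg_act h)%VF;
  hg_mod1 : forall h, hg_act h 1 = (counit h : K) *: 1;
  hg_modM : forall h x y,
    hg_act h (x * y) = tlift (fun a b => hg_act a x * hg_act b y) (comul h);
  hg_bij : bijective
    (tlift (fun x h => (amull x \o hg_act h)%VF)
      : tensor L hg_hopf -> 'End(L))
}.

Arguments hg_act {K L} {S} : rename.

Definition hg_iso (K : fieldType) (L : fieldExtType K)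
    (S1 S2 : hopfGalois L) : Prop :=
  exists f : {linear S1 -> S2},
  [/\ bijective f,
      f 1 = 1 /\ (forall g h, f (g * h) = f g * f h),
      forall h, comul (f h) = tlift (fun a b => tens (f a) (f b)) (comul h),
      (forall h, counit (f h) = counit h) /\
        (forall h, antipode (f h) = f (antipode h)) &
      forall h, hg_act (f h) = hg_act h].

Definition hg_count (K : fieldType) (L : fieldExtType K)
    (P : hopfGalois L -> Prop) (n : nat) : Prop :=
  exists S : 'I_n -> hopfGalois L,
  [/\ forall i, P (S i),
      forall i j, hg_iso (S i) (S j) -> i = j &
      forall S0, P S0 -> exists i, hg_iso S0 (S i)].

(* M is itself normal over K, by virtue of being a [splittingFieldType K].    *)
Definition normal_closure (K : fieldType) (M : splittingFieldType K)
    (L : {subfield M}) : Prop :=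
  forall E : {subfield M},
    (L <= E)%VS -> normalField 1 E -> ({:M} <= E)%VS.

Section GreitherPareigis.
Variables (K : fieldType) (M : splittingFieldType K) (L : {subfield M}).

Local Notation Gal := 'Gal({:M} / 1)%g.
Local Notation Gal' := 'Gal({:M} / L)%g.
Local Notation point := {set gal_of {:M}}.

(* Products of [gal_of] and of permutations are composed from left to right:  *)
(* (x * y) a = y (x a).  So the left cosets of Gal' for composition are the   *)
(* [rcosets], on which g acts by A |-> A :* g, and all elements of a given    *)
(* coset have the same restriction to L.                                      *)
Definition gp_points : {set point} := rcosets Gal' Gal.

Definition gp_lambda (g : gal_of {:M}) : {perm point} :=
  restr_perm gp_points (actperm 'Rs%act g).

Definition gp_regular (N : {group {perm point}}) : Prop :=
  [/\ N \subset perm.Sym gp_points,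
      [transitive N, on gp_points | 'P] &
      {in gp_points, forall A, 'C_N[A | 'P] = 1}]%g.

Definition gp_normalized (N : {group {perm point}}) : Prop :=
  [set gp_lambda g | g in Gal] \subset 'N(N)%g.

(* The structure S is the one attached to N by the Greither-Pareigis          *)
(* correspondence: iota identifies the Hopf algebra of S with the fixed       *)
(* points M[N]^Gal of the group algebra M[N], where Gal acts on M and, by     *)
(* conjugation via lambda, on N; the action on L is that of                   *)
(*   (sum_n c_n n) x = sum_n c_n (n^-1 (Gal'))(x),                            *)
(* a coset acting on L through any of its elements.  An element of M[N] is a  *)
(* finite function supported on N.  The composite of m followed by n is       *)
(* m * n, so this is the product n m of the group algebra.                    *)
Definition gp_corresponds (N : {group {perm point}})
    (S : hopfGalois (subvs_of L)) : Prop :=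
  exists iota : {linear S -> {ffun {perm point} -> M}},
  [/\ injective iota /\
      (forall c : {ffun {perm point} -> M},
        (exists h, iota h = c) <->
        (forall n, n \notin N -> c n = 0) /\
        {in Gal & N, forall g n, c (n ^ gp_lambda g)%g = g (c n)}),
      (forall n, iota 1 n = (n == 1%g)%:R) /\
      (forall g h k, iota (g * h) k =
        \sum_(n in N) \sum_(m in N | (m * n)%g == k) iota g n * iota h m),
      (forall h n m, tlift (fun a b => iota a n * iota b m) (comul h) =
        if n == m then iota h n else 0) /\
      (forall h, (counit h : K) *: (1 : M) = \sum_(n in N) iota h n),
      forall h n, iota (antipode h) n = iota h n^-1%g &
      forall h x, vsval (hg_act h x) =
        \sum_(n in N) iota h n * repr (n^-1%g (Gal' : point)) (vsval x)].

Definition of_type (S : hopfGalois (subvs_of L))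
    (gT : finGroupType) (D : {group gT}) : Prop :=
  exists N : {group {perm point}},
  [/\ gp_regular N, gp_normalized N, gp_corresponds N S & N \isog D].

Definition dihedral_type (p : nat) (S : hopfGalois (subvs_of L)) : Prop :=
  of_type S 'D_(2 * p).

End GreitherPareigis.

(* G is a semidirect product (for some action) of a group isomorphic to C by  *)
(* a group isomorphic to D.                                                   *)
Definition is_semidirect (gT aT bT : finGroupType) (G : {group gT})
    (C : {group aT}) (D : {group bT}) : Prop :=
  exists A B : {group gT}, [/\ A ><| B = G, A \isog C & B \isog D]%g.

(* The cyclic group of order n > 0 is [Zp n] (and not [setT] in 'Z_n, which   *)
(* has order 2 when n = 1).                                                   *)
Definition case_i (p : nat) (gT : finGroupType) (G : {group gT}) : Prop :=
  exists m : nat, [/\ ~~ odd m, (m %| p.-1)%N &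
    is_semidirect G (setX (Zp p) (Zp p)) (Zp m)].

Definition case_ii (p : nat) (gT : finGroupType) (G : {group gT}) : Prop :=
  exists m : nat, [/\ ~~ odd m, (m %| p.-1)%N &
    is_semidirect G (setX (Zp p) (Zp p)) (setX (Zp 2) (Zp m))].

Definition case_iii (p : nat) (gT : finGroupType) (G : {group gT}) : Prop :=
  exists m : nat, (m %| p.-1)%N /\ is_semidirect G (Zp (2 * p)) (Zp m).

Definition case_iv (p : nat) (gT : finGroupType) (G : {group gT}) : Prop :=
  exists m : nat, [/\ ~~ odd m, (m %| p.-1)%N &
    is_semidirect G (Zp p) (Zp m)].

(* Main.v *)
From HB Require Import structures.
Require Import Defs.
From mathcomp Require Import all_boot all_order all_algebra.
From mathcomp Require Import all_fingroup all_solvable all_field.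

(** Structures of dihedral type correspond to regular dihedral subgroups N of
Sym(G/G') normalised by G, so the theorem has two independent halves: a count
of such subgroups of the symmetric group on 2p points, and the construction
and separation of the Hopf algebras attached to them.

Counting.  The rotation subgroup C of N has order p, acts semiregularly and is
characteristic in N.  It also determines N: a reflection inverts C and
exchanges its two orbits, and the product of two involutions with this property
always lies in C.  Hence C together with all these involutions generates a
regular dihedral group, [dihedral_hull], with the same normaliser inside the
symmetric group as C ([regular_dihedral_hull], [dihedral_normalizer]), and the
problem is to count the semiregular subgroups C of order p that G normalises.
Let C be one of them.  The permutations that act on each orbit of C as an
element of C form an elementary abelian group of order p^2, [orbitwise], which
contains all the p-elements that normalise C.  It is the product of C and of
[twist], whose elements act as c on one orbit and as c^-1 on the other.  Both
factors are semiregular and normalised by G.  An element of G that exchanges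
the orbits and acts on C as the k-th power acts on [twist] as the power -k;
as p is odd, no other line of [orbitwise] is invariant
([semiregular_unique]).  So there are two groups N as soon as there is one.

The list of groups.  If G normalises C, then Q, the intersection of G with
[orbitwise], is the normal Sylow p-subgroup of G, of order p or p^2, and it has
a complement H.  The elements of H that preserve the orbits act faithfully on
C, hence form a cyclic group of order dividing p-1; those that centralise C
form a group of order at most 2, generated by an exchange of the orbits.  The
four cases result from this ([forward_cases]).  Conversely, when G has a normal
cyclic subgroup whose p-part has order p, that p-part is semiregular.  When G
is the semidirect product of A = C_p x C_p by B, the point stabilisers in A are
two subgroups of order p exchanged by some b in B.  On either of them b^2 acts
as a square in the cyclic group of automorphisms, because the exponent m of B
is even and divides p-1; so b has an eigenvector in A outside both stabilisers,
and this eigenvector generates C ([semiregular_of_abelem]).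

Hopf algebras.  Let H be the space of Galois-fixed points of the group algebra
M[N].  Galois descent says that a basis of H over K is a basis of M[N] over M
([descent_free], [descent_span]).  Independence makes a tensor over H
determined by its coefficients in M[N x N] ([eval2_inj]), so that the Hopf
axioms can be checked in the group algebra; the comultiplication is defined
over K because its matrix is Galois-invariant ([diagonal_exists]).  H acts on L
through the embeddings of L into M given by the cosets, and the independence of
these embeddings ([rho_free]), with a count of dimensions, makes the structure
a Hopf Galois one ([gp_existence]).  The structure attached to N is unique up
to isomorphism ([gp_unique_structure]).  It determines N as well
([gp_unique_group]): by independence of embeddings the action gives every
coefficient of h as a function on the points of G/G', which N labels simply
transitively, and the product of H then gives the product of N as a law on
points, that is, the permutations of N themselves. *)

Set Implicit Arguments.
Unset Strict Implicit.
Unset Printing Implicit Defensive.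

Import GroupScope.

(** * Semiregular subgroups of prime order p on 2p points *)

Definition semiregular_on (T : finType) (D : {set T}) (p : nat)
    (C : {set {perm T}}) : Prop :=
  [/\ C \subset perm.Sym D, #|C| = p & {in D, forall x, 'C_C[x | 'P] = 1}].

Definition regular_on (T : finType) (D : {set T}) (N : {group {perm T}}) : Prop :=
  [/\ N \subset perm.Sym D, [transitive N, on D | 'P] &
      {in D, forall x, 'C_N[x | 'P] = 1}].

Section SemiregularSubgroup.
Variables (T : finType) (D : {set T}) (p : nat).
Hypotheses (p_pr : prime p) (p_odd : odd p) (cardD : #|D| = (2 * p)%N).
Variable C : {group {perm T}}.
Hypothesis semiC : semiregular_on D p C.
Implicit Types (x y z : T) (a c g h : {perm T}).

Local Notation S := (perm.Sym D).
Local Notation orb := (orbit 'P C).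

Let sCS : C \subset S. Proof. by case: semiC. Qed.
Let cardC : #|C| = p. Proof. by case: semiC. Qed.

Lemma Sym_mem g x : g \in S -> (g x \in D) = (x \in D).
Proof. by rewrite inE => /perm_closed->. Qed.

Lemma Sym_out g x : g \in S -> x \notin D -> g x = x.
Proof. by rewrite inE => /out_perm; apply. Qed.

Lemma Sym_eq g h : g \in S -> h \in S -> {in D, g =1 h} -> g = h.
Proof.
move=> Sg Sh gh; apply/permP => x; have [/gh//|D'x] := boolP (x \in D).
by rewrite !Sym_out.
Qed.

Lemma semiregular_eq x a b : x \in D -> a \in C -> b \in C -> a x = b x -> a = b.
Proof.
move=> Dx Ca Cb ab; have [_ _ free] := semiC.
apply/eqP; rewrite eq_mulgV1 -in_set1 -[[set 1]]/(1 : {set _}) -(free x Dx).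
rewrite inE groupM ?groupV //=; apply/astab1P.
by rewrite /= /aperm permM ab permK.
Qed.

Lemma orbP x y : reflect (exists2 a, a \in C & a x = y) (y \in orb x).
Proof. by apply: (iffP orbitP) => -[a Ca Dy]; exists a. Qed.

Lemma mem_orb_act x a : a \in C -> a x \in orb x.
Proof. by move=> Ca; apply/orbP; exists a. Qed.

Lemma card_orb x : x \in D -> #|orb x| = p.
Proof.
move=> Dx; rewrite -cardC -(card_orbit_stab 'P C x).
by have [_ _ ->] := semiC; rewrite ?cards1 ?muln1.
Qed.

Lemma orb_sub x : x \in D -> orb x \subset D.
Proof.
move=> Dx; apply/subsetP => y /orbP[a Ca <-].
by rewrite Sym_mem // (subsetP sCS).
Qed.

Lemma orb_sym x y : (x \in orb y) = (y \in orb x).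
Proof. exact: orbit_sym. Qed.

Lemma orb_trans x y z : x \in orb y -> y \in orb z -> x \in orb z.
Proof. by move/orbit_trans; apply. Qed.

(** Both orbits have p points out of 2p. *)
Lemma two_orbits x y z : x \in D -> y \in D -> z \in D ->
  y \notin orb x -> z \notin orb x -> z \in orb y.
Proof.
move=> Dx Dy Dz xy xz; apply: contraR xz => yz.
have dis : [disjoint orb x & orb y].
  apply/pred0P => t /=; apply/negbTE; apply: contra xy => /andP[tx ty].
  by apply: orb_trans tx; rewrite orb_sym.
have sub : orb x :|: orb y \subset D by rewrite subUset !orb_sub.
have /setP/(_ z) : orb x :|: orb y = D.
  apply/eqP; rewrite eqEcard sub cardsU cardD !card_orb //.
  by rewrite (disjoint_setI0 dis) cards0 subn0 addnn mul2n leqnn.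
by rewrite inE Dz (negPf yz) orbF.
Qed.

Lemma second_orbit x : x \in D -> exists2 y, y \in D & y \notin orb x.
Proof.
move=> Dx; apply/exists_inP; rewrite -negb_forall_in; apply/negP => /forall_inP sub.
have: D \subset orb x by apply/subsetP.
move/subset_leq_card; rewrite cardD card_orb // mul2n -addnn leqNgt.
by rewrite -{1}[p]addn0 ltn_add2l prime_gt0.
Qed.

Lemma norm_orb g x y : g \in 'N(C) -> (g y \in orb (g x)) = (y \in orb x).
Proof.
move=> Ng; apply/orbP/orbP => [[a Ca Dy] | [a Ca <-]]; last first.
  by exists (a ^ g); rewrite ?memJ_norm // permJ.
exists (a ^ g^-1); first by rewrite memJ_norm ?groupV.
by apply: (@perm_inj _ g); rewrite -Dy -[in RHS](permK g x) -permJ // permKV conjgKV.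
Qed.

Definition fixes_orbits g := [forall x in D, g x \in orb x].

(** A permutation that normalises C permutes its two orbits, so whether it fixes
them can be tested on any single point. *)
Lemma fixes_orbitsP g : g \in S -> g \in 'N(C) -> forall x, x \in D ->
  fixes_orbits g = (g x \in orb x).
Proof.
move=> Sg Ng x Dx; apply/forall_inP/idP => [/(_ x Dx)//| gx y Dy].
have [xy | xy] := boolP (y \in orb x).
  have := xy; rewrite -(norm_orb x y Ng) => /orb_trans/(_ gx) gyx.
  by apply: orb_trans gyx _; rewrite orb_sym.
apply: (two_orbits Dx) => //; first by rewrite Sym_mem.
apply: contra xy => gyx; rewrite -(norm_orb x y Ng).
by apply: orb_trans gyx _; rewrite orb_sym.
Qed.

Lemma swapsP g x y : g \in S -> g \in 'N(C) -> ~~ fixes_orbits g -> x \in D -> y \in D ->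
  (g y \in orb x) = (y \notin orb x).
Proof.
move=> Sg Ng sw Dx Dy; have gy : g y \notin orb y by rewrite -fixes_orbitsP.
apply/idP/idP => [gyx | xy]; last first.
  apply: (two_orbits Dy) => //; rewrite ?Sym_mem //.
  by rewrite orb_sym.
apply: contra gy => yx; apply: orb_trans gyx _; rewrite orb_sym //.
Qed.

Definition orbit_kernel := 'N_S(C) :&: \bigcap_(x in D) 'N(orb x | 'P).
Canonical orbit_kernel_group := [group of orbit_kernel].

Lemma orbit_kernelP g : reflect [/\ g \in S, g \in 'N(C) & fixes_orbits g] (g \in orbit_kernel).
Proof.
apply: (iffP setIP) => [[/setIP[Sg Ng] /bigcapP og] | [Sg Ng /forall_inP pg]].
  split=> //; apply/forall_inP => x Dx.
  by rewrite -[g x]/('P%act x g) (astabs_act _ (og x Dx)) orbit_refl.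
split; first by rewrite inE Sg.
apply/bigcapP => x Dx; rewrite !inE; apply/subsetP => y xy; rewrite inE.
have Dy : y \in D := subsetP (orb_sub Dx) y xy.
exact: (orb_trans (pg y Dy) xy).
Qed.

Lemma swap_mul g h : g \in S -> g \in 'N(C) -> h \in S -> h \in 'N(C) ->
  ~~ fixes_orbits g -> ~~ fixes_orbits h -> fixes_orbits (g * h).
Proof.
move=> Sg Ng Sh Nh sg sh; apply/forall_inP => x Dx; rewrite permM.
have gx : g x \notin orb x by rewrite -fixes_orbitsP.
by rewrite swapsP ?Sym_mem.
Qed.

(** The permutations acting on each orbit of C as an element of C, possibly a
different one for each orbit: the product of two cyclic groups of order p. *)
Definition orbitwise := 'C_orbit_kernel(C).
Canonical orbitwise_group := [group of orbitwise].

Lemma orbitwiseP g :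
  reflect [/\ g \in S, g \in 'C(C) & forall x, x \in D -> g x \in orb x] (g \in orbitwise).
Proof.
apply: (iffP setIP) => [[/orbit_kernelP[Sg _ /forall_inP pg] Cg] | [Sg Cg pg]] //.
split=> //; apply/orbit_kernelP; split=> //; last exact/forall_inP.
exact: (subsetP (cent_sub C)).
Qed.

Lemma cent_act g a x : g \in 'C(C) -> a \in C -> g (a x) = a (g x).
Proof. by move=> Cg Ca; rewrite -!permM (centP Cg). Qed.

Lemma orbit_kernel_norm g : g \in S -> g \in 'N(C) -> g \in 'N(orbit_kernel).
Proof.
move=> Sg Ng; rewrite inE; apply/subsetP => _ /imsetP[k /orbit_kernelP[Sk Nk pk] ->].
apply/orbit_kernelP; split; rewrite ?groupJ //; apply/forall_inP => x Dx.
rewrite -[x](permKV g) permJ norm_orb // -fixes_orbitsP //.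
by rewrite Sym_mem ?groupV.
Qed.

Lemma orbitwise_norm g : g \in S -> g \in 'N(C) -> g \in 'N(orbitwise).
Proof.
move=> Sg Ng; have := orbit_kernel_norm Sg Ng; rewrite /orbitwise -!sub1set => nk.
by rewrite normsI // norms_cent // sub1set.
Qed.

Lemma orbitwise_act g x : g \in orbitwise -> x \in D ->
  exists2 a, a \in C & {in orb x, g =1 a}.
Proof.
case/orbitwiseP=> Sg Cg pg Dx; have /orbP[a Ca ax] := pg x Dx.
exists a => // _ /orbP[b Cb <-]; rewrite cent_act // -ax.
have /centsP abC : abelian C by rewrite cyclic_abelian // prime_cyclic ?cardC.
by rewrite -!permM abC.
Qed.

Lemma semiregular_abelian : abelian C.
Proof. by rewrite cyclic_abelian // prime_cyclic ?cardC. Qed.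

Lemma orbitwise_abelian : abelian orbitwise.
Proof.
apply/centsP => g Lg h Lh; have [Sg _ pg] := orbitwiseP _ Lg; have [Sh _ ph] := orbitwiseP _ Lh.
apply: Sym_eq; rewrite ?groupM // => x Dx; rewrite !permM.
have [a Ca ga] := orbitwise_act Lg Dx; have [b Cb hb] := orbitwise_act Lh Dx.
rewrite (ga x) ?orbit_refl // (hb x) ?orbit_refl // hb ?mem_orb_act //.
by rewrite ga ?mem_orb_act // -!permM (centsP semiregular_abelian).
Qed.

Lemma orbitwise_expg g n x a : {in orb x, g =1 a} -> a \in C ->
  {in orb x, g ^+ n =1 a ^+ n}.
Proof.
move=> ga Ca; elim: n => [|n IHn] y xy; first by rewrite !expg0.
rewrite !expgSr !permM IHn // ga //; apply: orb_trans xy.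
by rewrite mem_orb_act ?groupX.
Qed.

Lemma orbitwise_abelem : p.-abelem orbitwise.
Proof.
apply/abelemP => //; split=> [|g Lg]; first exact: orbitwise_abelian.
have [Sg _ _] := orbitwiseP _ Lg; apply: Sym_eq; rewrite ?groupX ?group1 // => x Dx.
have [a Ca ga] := orbitwise_act Lg Dx.
by rewrite (orbitwise_expg p ga) ?orbit_refl // -cardC expg_cardG.
Qed.

Lemma sub_orbitwise : C \subset orbitwise.
Proof.
apply/subsetP => a Ca; apply/orbitwiseP; split; first exact: (subsetP sCS).
  exact: (subsetP semiregular_abelian).
by move=> x _; apply: mem_orb_act.
Qed.

(** An element of [orbitwise] acts on each orbit as an element of C, and C is free;
so one point in each orbit is enough to know it. *)
Lemma orbitwise_eq g h x y : x \in D -> y \in D -> y \notin orb x ->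
  g \in orbitwise -> h \in orbitwise -> g x = h x -> g y = h y -> g = h.
Proof.
move=> Dx Dy xy Lg Lh ghx ghy.
have [Sg _ _] := orbitwiseP _ Lg; have [Sh _ _] := orbitwiseP _ Lh.
have eq_orb z : z \in D -> g z = h z -> {in orb z, g =1 h}.
  move=> Dz ghz; have [a Ca ga] := orbitwise_act Lg Dz; have [b Cb hb] := orbitwise_act Lh Dz.
  move=> t zt; rewrite ga // hb //; congr (fun_of_perm _ t).
  by apply: (semiregular_eq Dz) => //; rewrite -ga -?hb ?orbit_refl.
apply: Sym_eq => // z Dz; have [xz | xz] := boolP (z \in orb x).
  exact: eq_orb xz.
by apply: (eq_orb y) => //; apply: two_orbits xz.
Qed.

Lemma card_orbitwise : #|orbitwise| <= p ^ 2.
Proof.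
have /card_gt0P[x Dx] : 0 < #|D| by rewrite cardD muln_gt0 (prime_gt0 p_pr).
have [y Dy xy] := second_orbit Dx.
have <- : #|setX (orb x) (orb y)| = (p ^ 2)%N by rewrite cardsX !card_orb.
rewrite -(card_in_imset (f := fun g => (g x, g y))) => [|g h Lg Lh /= [ghx ghy]].
  apply/subset_leq_card/subsetP => _ /imsetP[g /orbitwiseP[_ _ pg] ->].
  by rewrite inE !pg.
exact: (orbitwise_eq Dx Dy xy).
Qed.

(** g^2 fixes both orbits and generates the same cyclic group as g. *)
Lemma odd_orbit_kernel g : g \in S -> g \in 'N(C) -> odd #[g] -> g \in orbit_kernel.
Proof.
move=> Sg Ng odd_g; have kg2 : g ^+ 2 \in orbit_kernel.
  apply/orbit_kernelP; split; rewrite ?groupX //; rewrite expgS expg1.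
  have [pg2|pg2] := boolP (fixes_orbits g); last exact: swap_mul.
  have kg : g \in orbit_kernel by apply/orbit_kernelP.
  by have /orbit_kernelP[] : g * g \in orbit_kernel by rewrite groupM.
have: <[g]> \subset orbit_kernel; last by rewrite cycle_subG.
have /eqP-> : generator <[g]> (g ^+ 2) by rewrite generator_coprime coprimen2.
by rewrite cycle_subG.
Qed.

(** A p-element normalising C fixes the orbits since p is odd, and centralises C
since the automorphism group of C has order p-1. *)
Lemma p_elt_orbitwise g : g \in S -> g \in 'N(C) -> p.-elt g -> g \in orbitwise.
Proof.
move=> Sg Ng pg; have odd_g : odd #[g].
  by have /p_natP[k ->] := pg; rewrite oddX p_odd orbT.
rewrite inE odd_orbit_kernel // -(ker_conj_aut C); apply/kerP => //.
apply/eqP; rewrite -order_eq1; apply/eqP.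
apply: (@pnat_1 p); first exact: morph_p_elt.
apply: (pnat_dvd (order_dvdG (mem_morphim _ Ng Ng))).
apply: (pnat_dvd (cardSg (Aut_conj_aut _ _))).
rewrite card_Aut_cyclic ?prime_cyclic ?cardC // totient_prime //.
by rewrite p'natE // gtnNdvd ?ltn_predL ?(prime_gt0 p_pr) // -ltnS prednK ?prime_gt1 ?prime_gt0.
Qed.

(** What the reflections of a regular dihedral group with rotation subgroup C
must look like.  The condition refers to C alone, which makes the set
invariant under the normaliser of C. *)
Definition reflections := [set n in S | [&& n ^+ 2 == 1,
  [forall a in C, a ^ n == a^-1] & [forall x in D, n x \notin orb x]]].

Lemma reflectionP n : reflect
  [/\ n \in S, n ^+ 2 = 1, {in C, forall a, a ^ n = a^-1} &
      {in D, forall x, n x \notin orb x}] (n \in reflections).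
Proof.
rewrite [n \in reflections]in_set; apply: (iffP and4P).
  move=> [Sn /eqP n2 /forall_inP invn /forall_inP swn]; split=> // a Ca.
  exact/eqP/invn.
move=> [Sn n2 invn swn]; split=> //; first exact/eqP.
  by apply/forall_inP => a /invn/eqP.
exact/forall_inP.
Qed.

Lemma reflection_norm n : n \in reflections -> n \in 'N(C).
Proof.
case/reflectionP=> _ _ invn _; rewrite inE; apply/subsetP => _ /imsetP[a Ca ->].
by rewrite invn ?groupV.
Qed.

Lemma reflection_conj g n : g \in S -> g \in 'N(C) -> n \in reflections -> n ^ g \in reflections.
Proof.
move=> Sg Ng /reflectionP[Sn n2 invn swn]; apply/reflectionP; split.
- by rewrite groupJ.
- by rewrite -conjXg n2 conj1g.
- move=> a Ca; have Cag : a ^ g^-1 \in C by rewrite memJ_norm ?groupV.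
  by rewrite -{1}[a](conjgKV g) -conjJg invn // conjVg conjgKV.
move=> x Dx; rewrite -[x](permKV g) permJ norm_orb //; apply: swn.
by rewrite Sym_mem ?groupV.
Qed.

(** Choose a point in each orbit, x1 and x2, and exchange a x1 with a^-1 x2 for
every a in C. *)
Lemma reflection_exists : exists n, n \in reflections.
Proof.
have /card_gt0P[x1 D1] : 0 < #|D| by rewrite cardD muln_gt0 (prime_gt0 p_pr).
have [x2 D2 x12] := second_orbit D1.
(* The partner of z; both picks fail outside D. *)
pose f z := if [pick a in C | (a : {perm T}) x1 == z] is Some a then (a^-1 : {perm T}) x2 else
  if [pick a in C | (a : {perm T}) x2 == z] is Some a then (a^-1 : {perm T}) x1 else z.
have f1 a : a \in C -> f (a x1) = a^-1 x2.
  move=> Ca; rewrite /f; case: pickP => [b /andP[Cb /eqP ba] | /(_ a)]; last by rewrite Ca eqxx.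
  by rewrite (semiregular_eq D1 Cb Ca ba).
have f2 a : a \in C -> f (a x2) = a^-1 x1.
  move=> Ca; rewrite /f; case: pickP => [b /andP[Cb /eqP ba] | _].
    case/negP: x12; apply: (orb_trans (y := a x2)); last by rewrite -ba mem_orb_act.
    by rewrite orb_sym mem_orb_act.
  case: pickP => [b /andP[Cb /eqP ba] | /(_ a)]; last by rewrite Ca eqxx.
  by rewrite (semiregular_eq D2 Cb Ca ba).
have f3 z : z \notin D -> f z = z.
  move=> D'z; rewrite /f; case: pickP => [b /andP[Cb /eqP bz]|_].
    by rewrite -bz Sym_mem ?D1 // (subsetP sCS) in D'z.
  case: pickP => [b /andP[Cb /eqP bz]|_] //.
  by rewrite -bz Sym_mem ?D2 // (subsetP sCS) in D'z.
have Dcase z : z \in D -> (exists2 a, a \in C & z = a x1) \/ (exists2 a, a \in C & z = a x2).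
  move=> Dz; have [/orbP[a Ca <-]|xz] := boolP (z \in orb x1); first by left; exists a.
  have /orbP[a Ca <-] := two_orbits D1 D2 Dz x12 xz.
  by right; exists a.
have fK : involutive f.
  move=> z; have [/Dcase[] [a Ca ->]|D'z] := boolP (z \in D); last by rewrite !f3.
    by rewrite f1 // f2 ?groupV // invgK.
  by rewrite f2 // f1 ?groupV // invgK.
pose n := perm (inv_inj fK); have nE z : n z = f z by rewrite permE.
have Sn : n \in S.
  by rewrite inE; apply/subsetP => z; rewrite inE nE; apply: contraR => /f3->.
have n2 : n ^+ 2 = 1 by apply/permP => z; rewrite expgS expg1 permM !nE fK perm1.
have abM a b : a \in C -> b \in C -> (b * a)^-1 = b^-1 * a^-1.
  by move=> Ca Cb; rewrite (centsP semiregular_abelian b Cb a Ca) invMg.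
exists n; apply/reflectionP; split=> // [a Ca | x /Dcase[] [a Ca ->]].
- have Sa : a \in S by apply: (subsetP sCS).
  apply: Sym_eq; rewrite ?groupJ ?groupV // => z Dz.
  have Dnz : n z \in D by rewrite Sym_mem.
  rewrite -[z](_ : n (n z) = z) ?permJ; last by rewrite !nE fK.
  case: (Dcase _ Dnz) => [] [b Cb ->]; rewrite !nE.
    by rewrite f1 // -!permM f1 ?groupM // abM.
  by rewrite f2 // -!permM f2 ?groupM // abM.
- rewrite nE f1 //; apply: contra x12 => x12.
  apply: (orb_trans (y := a^-1 x2)); first by rewrite orb_sym mem_orb_act ?groupV.
  by apply: orb_trans x12 _; rewrite mem_orb_act.
rewrite nE f2 //; apply: contra x12 => x12.
apply: (orb_trans (y := a x2)); first by rewrite orb_sym mem_orb_act.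
rewrite orb_sym; apply: orb_trans _ x12.
by rewrite orb_sym mem_orb_act ?groupV.
Qed.

(** The product z = n n' centralises C and fixes the orbits, hence acts as some
a in C on the orbit of x.  Since n inverts both z and a, z acts as a on the
other orbit too. *)
Lemma reflection_mul n n' : n \in reflections -> n' \in reflections -> n * n' \in C.
Proof.
move=> Rn Rn'; have Nn := reflection_norm Rn; have Nn' := reflection_norm Rn'.
have [Sn n2 invn swn] := reflectionP _ Rn; have [Sn' n'2 invn' swn'] := reflectionP _ Rn'.
have /card_gt0P[x Dx] : 0 < #|D| by rewrite cardD muln_gt0 (prime_gt0 p_pr).
have sw m : m \in S -> m \in 'N(C) -> {in D, forall x, m x \notin orb x} -> ~~ fixes_orbits m.
  by move=> Sm Nm swm; rewrite (fixes_orbitsP Sm Nm Dx) swm.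
set z := n * n'; have Lz : z \in orbitwise.
  apply/orbitwiseP; split; first by rewrite groupM.
    apply/centP => a Ca; apply: commute_sym; apply/commgP/conjg_fixP.
    by rewrite /z conjgM invn // invn' ?groupV // invgK.
  move=> y Dy; have := swap_mul Sn Nn Sn' Nn' (sw _ Sn Nn swn) (sw _ Sn' Nn' swn').
  by move/forall_inP; apply.
have [a Ca za] := orbitwise_act Lz Dx.
suffices -> : z = a by [].
have La : a \in orbitwise by apply: (subsetP (sub_orbitwise)).
have zx : z x = a x by rewrite za ?orbit_refl.
have Dnx : n x \in D by rewrite Sym_mem.
apply: (orbitwise_eq Dx Dnx (swn x Dx)) => //.
have [_ Cz _] := orbitwiseP _ Lz.
have nV : n^-1 = n by apply: (mulgI n); rewrite mulgV -n2.
have n'V : n'^-1 = n' by apply: (mulgI n'); rewrite mulgV -n'2.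
have zn : z ^ n = z^-1 by rewrite conjgE /z invMg n'V nV mulgA -{1}nV mulKg.
have: z^-1 (n x) = a^-1 (n x) by rewrite -zn permJ zx -permJ invn.
move/(congr1 z); rewrite permKV (cent_act _ Cz) ?groupV // => e.
by rewrite [in RHS]e permKV.
Qed.

Definition dihedral_hull := <<C :|: reflections>>.
Canonical dihedral_hull_group := [group of dihedral_hull].

Lemma dihedral_hull_norm g : g \in S -> g \in 'N(C) -> g \in 'N(dihedral_hull).
Proof.
move=> Sg Ng; rewrite inE -genJ genS // conjUg setUSS //; first by rewrite (normP Ng).
by apply/subsetP => _ /imsetP[n Rn ->]; apply: reflection_conj.
Qed.

Lemma reflection_order n : n \in reflections -> #[n] = 2.
Proof.
have /card_gt0P[x Dx] : 0 < #|D| by rewrite cardD muln_gt0 (prime_gt0 p_pr).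
case/reflectionP=> Sn n2 _ /(_ x Dx) swn; apply: nt_prime_order => //.
by apply: contraNneq swn => ->; rewrite perm1 orbit_refl.
Qed.

Lemma dihedral_hullE n : n \in reflections -> dihedral_hull = C * <[n]>.
Proof.
move=> Rn; have Nn := reflection_norm Rn.
rewrite -norm_joinEr ?cycle_subG //; apply/eqP; rewrite eqEsubset.
apply/andP; split; rewrite gen_subG subUset.
  rewrite joing_subl; apply/subsetP => m Rm.
  have [_ n2 _ _] := reflectionP _ Rn.
  have -> : m = (m * n) * n by rewrite -mulgA -expg2 n2 mulg1.
  rewrite groupM //; first exact: (subsetP (joing_subl _ _) _ (reflection_mul Rm Rn)).
  exact: (subsetP (joing_subr _ _) _ (cycle_id n)).
by rewrite sub_gen ?subsetUl //= cycle_subG mem_gen // inE Rn orbT.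
Qed.

Let Dinh : exists x, x \in D.
Proof. by apply/card_gt0P; rewrite cardD muln_gt0 (prime_gt0 p_pr). Qed.

Let n_inv n : n \in reflections -> n^-1 = n.
Proof. by case/reflectionP=> _ n2 _ _; apply: (mulgI n); rewrite mulgV -n2. Qed.

Lemma dihedral_hull_sub : dihedral_hull \subset S.
Proof.
by rewrite gen_subG subUset sCS; apply/subsetP => n /reflectionP[].
Qed.

Lemma card_dihedral_hull : #|dihedral_hull| = (2 * p)%N.
Proof.
have [n Rn] := reflection_exists.
rewrite (dihedral_hullE Rn) coprime_cardMg cardC;
  first by rewrite -orderE reflection_order // mulnC.
by rewrite -orderE reflection_order // coprimen2.
Qed.

Lemma reflection_hull n : n \in reflections -> n \in dihedral_hull.
Proof. by move=> Rn; rewrite mem_gen // inE Rn orbT. Qed.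

Lemma sub_dihedral_hull : C \subset dihedral_hull.
Proof. by rewrite sub_gen ?subsetUl. Qed.

Lemma dihedral_hull_orbit x : x \in D -> orbit 'P dihedral_hull x = D.
Proof.
move=> Dx; have [n Rn] := reflection_exists.
have [Sn _ _ swn] := reflectionP _ Rn.
apply/setP => y; apply/orbitP/idP => [[a /(subsetP dihedral_hull_sub) Sa <-] | Dy].
  by rewrite /= /aperm Sym_mem.
have [/orbP[a Ca <-]|xy] := boolP (y \in orb x).
  by exists a; first exact: (subsetP sub_dihedral_hull).
have /orbP[a Ca <-] := two_orbits Dx (etrans (Sym_mem x Sn) Dx) Dy (swn x Dx) xy.
exists (n * a); last by rewrite /= /aperm permM.
by apply: groupM; [apply: reflection_hull | apply: (subsetP sub_dihedral_hull)].
Qed.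

Lemma dihedral_hull_regular : regular_on D [group of dihedral_hull].
Proof.
split=> [||x Dx]; first exact: dihedral_hull_sub.
  by have [x Dx] := Dinh; apply/imsetP; exists x; rewrite ?dihedral_hull_orbit.
apply: card_le1_trivg.
have /eqP := card_orbit_stab 'P [group of dihedral_hull] x.
rewrite dihedral_hull_orbit // card_dihedral_hull cardD -{2}[(2 * p)%N]muln1.
by rewrite eqn_pmul2l ?muln_gt0 ?(prime_gt0 p_pr) // => /eqP->.
Qed.

Lemma dihedral_hull_isog : dihedral_hull \isog 'D_(2 * p).
Proof.
have [n Rn] := reflection_exists; have [_ n2 invn _] := reflectionP _ Rn.
have /cyclicP[c DC] : cyclic C by rewrite prime_cyclic ?cardC.
have Cc : c \in C by rewrite DC cycle_id.
rewrite mul2n isogEcard card_dihedral ?prime_gt1 //.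
rewrite card_dihedral_hull mul2n leqnn andbT Grp_dihedral ?prime_gt1 //.
apply/existsP; exists (c, n); rewrite /= !xpair_eqE.
have cp : c ^+ p = 1 by rewrite -cardC expg_cardG.
rewrite n2 invn // cp !eqxx !andbT.
by rewrite -DC norm_joinEr ?cycle_subG ?reflection_norm // (dihedral_hullE Rn).
Qed.

(** So the hull determines C, and different C have different hulls. *)
Lemma dihedral_hull_pcore : 'O_p(dihedral_hull) = C.
Proof.
apply: normal_Hall_pcore.
  rewrite /pHall sub_dihedral_hull /pgroup cardC pnat_id //= -divgS ?sub_dihedral_hull //.
  rewrite card_dihedral_hull cardC mulnK ?prime_gt0 // p'natE //.
  by rewrite dvdn_prime2 //; apply: contraL p_odd => /eqP->.
apply/andP; split; first exact: sub_dihedral_hull.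
rewrite gen_subG subUset normG; apply/subsetP => n; exact: reflection_norm.
Qed.

(** Conjugation by a reflection n exchanges the two orbits and inverts C: an
element of [orbitwise] acting as a on one orbit commutes with n exactly when
it acts as a^-1 on the other. *)
Definition twist := 'C_orbitwise(reflections).
Canonical twist_group := [group of twist].

(** One reflection is enough: the others differ from it by elements of C, with
which the abelian group [orbitwise] commutes. *)
Lemma twistP n w : n \in reflections ->
  reflect (w \in orbitwise /\ w ^ n = w) (w \in twist).
Proof.
move=> Rn; apply: (iffP setIP) => -[Lw Cw]; split=> //.
  by rewrite /conjg (centP Cw) // mulKg.
apply/centP => m Rm; have Lnm : m * n \in orbitwise.
  by apply: (subsetP sub_orbitwise); apply: reflection_mul.
have -> : m = (m * n) * n by rewrite -{2}(n_inv Rn) mulgK.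
apply: commuteM; last by apply/commgP/conjg_fixP.
exact: (centsP orbitwise_abelian).
Qed.

Lemma twist_norm g : g \in S -> g \in 'N(C) -> g \in 'N(twist).
Proof.
move=> Sg Ng; rewrite -sub1set normsI ?sub1set ?orbitwise_norm //.
rewrite -sub1set norms_cent // sub1set inE.
by apply/subsetP => _ /imsetP[n Rn ->]; apply: reflection_conj.
Qed.

Lemma twist_act n w x : n \in reflections -> w \in twist -> w (n x) = n (w x).
Proof.
by move=> Rn tw; have [_ wn] := twistP _ Rn tw; rewrite -{1}wn permJ.
Qed.

(** Let c1 act as c on one orbit and trivially on the other; then c1 c1^n is fixed
by n and acts as c on the first orbit. *)
Lemma twist_nontrivial : twist != 1.
Proof.
have [x Dx] := Dinh; have [n Rn] := reflection_exists.
have [Sn n2 _ swn] := reflectionP _ Rn.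
have /trivgPn[c Cc c1] : C :!=: 1 by rewrite -cardG_gt1 cardC prime_gt1.
pose c1' := restr_perm (orb x) c.
have Nc : c \in 'N(orb x | 'P).
  rewrite !inE; apply/subsetP => y xy; rewrite inE.
  by apply: orb_trans xy; apply: mem_orb_act.
have cE y : y \in orb x -> c1' y = c y by move=> xy; rewrite /c1' restr_permE.
have c'E y : y \notin orb x -> c1' y = y.
  by move=> xy; rewrite /c1' (out_perm (restr_perm_on _ _)).
have orb_act y a : a \in C -> (a y \in orb x) = (y \in orb x).
  move=> Ca; apply/idP/idP => [ay|]; last first.
    by apply: orb_trans; apply: mem_orb_act.
  by apply: orb_trans ay; rewrite orb_sym mem_orb_act.
have Lc : c1' \in orbitwise.
  apply/orbitwiseP; split.
  - rewrite inE; apply: subset_trans (restr_perm_on _ _) (orb_sub Dx).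
  - apply/centP => a Ca; apply/permP => y; rewrite !permM.
    have [xy|xy] := boolP (y \in orb x); last by rewrite !c'E ?orb_act.
    by rewrite !cE ?orb_act // -!permM (centsP semiregular_abelian).
  move=> y Dy; have [xy|xy] := boolP (y \in orb x); last by rewrite c'E ?orbit_refl.
  by rewrite cE // mem_orb_act.
have Lcn : c1' ^ n \in orbitwise by rewrite memJ_norm // orbitwise_norm // reflection_norm.
have tw : c1' * c1' ^ n \in twist.
  apply/(twistP _ Rn); split; first by rewrite groupM.
  rewrite conjMg -conjgM -[n * n]expg2 n2 conjg1.
  exact: (centsP orbitwise_abelian).
apply/trivgPn; exists (c1' * c1' ^ n); rewrite //.
apply: contraNneq c1 => w1; apply/eqP; apply: (semiregular_eq Dx) => //.
rewrite perm1 -[RHS]perm1 -w1 permM cE ?orbit_refl //.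
have nnE : n (n (c x)) = c x by rewrite -permM -expg2 n2 perm1.
rewrite -[in RHS]nnE permJ c'E ?nnE //; apply: contra (swn (c x) _) => [ncx|].
  by apply: orb_trans ncx _; rewrite orb_sym mem_orb_act.
by rewrite Sym_mem // (subsetP sCS).
Qed.

Lemma twist_orbitwise : twist \subset orbitwise. Proof. exact: subsetIl. Qed.

Lemma twist_free w x : w \in twist -> x \in D -> w x = x -> w = 1.
Proof.
move=> tw Dx wx; have [n Rn] := reflection_exists.
have [Sn _ _ swn] := reflectionP _ Rn.
apply: (orbitwise_eq Dx _ (swn x Dx)); rewrite ?group1 ?perm1 ?Sym_mem //.
  exact: (subsetP twist_orbitwise).
by rewrite twist_act ?wx.
Qed.

Lemma twist_semiregular : semiregular_on D p twist.
Proof.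
have sLS : orbitwise \subset S by apply/subsetP => g /orbitwiseP[].
have free : {in D, forall x, 'C_twist[x | 'P] = 1}.
  move=> x Dx; apply/trivgP/subsetP => w /setIP[tw /astab1P wx].
  by rewrite inE; apply/eqP; apply: twist_free tw Dx _.
split=> //; first exact: subset_trans twist_orbitwise sLS.
have [x Dx] := Dinh.
have le_p : #|twist| <= p.
  rewrite -(card_orb Dx) -(card_orbit_stab 'P [group of twist] x) free // cards1 muln1.
  apply/subset_leq_card/subsetP => y /orbitP[w tw <-].
  by have /orbitwiseP[_ _] := subsetP twist_orbitwise w tw; apply.
have /p_natP[k Dk] : p.-group twist
  by apply: pgroupS twist_orbitwise (abelem_pgroup orbitwise_abelem).
have := twist_nontrivial; rewrite -cardG_gt1 Dk; move: le_p; rewrite Dk.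
case: k {Dk} => [|[|k]] //.
have := ltn_exp2l 1 k.+2 (prime_gt1 p_pr); rewrite expn1 => lt_p.
by rewrite leqNgt lt_p.
Qed.

Lemma twist_TI : C :&: twist = 1.
Proof.
have [n Rn] := reflection_exists; have [_ _ invn _] := reflectionP _ Rn.
apply/trivgP/subsetP => w /setIP[Cw /(twistP _ Rn)[_ wn]].
have w2 : w ^+ 2 = 1 by rewrite expgS expg1 -{1}wn invn // mulVg.
rewrite inE -order_eq1 -dvdn1 -(eqP (_ : coprime 2 p)) ?coprime2n //.
by rewrite dvdn_gcd order_dvdn w2 eqxx -cardC order_dvdG.
Qed.

Lemma orbitwise_eq_mul : orbitwise = C * twist.
Proof.
apply/esym/eqP; rewrite eqEcard mul_subG ?sub_orbitwise ?twist_orbitwise //.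
have [_ cardt _] := twist_semiregular.
by rewrite TI_cardMg ?twist_TI // cardC cardt card_orbitwise.
Qed.

(** The eigenvalue changes sign because w acts as a at x and as a^-1 at g x, which
lies in the other orbit. *)
Lemma twist_conj_swap g k w : g \in S -> g \in 'N(C) -> ~~ fixes_orbits g ->
  {in C, forall a, a ^ g = a ^+ k} -> w \in twist -> w ^ g = (w ^+ k)^-1.
Proof.
move=> Sg Ng sg gk tw; have Lw := subsetP twist_orbitwise w tw.
have Sw : w \in S by case/orbitwiseP: Lw.
have [n Rn] := reflection_exists; have [Sn _ invn swn] := reflectionP _ Rn.
apply: Sym_eq; rewrite ?groupJ ?groupV ?groupX // => z Dz.
set x := g^-1 z; have Dx : x \in D by rewrite Sym_mem ?groupV.
have [a Ca wa] := orbitwise_act Lw Dx.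
have -> : z = g x by rewrite permKV.
rewrite permJ wa ?orbit_refl // -permJ gk //.
apply: (@perm_inj _ (w ^+ k)); rewrite permKV.
have Dnx : n x \in D by rewrite Sym_mem.
have gnx : g x \in orb (n x).
  have Dgx : g x \in D by rewrite Sym_mem.
  by apply: (two_orbits Dx Dnx Dgx (swn x Dx)); rewrite -fixes_orbitsP.
have wan : {in orb (n x), w =1 a^-1}.
  have [b Cb wb] := orbitwise_act Lw Dnx.
  suffices <- : b = a^-1 by [].
  apply: (semiregular_eq Dnx); rewrite ?groupV // -wb ?orbit_refl //.
  by rewrite (twist_act _ Rn tw) wa ?orbit_refl // -permJ invn.
rewrite (orbitwise_expg k wan) ?groupV //; last first.
  by apply: orb_trans gnx; rewrite mem_orb_act ?groupX.
by rewrite expgVn permK.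
Qed.

(** On a single orbit [orbitwise] acts through C, which has prime order: any
element that moves a point of the orbit generates the whole action there. *)
Lemma orbitwise_generates q x a : q \in orbitwise -> x \in D -> q x != x -> a \in C ->
  exists i, {in orb x, a =1 q ^+ i}.
Proof.
move=> Lq Dx qx Ca; have [a0 Ca0 qa] := orbitwise_act Lq Dx.
have a0_neq1 : a0 != 1.
  by apply: contraNneq qx => a01; rewrite qa ?orbit_refl // a01 perm1.
have DC : C :=: <[a0]>.
  have oa0 : #[a0] = p by apply: nt_prime_order; rewrite // -cardC expg_cardG.
  by apply/esym/eqP; rewrite eqEcard cycle_subG Ca0 cardC -orderE oa0 leqnn.
have /cycleP[i Di] : a \in <[a0]> by rewrite -DC.
by exists i => y xy; rewrite (orbitwise_expg i qa) // Di.
Qed.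

End SemiregularSubgroup.

(** * The two regular dihedral subgroups normalised by a transitive group *)

Section Count.
Variables (T : finType) (D : {set T}) (p : nat).
Hypotheses (p_pr : prime p) (p_odd : odd p) (cardD : #|D| = (2 * p)%N).
Implicit Types (x y z : T) (a c g h n : {perm T}) (C : {group {perm T}}).

Local Notation S := (perm.Sym D).

Lemma point_exists : exists x, x \in D.
Proof. by apply/card_gt0P; rewrite cardD muln_gt0 (prime_gt0 p_pr). Qed.

(** The p-elements of G lie in the orbitwise groups of both C and C'; as they move
every point by transitivity, their powers describe both C and C' locally, and
C' is contained in [orbitwise D C].  An element g of G exchanging the orbits of
C has eigenvalues k on C and -k on [twist], distinct as p is odd, and C' is
one of the two eigenlines. *)
Lemma semiregular_unique C (semiC : semiregular_on D p C) (G C' : {group {perm T}}) :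
    G \subset S -> G \subset 'N(C) -> [transitive G, on D | 'P] ->
    semiregular_on D p C' -> G \subset 'N(C') ->
  C' :=: C \/ C' :=: twist D C.
Proof.
move=> sGS nGC Gtr semiC' nGC'; have [sC'S cardC' _] := semiC'; have [sCS cardC _] := semiC.
have [x0 D0] := point_exists.
have moved x : x \in D -> exists q, [/\ q \in G, p.-elt q & q x != x].
  move=> Dx; have pG : p %| #|G|.
    rewrite -(card_orbit_stab 'P G x) (atransP Gtr) // cardD.
    by rewrite -mulnA dvdn_mull // dvdn_mulr.
  have [q Gq oq] := Cauchy p_pr pG.
  have [y Dy qy] : exists2 y, y \in D & q y != y.
    apply/exists_inP; rewrite -negb_forall_in; apply/negP => /forall_inP fixq.
    have q1 : q = 1.
      apply: (Sym_eq (D := D)); rewrite ?group1 ?(subsetP sGS) // => y Dy.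
      by rewrite perm1; apply/eqP/fixq.
    by move: (prime_gt1 p_pr); rewrite -oq q1 order1.
  have [g Gg Dxg] := atransP2 Gtr Dy Dx.
  exists (q ^ g); split; first by rewrite groupJ.
    by rewrite p_eltJ /p_elt oq pnat_id.
  by rewrite Dxg /= /aperm permJ (inj_eq perm_inj).
have sC'L : C' \subset orbitwise D C.
  apply/subsetP => z C'z; have Sz := subsetP sC'S z C'z.
  have key x : x \in D -> exists q, exists i,
      [/\ q \in orbitwise D C, q \in 'C(C'), z x = (q ^+ i) x & q x != x].
    move=> Dx; have [q [Gq pq qx]] := moved x Dx.
    have Sq := subsetP sGS q Gq; have Nq := subsetP nGC q Gq.
    have L'q := p_elt_orbitwise p_pr p_odd cardD semiC' Sq (subsetP nGC' q Gq) pq.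
    have [i zi] := orbitwise_generates p_pr semiC' L'q Dx qx C'z.
    exists q, i; split=> //; first exact: (p_elt_orbitwise p_pr p_odd cardD semiC).
      by case/(orbitwiseP semiC'): L'q.
    by rewrite zi ?orbit_refl.
  apply/(orbitwiseP semiC); split=> // [|x Dx]; last first.
    have [q [i [Lq _ -> _]]] := key x Dx.
    have /(orbitwiseP semiC)[_ _ Lqi] := groupX i Lq.
    exact: Lqi.
  apply/centP => a Ca; apply: (Sym_eq (D := D)); rewrite ?groupM ?(subsetP sCS a Ca) // => x Dx.
  have [q [i [Lq C'q zx qx]]] := key x Dx.
  have [j aj] := orbitwise_generates p_pr semiC Lq Dx qx Ca.
  have zxC : z x \in orbit 'P C x.
    have /(orbitwiseP semiC)[_ _ Lqi] := groupX i Lq.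
    by rewrite zx Lqi.
  have C'qj : q ^+ j \in 'C(C') by rewrite groupX.
  by rewrite !permM (aj x) ?orbit_refl // (aj (z x)) // -!permM (centP C'qj z C'z).
have [n Rn] := reflection_exists p_pr cardD semiC.
have /reflectionP[Sn _ _ swn] := Rn.
have Dnx0 : n x0 \in D by rewrite Sym_mem.
have [g Gg gx0] := atransP2 Gtr D0 Dnx0.
have Sg := subsetP sGS g Gg; have Ng := subsetP nGC g Gg.
have sg : ~~ fixes_orbits D C g
  by rewrite (fixes_orbitsP cardD semiC Sg Ng D0) -[g x0]/('P%act x0 g) -gx0 swn.
have power (A : {group {perm T}}) : #|A| = p -> g \in 'N(A) ->
    exists k, {in A, forall a, a ^ g = a ^+ k}.
  move=> cardA NA; have /cyclicP[a DA] : cyclic A by rewrite prime_cyclic ?cardA.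
  have /cycleP[k Dk] : a ^ g \in <[a]> by rewrite -DA memJ_norm // DA cycle_id.
  exists k => b; rewrite DA => /cycleP[i ->].
  by rewrite conjXg Dk -!expgM mulnC.
have [k gk] := power C cardC Ng; have [l gl] := power C' cardC' (subsetP nGC' g Gg).
have /cyclicP[z DC'] : cyclic C' by rewrite prime_cyclic ?cardC'.
have C'z : z \in C' by rewrite DC' cycle_id.
have [_ cardt _] := twist_semiregular p_pr cardD semiC.
have /mulsgP[u w Cu tw Dz] : z \in C * twist D C
  by rewrite -(orbitwise_eq_mul p_pr p_odd cardD semiC) (subsetP sC'L).
have Lu : u \in orbitwise D C by apply: (subsetP (sub_orbitwise p_pr semiC)).
have Lw : w \in orbitwise D C by apply: (subsetP (twist_orbitwise D C)).
have cuw : commute u w by apply: (centsP (orbitwise_abelian p_pr semiC)).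
(* Write a generator of C' as u w and compare the two expressions of (u w)^g:
   both sides are in C and in the twist, hence trivial. *)
have ukl : u ^- l * u ^+ k = w ^+ l * w ^+ k.
  have := gl z C'z; rewrite Dz conjMg gk // (twist_conj_swap p_pr cardD semiC Sg Ng sg gk tw).
  rewrite expgMn // => e.
  by apply: (mulgI (u ^+ l)); rewrite mulKVg mulgA -e mulgKV.
have fin (x : {perm T}) : x \in orbitwise D C -> x != 1 -> #[x] = p.
  move=> Lx x1; apply: nt_prime_order => //.
  by have /(abelemP p_pr)[_ ->] := orbitwise_abelem p_pr semiC.
have [u1 | u1] := eqVneq u 1.
  right; apply/eqP; rewrite eqEcard cardt cardC' leqnn andbT DC' cycle_subG Dz u1 mul1g.
  exact: tw.
have [w1 | w1] := eqVneq w 1.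
  left; apply/eqP; rewrite eqEcard cardC cardC' leqnn andbT DC' cycle_subG Dz w1 mulg1.
  exact: Cu.
have /andP[/eqP ukl1 /eqP wlk1] : (u ^- l * u ^+ k == 1) && (w ^+ l * w ^+ k == 1).
  have : u ^- l * u ^+ k \in C :&: twist D C.
    by rewrite inE {2}ukl !groupM ?groupV ?groupX.
  by rewrite (twist_TI p_pr p_odd cardD semiC) -ukl andbb => /set1P->.
exfalso.
have p_kl : p %| l + k by rewrite -(fin w) // order_dvdn expgD wlk1.
have /eqP : u ^+ l = u ^+ k by apply/eqP; rewrite eq_mulVg1 ukl1.
rewrite eq_expg_mod_order fin // => /eqP kl.
have : p %| k + k by rewrite /dvdn -modnDml -kl modnDml.
rewrite addnn -mul2n Euclid_dvdM // dvdn_prime2 // => /orP[/eqP p2|pk].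
  by move: p_odd; rewrite p2.
have := gk u Cu; rewrite -(divnK pk) mulnC expgM -(fin u) // expg_order expg1n.
by move/eqP; rewrite conjg_eq1 (negPf u1).
Qed.

(** Freeness of N forces a reflection n to exchange the orbits of C: if it mapped x
to a x with a in C, it would be equal to a. *)
Lemma regular_dihedral_hull (N : {group {perm T}}) :
    regular_on D N -> N \isog 'D_(2 * p) ->
  exists C, semiregular_on D p C /\ N :=: dihedral_hull D C.
Proof.
move=> [sNS Ntr free] isoN.
have cardN : #|N| = (2 * p)%N by rewrite (card_isog isoN) mul2n card_dihedral ?prime_gt1.
have := isog_hom isoN; rewrite mul2n Grp_dihedral ?prime_gt1 //.
case/existsP=> -[c n] /= /eqP[defN cp n2 cn].
have Nn : n \in 'N(<[c]>).
  by rewrite inE -cycleJ cn cycleV.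
have sNn : <[n]> \subset 'N(<[c]>) by rewrite cycle_subG.
have oc : #[c] %| p by rewrite order_dvdn cp.
have on : #[n] %| 2 by rewrite order_dvdn n2.
have cardc : #[c] = p.
  apply/eqP; rewrite eqn_leq (dvdn_leq (prime_gt0 p_pr) oc) /=.
  rewrite -(leq_pmul2l (isT : 0 < 2)) -cardN -defN norm_joinEr // mulnC.
  apply: leq_trans (leq_trans (_ : _ <= #|<[c]>| * #|<[n]>|)%N _); first exact: leqnn.
    by rewrite mul_cardG leq_pmulr ?cardG_gt0.
  by rewrite -!orderE leq_mul // dvdn_leq.
have sCN : <[c]> \subset N by rewrite -defN joing_subl.
have nN : n \in N by rewrite -defN (subsetP (joing_subr _ _)) ?cycle_id.
have semiC : semiregular_on D p <[c]>%G.
  split; [exact: subset_trans sNS | by rewrite /= -orderE | move=> x Dx].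
  by apply/trivgP; rewrite -(free x Dx) setSI.
exists <[c]>%G; split=> //.
have Rn : n \in reflections D <[c]>%G.
  apply/reflectionP; split=> [||a /cycleP[i ->]|x Dx] //; first exact: (subsetP sNS).
    by rewrite conjXg cn expgVn.
  apply/negP => /orbP[a Ca an].
  have : a * n^-1 \in 'C_N[x | 'P].
    have Na := subsetP sCN a Ca; apply/setIP; split; first by rewrite groupM ?groupV.
    by apply/astab1P; rewrite /= /aperm permM an permK.
  rewrite free // inE -eq_mulgV1 => /eqP Da.
  have n1 : n = 1.
    apply/eqP; rewrite -order_eq1 -dvdn1 -(eqP (_ : coprime 2 p)) ?coprime2n //.
    by rewrite dvdn_gcd on /= -cardc orderE order_dvdG // -Da.
  have : #|N| <= p.
    by rewrite -defN n1 cycle1 joingG1 -orderE cardc.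
  by rewrite cardN leqNgt mul2n -addnn -{1}[p]addn0 ltn_add2l prime_gt0.
apply/eqP; rewrite eq_sym eqEcard (card_dihedral_hull p_pr p_odd cardD semiC) cardN leqnn andbT.
rewrite (dihedral_hullE p_pr cardD semiC Rn) mul_subG // cycle_subG //.
Qed.

Lemma dihedral_normalizer (G N : {group {perm T}}) C :
    semiregular_on D p C -> N :=: dihedral_hull D C -> G \subset perm.Sym D ->
  (G \subset 'N(N)) = (G \subset 'N(C)).
Proof.
move=> semiC DN sGS; rewrite DN; apply/idP/idP => [nGN | nGC].
  rewrite -{1}(dihedral_hull_pcore p_pr p_odd cardD semiC).
  exact: gFnorm_trans nGN.
by apply/subsetP => g Gg; apply: dihedral_hull_norm; [apply: (subsetP sGS) | apply: (subsetP nGC)].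
Qed.

Definition dihedral_regular (G N : {group {perm T}}) : Prop :=
  [/\ regular_on D N, G \subset 'N(N) & N \isog 'D_(2 * p)].

Lemma dihedral_regularP (G : {group {perm T}}) : G \subset perm.Sym D ->
  (exists N, dihedral_regular G N) <->
  (exists C, semiregular_on D p C /\ G \subset 'N(C)).
Proof.
move=> sGS; split=> [[N [Nreg nGN isoN]] | [C [semiC nGC]]].
  have [C [semiC DN]] := regular_dihedral_hull Nreg isoN.
  by exists C; split=> //; rewrite -(dihedral_normalizer semiC DN sGS).
exists (dihedral_hull_group D C); split.
- by apply (dihedral_hull_regular p_pr p_odd cardD semiC).
- by rewrite (dihedral_normalizer semiC (erefl _) sGS).
by apply (dihedral_hull_isog p_pr p_odd cardD semiC).
Qed.

Theorem dihedral_regular_count (G C : {group {perm T}}) :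
    G \subset perm.Sym D -> [transitive G, on D | 'P] ->
    semiregular_on D p C -> G \subset 'N(C) ->
  exists N1 N2, [/\ N1 <> N2, dihedral_regular G N1, dihedral_regular G N2 &
    forall N, dihedral_regular G N -> N = N1 \/ N = N2].
Proof.
move=> sGS Gtr semiC nGC; pose Ct := twist_group D C.
have semiCt : semiregular_on D p Ct by apply (twist_semiregular p_pr cardD semiC).
have nGCt : G \subset 'N(Ct).
  apply/subsetP => g Gg; apply (twist_norm cardD semiC);
    [exact: (subsetP sGS) | exact: (subsetP nGC)].
have hull_ok (A : {group {perm T}}) : semiregular_on D p A -> G \subset 'N(A) ->
    dihedral_regular G (dihedral_hull_group D A).
  move=> semiA nGA; split; first by apply (dihedral_hull_regular p_pr p_odd cardD semiA).
    by rewrite (dihedral_normalizer semiA (erefl _) sGS).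
  by apply (dihedral_hull_isog p_pr p_odd cardD semiA).
exists (dihedral_hull_group D C), (dihedral_hull_group D Ct); split.
- move/(congr1 (fun N : {group _} => 'O_p(N))).
  rewrite (dihedral_hull_pcore p_pr p_odd cardD semiC).
  rewrite (dihedral_hull_pcore p_pr p_odd cardD semiCt) => eqC.
  have := twist_TI p_pr p_odd cardD semiC; rewrite -[twist D C]eqC setIid => C1.
  by have [_ cardC _] := semiC; move: (prime_gt1 p_pr); rewrite -cardC C1 cards1.
- exact: hull_ok.
- exact: hull_ok.
move=> N [Nreg nGN isoN]; have [C' [semiC' DN]] := regular_dihedral_hull Nreg isoN.
have nGC' : G \subset 'N(C') by rewrite -(dihedral_normalizer semiC' DN sGS).
have [DC' | DC'] := semiregular_unique semiC sGS nGC Gtr semiC' nGC'; [left | right];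
  apply: val_inj; rewrite /= DN.
  by congr (dihedral_hull D _); apply: val_inj.
by congr (dihedral_hull D _); apply: val_inj.
Qed.

End Count.

(** * Structure of the transitive groups that normalise a semiregular subgroup *)

Lemma cyclic_Zp n : cyclic (Zp n).
Proof.
rewrite /Zp; case: ifP => _; last exact: cyclic1.
by rewrite Zp_cycle cycle_cyclic.
Qed.

Lemma isog_Zp (gT : finGroupType) (G : {group gT}) n :
  cyclic G -> #|G| = n -> G \isog Zp n.
Proof.
move=> cG <-; rewrite (isog_cyclic_card (Zp_group #|G|) cG).
by rewrite cyclic_Zp card_Zp ?cardG_gt0 /=.
Qed.

Lemma isog_dprod_setX (gT aT bT : finGroupType) (G H K : {group gT})
    (A : {group aT}) (B : {group bT}) :
  H \x K = G -> H \isog A -> K \isog B -> G \isog setX A B.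
Proof.
move=> defG isoA isoB; apply: (isog_dprod defG (setX_dprod A B)).
  exact: isog_trans isoA (isog_setX1 _ A).
exact: isog_trans isoB (isog_set1X _ B).
Qed.

Lemma abelem_setX_Zp p : prime p -> p.-abelem (setX (Zp p) (Zp p)).
Proof.
move=> p_pr; have abZ : p.-abelem (Zp p).
  by rewrite prime_abelem // card_Zp // prime_gt0.
rewrite (dprod_abelem _ (setX_dprod _ _)) -(isog_abelem (isog_setX1 _ _)).
by rewrite -(isog_abelem (isog_set1X _ _)) !abZ.
Qed.

Section Cases.
Variables (T : finType) (D : {set T}) (p : nat).
Hypotheses (p_pr : prime p) (p_odd : odd p) (cardD : #|D| = (2 * p)%N).
Variable G : {group {perm T}}.
Hypothesis sGS : G \subset perm.Sym D.
Hypothesis Gtr : [transitive G, on D | 'P].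

Local Notation S := (perm.Sym D).

(** The point stabilisers in Q are conjugate under G, and trivial or equal to Q by
primality; if one of them were Q, all of them would be. *)
Lemma normal_semiregular (Q : {group {perm T}}) :
  Q <| G -> #|Q| = p -> semiregular_on D p Q.
Proof.
move=> /andP[sQG nQG] cardQ; split=> // [|x Dx]; first exact: subset_trans sQG sGS.
have prQ : prime #|Q| by rewrite cardQ.
have := prime_subgroupVti 'C_Q[x | 'P]%G prQ.
rewrite /= setIAC setIid => -[sQ | ->]; last by [].
have fixQ : Q \subset 'C(D | 'P).
  apply/subsetP => q Qq; apply/astabP => y Dy.
  have [g Gg ->] := atransP2 Gtr Dx Dy.
  have /(subsetP sQ)/setIP[_ /astab1P qx] : q ^ g^-1 \in Q
    by rewrite memJ_norm ?groupV ?(subsetP nQG).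
  by move: qx; rewrite /= /aperm => qx; rewrite -{1}(conjgKV g q) permJ qx.
have Q1 : Q :=: 1.
  apply/trivgP/subsetP => q Qq; rewrite inE; apply/eqP.
  apply: (Sym_eq (D := D)); rewrite ?group1 ?(subsetP sGS) ?(subsetP sQG) // => y Dy.
  by rewrite perm1; apply: (astabP (subsetP fixQ q Qq)).
by move: prQ; rewrite Q1 cards1.
Qed.

Section Forward.
Variable C : {group {perm T}}.
Hypotheses (semiC : semiregular_on D p C) (nGC : G \subset 'N(C)).

Let cardC : #|C| = p. Proof. by case: semiC. Qed.
Let Q := (G :&: orbitwise D C)%G.

Lemma orbitwise_part_normal : Q <| G.
Proof.
rewrite /normal subsetIl normsI ?normG //; apply/subsetP => g Gg.
by apply: (orbitwise_norm cardD semiC); [apply: (subsetP sGS) | apply: (subsetP nGC)].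
Qed.

Let abelQ : p.-abelem Q.
Proof. exact: abelemS (subsetIr _ _) (orbitwise_abelem p_pr semiC). Qed.

Let sylQ : p.-Sylow(G) Q.
Proof.
have [P sylP sQP] := Sylow_superset (normal_sub orbitwise_part_normal) (abelem_pgroup abelQ).
suffices -> : Q :=: P by [].
apply/eqP; rewrite eqEsubset sQP; apply/subsetP => g Pg.
have Gg := subsetP (pHall_sub sylP) g Pg.
rewrite inE Gg /=; apply: (p_elt_orbitwise p_pr p_odd cardD semiC).
- exact: (subsetP sGS).
- exact: (subsetP nGC).
exact: mem_p_elt (pHall_pgroup sylP) Pg.
Qed.

Lemma cyclic_faithful (K : {group {perm T}}) :
  K \subset 'N(C) -> 'C_K(C) = 1 -> cyclic K /\ #|K| %| p.-1.
Proof.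
move=> nKC K1.
have inj : 'injm (restrm nKC (conj_aut C)) by rewrite ker_restrm ker_conj_aut K1.
have isoK := sub_isog (subxx K) inj.
have sub : restrm nKC (conj_aut C) @* K \subset Aut C.
  by rewrite morphim_restrm setIid; apply: Aut_conj_aut.
split; first by rewrite (isog_cyclic isoK) (cyclicS sub) // Aut_prime_cyclic ?cardC.
rewrite (card_isog isoK); apply: dvdn_trans (cardSg sub) _.
by rewrite card_Aut_cyclic ?prime_cyclic ?cardC // totient_prime.
Qed.

Let cardQ : #|Q| = p \/ #|Q| = (p ^ 2)%N.
Proof.
have pG : p %| #|G|.
  have [x Dx] := point_exists p_pr cardD.
  rewrite -(card_orbit_stab 'P G x) (atransP Gtr) // cardD.
  by rewrite -mulnA dvdn_mull // dvdn_mulr.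
have le_p2 : #|Q| <= p ^ 2.
  apply: leq_trans (card_orbitwise p_pr cardD semiC).
  by apply: subset_leq_card; apply: subsetIr.
have /p_natP[k Dk] := abelem_pgroup abelQ.
have k_gt0 : 0 < k.
  rewrite lt0n; apply: contraL pG => /eqP k0.
  have /and3P[sQG _ p'Q] := sylQ.
  by rewrite -(Lagrange sQG) Dk k0 mul1n -p'natE.
move: le_p2; rewrite Dk leq_exp2l ?prime_gt1 // => k_le2.
by case: k k_gt0 k_le2 Dk => [|[|[|k]]] // _ _ Dk; [left | right].
Qed.

(** Q is a normal Sylow subgroup; let H be a complement, H0 the subgroup of H
fixing the orbits of C, and Z the centraliser of C in H.  H0 meets Z inside
the intersection of Q and H, so it is trivial, and two elements of Z outside
H0 have a product in that intersection: Z is trivial or generated by a central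
involution t of H.  In the first case H itself embeds in the automorphism group
of C.  In the second one H is the direct product of H0 and t.  The fourth
alternative is conditional because t centralises C, and hence forms with Q a
cyclic group of order 2p when C = Q. *)
Lemma forward_cases :
  [\/ case_i p G, case_ii p G, case_iv p G | #|Q| = p /\ (C :=: Q -> case_iii p G)].
Proof.
have hallQ : Hall G Q := pHall_Hall sylQ.
have /splitsP[H /complP[tiQH defG]] := SchurZassenhaus_split hallQ orbitwise_part_normal.
have sHG : H \subset G by rewrite -defG mulG_subr.
have [sQG nQG] := andP orbitwise_part_normal.
have nQH : H \subset 'N(Q) := subset_trans sHG nQG.
have sdG : Q ><| H = G by rewrite sdprodE.
have SH h : h \in H -> h \in S by move=> Hh; apply: (subsetP sGS); apply: (subsetP sHG).
have nCH : H \subset 'N(C) := subset_trans sHG nGC.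
have NH h : h \in H -> h \in 'N(C) by apply: (subsetP nCH).
pose H0 := (H :&: orbit_kernel D C)%G; pose Z := 'C_H(C)%G.
have tiZ : 'C_H0(C) = 1.
  apply/trivgP/subsetP => z /setIP[/setIP[Hz kz] Cz].
  suffices: z \in Q :&: H by rewrite tiQH.
  by apply/setIP; split=> //; apply/setIP; split; [apply: (subsetP sHG) | apply/setIP].
have sH0H : H0 \subset H := subsetIl _ _.
have [cycH0 dvdH0] := cyclic_faithful (subset_trans sH0H nCH) tiZ.
(* G is transitive and the elements of Q fix the orbits. *)
have [h Hh swh] : exists2 h, h \in H & h \notin orbit_kernel D C.
  have [x Dx] := point_exists p_pr cardD.
  have [y Dy xy] := second_orbit p_pr cardD semiC Dx.
  have [g Gg Dy'] := atransP2 Gtr Dx Dy.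
  have: g \in Q * H by rewrite defG.
  case/mulsgP=> q h Qq Hh Dg; exists h => //; apply: contra xy => kh.
  have kq : q \in orbit_kernel D C by move: Qq; rewrite !inE => /andP[_ /andP[]].
  have /(orbit_kernelP semiC)[_ _ /forall_inP/(_ x Dx)] : q * h \in orbit_kernel D C
    by rewrite groupM.
  by rewrite -Dg Dy'.
have evenH : ~~ odd #|H|.
  apply: contra swh => oddH; apply: (odd_orbit_kernel cardD semiC); rewrite ?SH ?NH //.
  exact: dvdn_odd (order_dvdG Hh) oddH.
have isoQ : #|Q| = (p ^ 2)%N -> Q \isog setX (Zp p) (Zp p).
  move=> oQ; rewrite (isog_abelem_card _ abelQ) abelem_setX_Zp //=.
  by rewrite cardsX card_Zp ?prime_gt0 // oQ.
have isoQ1 : #|Q| = p -> Q \isog Zp p.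
  by move=> oQ; apply: isog_Zp; rewrite // prime_cyclic ?oQ.
have [Z1 | ntZ] := eqVneq 'C_H(C) 1.
  have [cycH dvdH] := cyclic_faithful nCH Z1.
  have isoH : H \isog Zp #|H| by apply: isog_Zp.
  have [oQ | oQ] := cardQ; [constructor 3 | constructor 1]; exists #|H|; split=> //.
    by exists Q, H; split=> //; apply: isoQ1.
  by exists Q, H; split=> //; apply: isoQ.
have [t Zt t1] : exists2 t, t \in Z & t != 1 by apply/trivgPn.
have [Ht Ct] := setIP Zt.
have not_kernel z : z \in Z -> z != 1 -> z \notin orbit_kernel D C.
  case/setIP=> Hz Cz; apply: contra => kz.
  have: z \in 'C_H0(C) by apply/setIP; split=> //; apply/setIP.
  by rewrite tiZ => /set1P->.
have swap_mulH a b : a \in H -> b \in H -> a \notin orbit_kernel D C -> b \notin orbit_kernel D C ->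
    a * b \in orbit_kernel D C.
  move=> Ha Hb sa sb; apply/(orbit_kernelP semiC); split; rewrite ?groupM ?SH ?NH //.
  apply: (swap_mul cardD semiC); rewrite ?SH ?NH //.
    by apply: contra sa => pa; apply/(orbit_kernelP semiC); split; rewrite ?SH ?NH.
  by apply: contra sb => pb; apply/(orbit_kernelP semiC); split; rewrite ?SH ?NH.
have Z_t z : z \in Z -> z != 1 -> z * t = 1.
  move=> Zz z1; apply/eqP; apply: contraT => zt1.
  have := not_kernel _ (groupM Zz Zt) zt1.
  by rewrite swap_mulH ?not_kernel //; case/setIP: Zz.
have t2 : t ^+ 2 = 1 by rewrite expgS expg1 Z_t.
have ot : #[t] = 2 by apply: nt_prime_order.
have Z_eq z : z \in Z -> z != 1 -> z = t.
  by move=> Zz z1; apply: (mulIg t); rewrite Z_t // -t2.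
have cHt h1 : h1 \in H -> t ^ h1 = t.
  move=> Hh1; apply: Z_eq; last by rewrite conjg_eq1.
  by rewrite memJ_norm // (subsetP _ _ Hh1) // normsI ?normG // norms_cent.
have stZ : <[t]> \subset Z by rewrite cycle_subG.
have stH : <[t]> \subset H by rewrite cycle_subG.
have tiH0t : H0 :&: <[t]> = 1.
  apply/trivgP/subsetP => z /setIP[/setIP[_ kz] tz]; rewrite inE.
  by apply: contraTT kz; apply: not_kernel; apply: (subsetP stZ).
have cH0t : <[t]> \subset 'C(H0).
  rewrite cycle_subG; apply/centP => h1 /setIP[Hh1 _].
  by apply/commgP/conjg_fixP; apply: cHt.
have mulH0t : H0 * <[t]> = H.
  apply/eqP; rewrite eqEsubset mul_subG //=; apply/subsetP => h1 Hh1.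
  have [kh1 | sh1] := boolP (h1 \in orbit_kernel D C).
    by rewrite -(mulg1 h1) mem_mulg // inE Hh1.
  rewrite -(mulgK t h1) mem_mulg ?groupV ?cycle_id //.
  apply/setIP; split; first by rewrite groupM.
  by apply: swap_mulH => //; apply: not_kernel.
have defH : H0 \x <[t]> = H by rewrite dprodE.
have isot : <[t]> \isog Zp 2 by apply: isog_Zp; rewrite ?cycle_cyclic.
have isoH0 : H0 \isog Zp #|H0| by apply: isog_Zp.
have [oQ | oQ] := cardQ; last first.
  (* When H0 has odd order, H is cyclic and its order still divides p-1. *)
  have [oddH0 | evenH0] := boolP (odd #|H0|).
    have cycH : cyclic H.
      by rewrite (cyclic_dprod defH) ?cycle_cyclic // -orderE ot coprimen2.
    constructor 1; exists #|H|; split=> //; last first.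
      by exists Q, H; split=> //; [apply: isoQ | apply: isog_Zp].
    rewrite -(dprod_card defH) -orderE ot Gauss_dvd ?coprimen2 // dvdH0 dvdn2.
    by move: p_odd (prime_gt0 p_pr); case: (p).
  constructor 2; exists #|H0|; split=> //.
  exists Q, H; split=> //; first exact: isoQ.
  have defH' : <[t]> \x H0 = H by rewrite dprodC.
  exact: (isog_dprod_setX (A := Zp_group 2) (B := Zp_group #|H0|) defH' isot isoH0).
constructor 4; split=> // DC.
have cQt : <[t]> \subset 'C(Q) by rewrite -DC cycle_subG.
have tiQt : Q :&: <[t]> = 1.
  by apply/trivgP; rewrite -tiQH setIS // cycle_subG.
have dQt : Q \x <[t]> = Q <*> <[t]> by rewrite dprodEY.
exists #|H0|; split=> //; exists (Q <*> <[t]>)%G, H0; split=> //; last first.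
  apply: isog_Zp; last by rewrite -(dprod_card dQt) oQ -orderE ot mulnC.
  rewrite (cyclic_dprod dQt) ?cycle_cyclic ?prime_cyclic ?oQ // -orderE ot.
  by rewrite coprimen2.
have nQtH0 : H0 \subset 'N(Q <*> <[t]>).
  apply: normsY; first exact: subset_trans sH0H nQH.
  by rewrite cents_norm // centsC.
have defQt : Q <*> <[t]> = Q * <[t]> by rewrite norm_joinEr // cents_norm.
have tiQtH0 : (Q <*> <[t]>) :&: H0 = 1.
  apply/trivgP/subsetP => z /setIP[Qtz H0z].
  have : z \in Q * <[t]> by rewrite -defQt.
  case/mulsgP=> q s Qq ts Dz.
  have Hs : s \in H by apply: (subsetP stH).
  have q1 : q = 1.
    suffices: q \in Q :&: H by rewrite tiQH => /set1P.
    apply/setIP; split=> //; rewrite -(mulgK s q) -Dz groupM ?groupV //.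
    exact: (subsetP sH0H).
  suffices: z \in H0 :&: <[t]> by rewrite tiH0t.
  by rewrite inE H0z Dz q1 mul1g.
rewrite (sdprodE nQtH0 tiQtH0); change (Q <*> <[t]> * H0 = G).
by rewrite defQt -mulgA (centC cH0t) mulH0t.
Qed.

End Forward.
End Cases.

Lemma expg_pair (aT bT : finGroupType) (w : aT * bT) n :
  w ^+ n = (w.1 ^+ n, w.2 ^+ n).
Proof. by elim: n => [|n IHn] //; rewrite !expgS IHn. Qed.

Lemma exponent_C2_Cm (gT : finGroupType) (B : {group gT}) m :
  0 < m -> ~~ odd m -> B \isog setX (Zp 2) (Zp m) ->
  abelian B /\ {in B, forall b, b ^+ m = 1}.
Proof.
move=> m_gt0 even_m isoB; split.
  rewrite (isog_abelian isoB); apply/centsP => -[x y] /setXP[/= Zx Zy].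
  move=> [x' y'] /setXP[/= Zx' Zy'].
  by congr (_, _); [apply: (centsP (cyclic_abelian (cyclic_Zp 2)))
                   | apply: (centsP (cyclic_abelian (cyclic_Zp m)))].
case/isogP: isoB => f injf Df b Bb; apply: (injmP injf); rewrite ?groupX ?group1 //.
rewrite morphX // morph1 expg_pair.
have: f b \in setX (Zp 2) (Zp m) by rewrite -Df mem_morphim.
case: (f b) => x y /setXP[/= Zx Zy]; congr (_, _); apply/eqP; rewrite -order_dvdn.
  by apply: dvdn_trans (order_dvdG Zx) _; rewrite card_Zp // dvdn2.
by have := order_dvdG Zy; rewrite card_Zp.
Qed.

Section CasesIff.
Variables (T : finType) (D : {set T}) (p : nat).
Hypotheses (p_pr : prime p) (p_odd : odd p) (cardD : #|D| = (2 * p)%N).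
Variable G : {group {perm T}}.
Hypothesis sGS : G \subset perm.Sym D.
Hypothesis Gtr : [transitive G, on D | 'P].

Local Notation S := (perm.Sym D).

(** When Q has order p it is itself semiregular and normalised by G, and one may
start again with C := Q, for which C = Q does hold. *)
Lemma cases_of_semiregular (C : {group {perm T}}) :
    semiregular_on D p C -> G \subset 'N(C) ->
  [\/ case_i p G, case_ii p G, case_iii p G | case_iv p G].
Proof.
move=> semiC nGC.
have [||| [oQ _]] := forward_cases p_pr p_odd cardD sGS Gtr semiC nGC;
  [by constructor 1 | by constructor 2 | by constructor 4 |].
pose Q := (G :&: orbitwise D C)%G.
have orbitwise_part_normal : Q <| G := orbitwise_part_normal cardD sGS semiC nGC.
have semiQ : semiregular_on D p Q := normal_semiregular p_pr sGS Gtr orbitwise_part_normal oQ.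
have [||| [oQ' DQ]] :=
  forward_cases p_pr p_odd cardD sGS Gtr semiQ (normal_norm orbitwise_part_normal);
  [by constructor 1 | by constructor 2 | by constructor 4 |].
constructor 3; apply: DQ; apply/eqP; rewrite eqEcard oQ' oQ leqnn andbT.
by rewrite subsetI (normal_sub orbitwise_part_normal) (sub_orbitwise p_pr semiQ).
Qed.

(** The p-part of A is characteristic in A, hence normal in G. *)
Lemma semiregular_of_cyclic (A : {group {perm T}}) :
    A <| G -> cyclic A -> (#|A|`_p)%N = p ->
  exists C : {group {perm T}}, semiregular_on D p C /\ G \subset 'N(C).
Proof.
move=> nsAG cA oAp; exists 'O_p(A)%G.
have sylA : p.-Hall(A) 'O_p(A) by apply/nilpotent_pcore_Hall/abelian_nil/cyclic_abelian.
have nsOG : 'O_p(A)%G <| G := char_normal_trans (pcore_char p A) nsAG.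
split; last exact: normal_norm.
by apply: (normal_semiregular p_pr sGS Gtr nsOG); rewrite (card_Hall sylA).
Qed.

(** The stabilisers [F x] in A have order p, are constant on the A-orbits and take
exactly two values, exchanged by some b in B.  With u a generator of the first
one, v = u^b a generator of the second one, and u^(b^2) = u^(l^2), the element
u^l v is an eigenvector of b for l.  It is also one for the elements of B that
fix the two stabilisers, since they commute with b and act by the same power on
u and on v.  Lying outside the stabilisers, it acts freely. *)
Lemma semiregular_of_abelem (A B : {group {perm T}}) m :
    A ><| B = G -> p.-abelem A -> #|A| = (p ^ 2)%N -> abelian B ->
    {in B, forall b, b ^+ m = 1} -> ~~ odd m -> m %| p.-1 ->
  exists C : {group {perm T}}, semiregular_on D p C /\ G \subset 'N(C).
Proof.
move=> sdG abelA oA abB expB even_m dvd_m.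
have [_ defG nAB tiAB] := sdprodP sdG.
have [nsAG sBG _ _ _] := sdprod_context sdG.
have [sAG nAG] := andP nsAG; have [abA exA] := abelemP p_pr abelA.
have p_gt1 := prime_gt1 p_pr; have p_gt0 := prime_gt0 p_pr.
have p_gt2 : 2 < p by apply: odd_prime_gt2.
pose F x := 'C_A[x | 'P]%G.
have SG g : g \in G -> g \in S by apply: subsetP.
have FJ g x : g \in G -> F (g x) :=: F x :^ g.
  move=> Gg; rewrite /= conjIg (normsP nAG g Gg); congr (_ :&: _).
  exact: (astab1_act 'P x g).
have F_all (K : {group {perm T}}) : K \subset A -> {in D, forall y, K \subset F y} -> K :=: 1.
  move=> sKA fixK; apply/trivgP/subsetP => k Kk; rewrite inE; apply/eqP.
  apply: (Sym_eq (D := D)); rewrite ?group1 ?SG ?(subsetP sAG) ?(subsetP sKA) // => y Dy.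
  have /setIP[_ /astab1P ky] := subsetP (fixK y Dy) k Kk.
  by rewrite perm1 -[RHS]ky.
have sub_orb x : x \in D -> orbit 'P A x \subset D.
  move=> Dx; apply/subsetP => _ /orbitP[a Aa <-].
  by rewrite /= /aperm Sym_mem // SG // (subsetP sAG).
have oF x : x \in D -> #|F x| = p.
  move=> Dx; have stab := card_orbit_stab 'P A x.
  have /p_natP[k Dk] : p.-group (F x) by apply: pgroupS (subsetIl _ _) (abelem_pgroup abelA).
  have k_le2 : k <= 2.
    by rewrite -(leq_exp2l _ _ p_gt1) -Dk -oA subset_leq_card ?subsetIl.
  case: k k_le2 Dk => [|[|[|k]]] // _ Dk.
    have := subset_leq_card (sub_orb x Dx).
    move: stab; rewrite [X in (_ * X)%N]Dk muln1 oA => ->.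
    by rewrite cardD expnS expn1 leq_pmul2r // leqNgt p_gt2.
  have FA : F x :=: A by apply/eqP; rewrite eqEcard subsetIl oA [X in _ <= X]Dk leqnn.
  have A1 : A :=: 1.
    apply: F_all => // y Dy; have [g Gg ->] := atransP2 Gtr Dx Dy.
    by rewrite (FJ g x Gg) FA (normsP nAG).
  by move: oA; rewrite A1 cards1 => p1; have := ltn_exp2l 0 2 p_gt1; rewrite -p1 ltnn.
have prF x : x \in D -> prime #|F x| by move=> /oF->.
have tiF x y : x \in D -> y \in D -> F x :!=: F y -> F x :&: F y = 1.
  move=> Dx Dy neq; apply: prime_TIg; first exact: prF.
  by apply: contra neq => sF; rewrite eqEcard sF (oF x Dx) (oF y Dy) leqnn.
have [x Dx] := point_exists p_pr cardD.
have [y Dy Fxy] : exists2 y, y \in D & F x :!=: F y.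
  apply/exists_inP; rewrite -negb_forall_in; apply/negP => /forall_inP sub.
  have F1 : F x :=: 1.
    by apply: F_all => [|z Dz]; [apply: subsetIl | rewrite -(eqP (sub z Dz))].
  by have := oF x Dx; rewrite F1 cards1 => p1; rewrite -p1 in p_gt1.
have Forb z a : a \in A -> F (a z) :=: F z.
  move=> Aa; rewrite FJ ?(subsetP sAG) //; apply: normP.
  by apply: (subsetP (cent_sub _)); apply: (subsetP (centS (subsetIl _ _))); apply: (subsetP abA).
have card_orbA z : z \in D -> #|orbit 'P A z| = p.
  move=> Dz; have /eqP := card_orbit_stab 'P A z.
  by rewrite (oF z Dz) oA expnS expn1 eqn_pmul2r // => /eqP.
have Ftwo z : z \in D -> F z :=: F x \/ F z :=: F y.
  have Feq w w' : w' \in orbit 'P A w -> F w' :=: F w by case/orbitP=> a Aa <-; apply: Forb.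
  have dis : orbit 'P A x :&: orbit 'P A y = set0.
    apply/eqP; rewrite -subset0; apply/subsetP => w /setIP[/Feq xw /Feq yw].
    by rewrite -xw yw eqxx in Fxy.
  have <- : orbit 'P A x :|: orbit 'P A y = D.
    apply/eqP; rewrite eqEcard subUset !sub_orb // cardsU dis cards0 subn0.
    by rewrite !card_orbA // cardD mul2n addnn leqnn.
  by case/setUP=> /Feq; [left | right].
(* A moves the points without changing their stabilisers, since it is
   abelian; so the B-part of an element of G mapping x to y will do. *)
have [b Bb Dyb] : exists2 b, b \in B & F x :^ b = F y.
  have [g Gg Dg] := atransP2 Gtr Dx Dy.
  have /mulsgP[a b Aa Bb Dab] : g \in A * B by rewrite defG.
  exists b; rewrite // Dg /= /aperm Dab permM FJ ?(subsetP sBG) //.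
  by rewrite Forb.
have Gb : b \in G := subsetP sBG b Bb.
have Fyb : F y :^ b = F x.
  have Dby : b y \in D by rewrite Sym_mem ?SG.
  rewrite -FJ //; have [//|Fby] := Ftwo _ Dby.
  by case/eqP: Fxy; apply: (act_inj 'Js b); rewrite /= Dyb -FJ.
have [u Du] : exists u, F x :=: <[u]> by apply/cyclicP; rewrite prime_cyclic ?prF.
have Fu : u \in F x by rewrite Du cycle_id.
have u1 : u != 1 by apply: contraTneq (prF x Dx) => u1; rewrite Du u1 cycle1 cards1.
have nFb2 : b ^+ 2 \in 'N(F x).
  by apply/normP; rewrite expgS expg1 conjsgM Dyb Fyb.
have AF g w : w \in D -> g \in F w -> g \in A by move=> _ /setIP[].
(* The automorphism induced by b^2 is a square: it is the i-th power of a
   generator of a cyclic group of order p-1, and its power m./2 is trivial, so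
   that m divides i * m./2 and i is even.  Its square root is the l-th power. *)
have [l Dl] : exists l, u ^ (b ^+ 2) = (u ^+ l) ^+ l.
  have /cyclicP[tau0 Dtau0] : cyclic (Aut (F x)) by rewrite Aut_prime_cyclic ?prF.
  have otau0 : #[tau0] = p.-1.
    rewrite orderE -Dtau0 card_Aut_cyclic ?prime_cyclic ?prF //.
    by rewrite [#|_|](oF x Dx) totient_prime.
  have : conj_aut (F x) (b ^+ 2) \in Aut (F x) by apply: Aut_aut.
  rewrite Dtau0 => /cycleP[i Di].
  have even_i : ~~ odd i.
    have Dm : m = m./2.*2 by rewrite -{1}(odd_double_half m) (negbTE even_m).
    have m2_gt0 : 0 < m./2.
      rewrite -double_gt0 -Dm; apply: dvdn_gt0 dvd_m.
      by rewrite -ltnS prednK.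
    have : conj_aut (F x) (b ^+ 2) ^+ m./2 = 1.
      by rewrite -morphX // -expgM mul2n -Dm expB // morph1.
    rewrite Di -expgM => /eqP; rewrite -order_dvdn otau0 => dvd.
    by have := dvdn_trans dvd_m dvd; rewrite {1}Dm -mul2n dvdn_pmul2r // dvdn2.
  pose tau := tau0 ^+ i./2.
  have Atau : tau \in Aut (F x) by rewrite Dtau0 mem_cycle.
  have Ftau : tau u \in F x by rewrite Aut_closed.
  have /cycleP[l Dl] : tau u \in <[u]> by rewrite -Du.
  exists l; rewrite -(norm_conj_autE nFb2 Fu) Di.
  rewrite -(odd_double_half i) (negbTE even_i) add0n -addnn expgD permM -/tau Dl.
  by have /= := morphX (autm_morphism Atau) l Fu; rewrite !autmE Dl => ->.
set v := u ^ b; have Fv : v \in F y by rewrite -Dyb memJ_conjg.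
have Au := AF u x Dx Fu; have Av := AF v y Dy Fv.
have cA g h : g \in A -> h \in A -> commute g h by move=> Ag Ah; apply: (centsP abA).
have ul1 : u ^+ l != 1.
  apply: contraNneq u1 => ul1; rewrite -(conjg_eq1 u (b ^+ 2)) Dl ul1 expg1n //.
set z := u ^+ l * v.
have Az : z \in A by rewrite groupM ?groupX.
(* b maps u^l v to v^l u^(l^2). *)
have zb : z ^ b = z ^+ l.
  rewrite /z conjMg conjXg -/v -[v ^ b]conjgM -[b * b]/(b ^+ 2) Dl.
  by rewrite [RHS](expgMn l (cA _ _ (groupX l Au) Av)); apply: cA; rewrite ?groupX.
have zF w : w \in D -> z \notin F w.
  move=> Dw; have tixy := tiF x y Dx Dy Fxy; apply/negP.
  have [-> | ->] := Ftwo w Dw => zw.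
    have : v \in F x :&: F y.
      by rewrite inE Fv andbT -(mulKg (u ^+ l) v) groupM ?groupV ?groupX.
    by rewrite tixy => /set1P/eqP; rewrite conjg_eq1 (negPf u1).
  have : u ^+ l \in F x :&: F y.
    by rewrite inE groupX //= -(mulgK v (u ^+ l)) groupM ?groupV.
  by rewrite tixy => /set1P/eqP; rewrite (negPf ul1).
have z1 : z != 1 by apply: contraNneq (zF x Dx) => ->; apply: group1.
have oz : #[z] = p by apply: nt_prime_order => //; apply: exA.
exists <[z]>%G; split; first split=> [||w Dw] /=.
- by rewrite cycle_subG SG ?(subsetP sAG).
- exact: oz.
- apply: prime_TIg; first by rewrite -orderE oz.
  apply: contra (zF w Dw); rewrite cycle_subG => zw; by rewrite inE Az.
rewrite -defG mul_subG //.
  by apply/cents_norm/(subset_trans abA)/centS; rewrite cycle_subG.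
have stab g : g \in B -> F x :^ g = F x -> z ^ g \in <[z]>.
  move=> Bg Fg; have /cycleP[t Dt] : u ^ g \in <[u]> by rewrite -Du -Fg memJ_conjg.
  have vg : v ^ g = v ^+ t by rewrite /v -conjgM (centsP abB b Bb g Bg) conjgM Dt conjXg.
  rewrite /z conjMg conjXg Dt vg -expgM mulnC expgM -expgMn ?mem_cycle //.
  by apply: cA; rewrite ?groupX.
(* Up to a factor b, g fixes both stabilisers. *)
apply/subsetP => g Bg; rewrite inE -cycleJ cycle_subG.
have Dgx : g x \in D by rewrite Sym_mem ?SG ?(subsetP sBG).
have := FJ g x (subsetP sBG g Bg); have [-> | ->] := Ftwo _ Dgx => Fg.
  exact: stab.
have Bgb : g * b^-1 \in B by rewrite groupM ?groupV.
have zgb : z ^ (g * b^-1) \in <[z]>.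
  by apply: stab; rewrite // conjsgM -Fg -Dyb conjsgK.
have /cycleP[t Dt] := zgb.
by rewrite -(mulgKV b g) conjgM Dt conjXg zb -expgM mem_cycle.
Qed.

Theorem semiregular_of_cases :
    [\/ case_i p G, case_ii p G, case_iii p G | case_iv p G] ->
  exists C : {group {perm T}}, semiregular_on D p C /\ G \subset 'N(C).
Proof.
have p_gt0 := prime_gt0 p_pr.
have p1_gt0 : 0 < p.-1 by rewrite -ltnS prednK ?prime_gt1.
have oA (A : {group {perm T}}) : A \isog setX (Zp p) (Zp p) -> p.-abelem A /\ #|A| = (p ^ 2)%N.
  move=> isoA; rewrite (isog_abelem isoA) abelem_setX_Zp //.
  by rewrite (card_isog isoA) cardsX card_Zp.
case=> [[m [even_m dvd_m [A [B [sdG isoA isoB]]]]] | [m [even_m dvd_m [A [B [sdG isoA isoB]]]]]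
       | [m [dvd_m [A [B [sdG isoA _]]]]] | [m [_ _ [A [B [sdG isoA _]]]]]].
- have m_gt0 := dvdn_gt0 p1_gt0 dvd_m; have [abelA cardA] := oA A isoA.
  have oB : #|B| = m by rewrite (card_isog isoB) card_Zp.
  apply: (semiregular_of_abelem sdG abelA cardA _ _ even_m dvd_m).
    by rewrite (isog_abelian isoB) cyclic_abelian // cyclic_Zp.
  by move=> b Bb; rewrite -oB expg_cardG.
- have m_gt0 := dvdn_gt0 p1_gt0 dvd_m; have [abelA cardA] := oA A isoA.
  have [abB expB] := exponent_C2_Cm m_gt0 even_m isoB.
  exact: (semiregular_of_abelem sdG abelA cardA abB expB even_m dvd_m).
- have [nsAG _ _ _ _] := sdprod_context sdG.
  apply: (semiregular_of_cyclic nsAG).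
    by rewrite (isog_cyclic isoA) cyclic_Zp.
  rewrite (card_isog isoA) card_Zp ?muln_gt0 // partnM // part_p'nat; last first.
    by rewrite p'natE // dvdn_prime2 //; apply: contraL p_odd => /eqP->.
  by rewrite mul1n part_pnat_id // pnat_id.
have [nsAG _ _ _ _] := sdprod_context sdG.
apply: (semiregular_of_cyclic nsAG).
  by rewrite (isog_cyclic isoA) cyclic_Zp.
by rewrite (card_isog isoA) card_Zp // part_pnat_id // pnat_id.
Qed.

End CasesIff.

Lemma sdprod_isog (gT rT : finGroupType) (G : {group gT}) (H : {group rT})
    (aT bT : finGroupType) (A : {group aT}) (B : {group bT}) :
  G \isog H -> is_semidirect G A B -> is_semidirect H A B.
Proof.
case/isogP=> f injf Df [A1 [B1 [sdG isoA isoB]]].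
have [/andP[sA _] sB _ _ _] := sdprod_context sdG.
exists (f @* A1)%G, (f @* B1)%G; split; first by rewrite -Df; apply: injm_sdprod.
  by apply: isog_trans isoA; rewrite isog_sym sub_isog.
by apply: isog_trans isoB; rewrite isog_sym sub_isog.
Qed.

Lemma cases_isog p (gT rT : finGroupType) (G : {group gT}) (H : {group rT}) :
    G \isog H ->
  [\/ case_i p G, case_ii p G, case_iii p G | case_iv p G] ->
  [\/ case_i p H, case_ii p H, case_iii p H | case_iv p H].
Proof.
move=> isoGH [[m [e d sd]] | [m [e d sd]] | [m [d sd]] | [m [e d sd]]];
  [constructor 1 | constructor 2 | constructor 3 | constructor 4];
  by exists m; split=> //; apply: sdprod_isog isoGH sd.
Qed.

Import GRing.Theory VectorInternalTheory.
Local Open Scope ring_scope.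

(** * Linear maps out of tensor products *)

Section TensorLift.
Variable K : fieldType.

Definition linear_of (U W : lmodType K) (f : U -> W) (f_lin : linear f) :
    {linear U -> W} :=
  HB.pack f (GRing.isLinear.Build _ _ _ _ f f_lin).

Lemma tlift_linear (U V : vectType K) (W : lmodType K) (f : U -> V -> W) :
  linear (tlift f).
Proof.
move=> k T T'; rewrite /tlift scaler_sumr -big_split; apply: eq_bigr => i _ /=.
rewrite scaler_sumr -big_split; apply: eq_bigr => j _ /=.
by rewrite !mxE scalerDl scalerA.
Qed.

Lemma eq_tlift (U V : vectType K) (W : lmodType K) (f g : U -> V -> W) T :
  (forall u v, f u v = g u v) -> tlift f T = tlift g T.
Proof.
by move=> fg; apply: eq_bigr => i _; apply: eq_bigr => j _; rewrite fg.
Qed.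

Lemma linear_tlift (U V : vectType K) (W W' : lmodType K)
    (phi : {linear W -> W'}) (f : U -> V -> W) T :
  phi (tlift f T) = tlift (fun u v => phi (f u v)) T.
Proof.
rewrite linear_sum; apply: eq_bigr => i _.
by rewrite linear_sum; apply: eq_bigr => j _; rewrite linearZ.
Qed.

Lemma tlift_sum (U V : vectType K) (W : lmodType K) (I : finType) (P : pred I)
    (f : I -> U -> V -> W) T :
  tlift (fun u v => \sum_(i | P i) f i u v) T = \sum_(i | P i) tlift (f i) T.
Proof.
rewrite /tlift [RHS]exchange_big; apply: eq_bigr => i _ /=.
rewrite [RHS]exchange_big; apply: eq_bigr => j _ /=.
by rewrite scaler_sumr.
Qed.

Lemma tlift_mulr (U V : vectType K) (A : algType K) (f : U -> V -> A) a T :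
  tlift (fun u v => f u v * a) T = tlift f T * a.
Proof.
rewrite /tlift mulr_suml; apply: eq_bigr => i _.
by rewrite mulr_suml; apply: eq_bigr => j _; rewrite scalerAl.
Qed.

Lemma tlift_mull (U V : vectType K) (A : algType K) (f : U -> V -> A) a T :
  tlift (fun u v => a * f u v) T = a * tlift f T.
Proof.
rewrite /tlift mulr_sumr; apply: eq_bigr => i _.
by rewrite mulr_sumr; apply: eq_bigr => j _; rewrite scalerAr.
Qed.

Lemma linear_stdbasis (U : vectType K) (W : lmodType K)
    (phi : {linear U -> W}) u :
  phi u = \sum_i v2r u 0 i *: phi (stdbasis i).
Proof.
rewrite [in LHS](stdbasisE u) linear_sum.
by apply: eq_bigr => i _; rewrite linearZ.
Qed.

End TensorLift.

(** * Galois descent for functions on a group *)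

Section Descent.
Variables (K : fieldType) (M : splittingFieldType K).
Hypothesis galM1 : galois 1 {:M}.

Local Notation Gal := 'Gal({:M} / 1)%g.

Lemma mem_gal1 (g : gal_of {:M}) : g \in Gal.
Proof. by rewrite gal_kHom ?sub1v // k1AHom. Qed.

Lemma galoisK_fix (x : M) :
  (forall g : gal_of {:M}, g x = x) -> exists k : K, x = k%:A.
Proof.
move=> gx; apply/vlineP.
rewrite -[vline 1](galois_fixedField galM1).
by apply/fixedFieldP; rewrite ?memvf // => g _; apply: gx.
Qed.

(** Independence of the automorphisms of M. *)
Lemma trace_nondegenerate (a : M) :
  (forall c, galTrace 1 {:M} (c * a) = 0) -> a = 0.
Proof.
move=> tr0.
rewrite -(gal_id {:M} a).
apply: (@gal_independent _ _ {:M}%AS (mem Gal) (fun g => g a)); last exact: mem_gal1.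
move=> c _.
by rewrite -[RHS](tr0 c); apply: eq_bigr => g _; rewrite rmorphM mulrC.
Qed.

Variables (X : finGroupType) (N : {group X}) (lam : gal_of {:M} -> X).
Hypothesis lamN : forall g, lam g \in 'N(N)%g.
Hypothesis lamM : forall g h, lam (g * h)%g = (lam g * lam h)%g.

(** The fixed points of the Galois group acting on M[N], on the coefficients and,
through lam, on N; an element of M[N] is a function supported on N. *)
Definition equivariant (c : {ffun X -> M}) :=
  (forall n, n \notin N -> c n = 0) /\
  (forall g n, n \in N -> c (n ^ lam g)%g = g (c n)).

Lemma lam1 : lam 1%g = 1%g.
Proof. by apply: (mulgI (lam 1%g)); rewrite -lamM !mulg1. Qed.

Lemma lamV g : lam g^-1%g = (lam g)^-1%g.
Proof. by apply: (mulgI (lam g)); rewrite -lamM !mulgV lam1. Qed.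

Lemma memN_lam g n : ((n ^ lam g)%g \in N) = (n \in N).
Proof. by rewrite memJ_norm. Qed.

Section Embedding.
Variables (U : vectType K) (iota : {linear U -> {ffun X -> M}}).
Hypothesis iota_inj : injective iota.
Hypothesis iota_eq : forall u, equivariant (iota u).

Lemma iotaD n : linear (fun u => iota u n).
Proof. by move=> k u v; rewrite linearP !ffunE. Qed.

Definition iota_at n : {linear U -> M} :=
  linear_of (iotaD n).

Lemma iotaZ k u n : iota (k *: u) n = k *: iota u n.
Proof. by rewrite linearZ ffunE. Qed.

Lemma iota_stdbasis u n : iota u n = \sum_i v2r u 0 i *: iota (stdbasis i) n.
Proof. exact: (linear_stdbasis (iota_at n) u). Qed.

(** Apply the automorphisms g to the relation multiplied by c and add up: the traces
of the [c * a i] are the coefficients of a relation over K, which is trivial.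
As c is arbitrary and the trace form is nondegenerate, each [a i] is zero. *)
Lemma descent_free (a : 'I_(dim U) -> M) :
  (forall n, n \in N -> \sum_i a i * iota (stdbasis i) n = 0) ->
  forall i, a i = 0.
Proof.
move=> rel i; apply: trace_nondegenerate => c.
have /fin_all_exists[t Dt] j : exists k : K, galTrace 1 {:M} (c * a j) = k%:A.
  by apply/vlineP; apply: mem_galTrace galM1 (memvf _).
have tr0 n : n \in N -> \sum_j t j *: iota (stdbasis j) n = 0.
  move=> Nn.
  have rel_g (g : gal_of {:M}) : \sum_j g (c * a j) * iota (stdbasis j) n = 0.
    have := rel (n ^ (lam g)^-1)%g; rewrite -lamV memN_lam => /(_ Nn).
    move/(congr1 (fun x => g (c * x))); rewrite /= mulr0 rmorph0 => E; rewrite -[RHS]E.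
    rewrite mulr_sumr rmorph_sum; apply: eq_bigr => j _.
    rewrite [in RHS]mulrA [RHS]rmorphM; congr (_ * _).
    rewrite /= -(iota_eq (stdbasis j)).2 -?lamV ?memN_lam //.
    by rewrite -conjgM -lamM mulVg lam1 conjg1.
  transitivity (\sum_(g in Gal) \sum_j g (c * a j) * iota (stdbasis j) n).
    rewrite exchange_big; apply: eq_bigr => j _ /=.
    by rewrite -mulr_suml -[\sum_(g in _) _]/(galTrace _ _ _) Dt -scalerAl mul1r.
  by rewrite big1.
have: \sum_j t j *: stdbasis j = 0.
  apply: iota_inj; rewrite linear0; apply/ffunP => n; rewrite [RHS]ffunE.
  rewrite -[LHS]/(iota_at n _) linear_sum /=.
  have [Nn | N'n] := boolP (n \in N).
    by rewrite -[RHS](tr0 n Nn); apply: eq_bigr => j _; rewrite iotaZ.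
  by rewrite big1 // => j _; rewrite (iota_eq _).1.
move/(congr1 v2r); rewrite linear0 linear_sum => /matrixP/(_ 0 i).
rewrite !mxE summxE (bigD1 i) //= big1 => [|j ji]; last first.
  by rewrite linearZ /= mxE /stdbasis r2vK !mxE eq_sym (negPf ji) andbF mulr0.
by rewrite addr0 linearZ /= mxE /stdbasis r2vK !mxE !eqxx mulr1 Dt => ->; rewrite scale0r.
Qed.

(** A tensor is a matrix over K whose rows are elements of V; [descent_free] frees
the rows from the relations satisfied by the [iota a n], and the [beta j]
separate the elements of V. *)
Lemma tensor_eq (V : vectType K) (J : Type) (beta : J -> {linear V -> M}) :
    (forall v, (forall j, beta j v = 0) -> v = 0) ->
  forall T T' : tensor U V,
    (forall n j, tlift (fun a b => iota a n * beta j b) T =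
                 tlift (fun a b => iota a n * beta j b) T') -> T = T'.
Proof.
move=> beta_inj T T' eqT; apply/eqP; rewrite -subr_eq0; apply/eqP.
set D := T - T'; have {eqT} D0 n j : tlift (fun a b => iota a n * beta j b) D = 0.
  have := tlift_linear (fun a b => iota a n * beta j b) (-1) T' T.
  by rewrite /= eqT !scaleN1r addNr addrC.
have rowD0 i : \sum_j D i j *: stdbasis j = 0.
  apply: beta_inj => j; move: i; apply: descent_free => n _.
  rewrite -[RHS](D0 n j); apply: eq_bigr => i _.
  rewrite linear_sum mulr_suml; apply: eq_bigr => k _.
  by rewrite linearZ /= -scalerAl mulrC.
apply/matrixP => i j; have /(congr1 (fun v => v2r v 0 j)) := rowD0 i.
rewrite /= linear_sum summxE (bigD1 j) //= big1 => [|k kj]; last first.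
  by rewrite linearZ /= mxE /stdbasis r2vK !mxE eq_sym (negPf kj) andbF mulr0.
rewrite addr0 linearZ /= mxE /stdbasis r2vK !mxE !eqxx mulr1 => ->.
by rewrite linear0 mxE.
Qed.

Definition eval2 n m (T : tensor U U) : M :=
  tlift (fun a b => iota a n * iota b m) T.

Lemma eval2_linear n m : linear (eval2 n m).
Proof. exact: tlift_linear. Qed.

Lemma iota_at_eq0 u : (forall n, iota_at n u = 0) -> u = 0.
Proof.
move=> u0; apply: iota_inj; rewrite linear0; apply/ffunP => n.
by rewrite [RHS]ffunE; apply: u0.
Qed.

Lemma eval2_inj T T' : (forall n m, eval2 n m T = eval2 n m T') -> T = T'.
Proof. exact: (tensor_eq iota_at_eq0). Qed.

Definition eval3 n m k (T : tensor U (tensor U U)) : M :=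
  tlift (fun a T' => iota a n * eval2 m k T') T.

Lemma eval3_inj T T' :
  (forall n m k, eval3 n m k T = eval3 n m k T') -> T = T'.
Proof.
move=> eqT; apply: (tensor_eq (J := X * X)
  (beta := fun mk => linear_of (eval2_linear mk.1 mk.2))) => [T0 T0z|n [m k]].
  apply: eval2_inj => m k; rewrite [LHS](T0z (m, k)).
  exact: (esym (linear0 (linear_of (eval2_linear m k)))).
exact: eqT.
Qed.

Lemma eval2_tens n m a b : eval2 n m (tens a b) = iota a n * iota b m.
Proof.
apply: (@tliftE _ _ _ _ (fun a b => iota a n * iota b m)) => [u|v] k x y.
  by rewrite iotaD mulrDr scalerAr.
by rewrite iotaD mulrDl scalerAl.
Qed.

Lemma eval3_tens n m k a T :
  eval3 n m k (tens a T) = iota a n * eval2 m k T.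
Proof.
apply: (@tliftE _ _ _ _ (fun a T => iota a n * eval2 m k T)) => [u|v] c x y.
  by rewrite eval2_linear mulrDr scalerAr.
by rewrite iotaD mulrDl scalerAl.
Qed.

Lemma eval3_linear n m k : linear (eval3 n m k).
Proof. exact: tlift_linear. Qed.

Section Diagonal.
Variable Delta : U -> tensor U U.
Hypothesis DeltaE : forall h n m,
  eval2 n m (Delta h) = if n == m then iota h n else 0.

(** The comultiplication is grouplike on N: only the diagonal terms n (x) n
survive. *)
Lemma sweedler (F : U -> U -> M) (Phi : X -> X -> M) h :
    (forall a b, F a b =
      \sum_(n in N) \sum_(m in N) iota a n * iota b m * Phi n m) ->
  tlift F (Delta h) = \sum_(n in N) iota h n * Phi n n.
Proof.
move=> FE; rewrite (eq_tlift _ FE) tlift_sum; apply: eq_bigr => n Nn.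
rewrite tlift_sum (bigD1 n) //= big1 ?addr0 => [|m /andP[_ ne_mn]];
  rewrite tlift_mulr -/(eval2 _ _ _) DeltaE ?eqxx // eq_sym (negPf ne_mn).
by rewrite mul0r.
Qed.

End Diagonal.

Hypothesis iota_full : forall c, equivariant c -> exists u, iota u = c.

(** A column of the inverse of the matrix of the g w_j, for a basis w of M over K. *)
Lemma gal_dual_bases : exists m (a b : 'I_m -> M),
  forall g : gal_of {:M}, \sum_j b j * g (a j) = (g == 1%g)%:R.
Proof.
have [w _ [uM _ _]] := @gal_matrix _ _ {:M}%AS Gal.
pose iG := enum_rank_in (group1 Gal).
set W := (\matrix_(i, j) _) in uM.
exists #|Gal|, (tnth w), (fun j => invmx W j (iG 1%g)) => g.
transitivity ((W *m invmx W) (iG g) (iG 1%g)).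
  rewrite mxE; apply: eq_bigr => j _; rewrite mulrC; congr (_ * _).
  by rewrite mxE enum_rankK_in ?mem_gal1.
rewrite mulmxV // mxE; congr ((_ : bool)%:R); apply/eqP/eqP => [|-> //].
by move/(congr1 enum_val); rewrite !enum_rankK_in ?mem_gal1.
Qed.

(** The sum over the Galois group of the conjugates of the element a n of M[N]. *)
Definition orbit_fun n a : {ffun X -> M} :=
  [ffun m => \sum_(g | (n ^ lam g)%g == m) (g : gal_of {:M}) a].

Lemma orbit_fun_equivariant n a : n \in N -> equivariant (orbit_fun n a).
Proof.
move=> Nn; split=> [m N'm | h m Nm]; rewrite !ffunE.
  rewrite big_pred0 // => g; apply: contraNF N'm => /eqP<-.
  by rewrite memN_lam.
rewrite (reindex_inj (mulIg h)) rmorph_sum; apply: eq_big => g.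
  by rewrite lamM conjgM (inj_eq (conjg_inj _)).
by move=> _; rewrite galM ?memvf.
Qed.

(** In terms of the dual bases a, b of M, the basis element n of M[N] is the sum of
the b_j times the equivariant functions [orbit_fun n (a j)]. *)
Lemma descent_span : exists B : X -> 'I_(dim U) -> M,
  {in N &, forall n m, \sum_i B n i * iota (stdbasis i) m = (n == m)%:R}.
Proof.
have [r [a [b ab]]] := gal_dual_bases.
have /fin_all_exists[v Dv] (nj : X * 'I_r) :
    exists u, nj.1 \in N -> iota u = orbit_fun nj.1 (a nj.2).
  have [Nn | _] := boolP (nj.1 \in N); last by exists 0.
  by have [u Du] := iota_full (orbit_fun_equivariant (a nj.2) Nn); exists u.
exists (fun n i => \sum_j b j * (v2r (v (n, j)) 0 i)%:A) => n m Nn Nm.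
transitivity (\sum_j b j * orbit_fun n (a j) m).
  rewrite -(eq_bigr _ (fun i _ => esym (mulr_suml _ _ _ _))) exchange_big /=.
  apply: eq_bigr => j _; rewrite -(Dv (n, j) Nn) iota_stdbasis mulr_sumr.
  by apply: eq_bigr => i _; rewrite -mulrA -scalerAl mul1r.
under eq_bigr do rewrite ffunE mulr_sumr.
rewrite exchange_big /=; under eq_bigr do rewrite ab.
have [<- | ne_nm] := eqVneq n m.
  rewrite (bigD1 1%g) ?lam1 ?conjg1 //= eqxx big1 ?addr0 // => g.
  by case/andP=> _ /negPf->.
rewrite big1 // => g /eqP n_g; case: eqP => // g1.
by case/eqP: ne_nm; rewrite -n_g g1 lam1 conjg1.
Qed.

(** The matrix of the coefficients of a K-basis is free by [descent_free] and full
by [descent_span]. *)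
Lemma dim_descent : dim U = #|N|.
Proof.
have [B DB] := descent_span.
pose E : 'M[M]_(dim U, #|N|) := \matrix_(i, k) iota (stdbasis i) (enum_val k).
have freeE : row_free E.
  rewrite -kermx_eq0; apply/rowV0P => v /sub_kermxP/rowP vE0.
  apply/rowP => i; rewrite mxE; move: i; apply: descent_free => n Nn.
  have := vE0 (enum_rank_in (group1 N) n); rewrite !mxE => vEn.
  rewrite -[RHS]vEn; apply: eq_bigr => i _.
  by rewrite mxE enum_rankK_in.
have fullE : row_full E.
  apply/row_fullP; exists (\matrix_(k, i) B (enum_val k) i).
  apply/matrixP => k l; rewrite !mxE -(inj_eq enum_val_inj) -DB ?enum_valP //.
  by apply: eq_bigr => i _; rewrite !mxE.
by rewrite -(eqP freeE) (eqP fullE).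
Qed.

(** Both sides are coefficients of the same element of M[N] on a basis of U, and
these coefficients are unique. *)
Lemma galois_dual_equivariant (B : X -> 'I_(dim U) -> M) :
  {in N &, forall n m, \sum_i B n i * iota (stdbasis i) m = (n == m)%:R} ->
  forall (g : gal_of {:M}) n i, n \in N -> g (B n i) = B (n ^ lam g)%g i.
Proof.
move=> DB g n i Nn; apply/eqP; rewrite -subr_eq0; apply/eqP; move: i.
apply: descent_free => m Nm.
under eq_bigr do rewrite mulrBl.
rewrite sumrB DB ?memN_lam //; apply/eqP; rewrite subr_eq0; apply/eqP.
set m' := (m ^ (lam g)^-1)%g.
have Nm' : m' \in N by rewrite /m' -lamV memN_lam.
have -> : ((n ^ lam g)%g == m) = (n == m').
  by rewrite /m' (canF_eq (conjgK (lam g))).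
rewrite -(rmorph_nat g) -DB // rmorph_sum; apply: eq_bigr => i _.
by rewrite rmorphM /= -(iota_eq _).2 // -conjgM mulVg conjg1.
Qed.

Lemma scalar_lift (phi : {linear U -> M}) :
    (forall (g : gal_of {:M}) u, g (phi u) = phi u) ->
  exists psi : {linear U -> K^o}, forall u, (psi u : K)%:A = phi u.
Proof.
move=> phiG; pose psi u : K^o := coord [tuple (1 : M)] ord0 (phi u).
have psi_lin : linear psi by move=> k u v; rewrite /psi !linearP.
exists (linear_of psi_lin) => u /=.
rewrite /psi; have [k ->] := galoisK_fix (phiG^~ u).
by rewrite linearZ /= (coord_free 0) ?mulr1 // seq1_free oner_eq0.
Qed.

(** In terms of the dual coefficients B, the diagonal of h has matrix
sum_n h(n) B(n,i) B(n,j).  The Galois group permutes the terms of this sum, so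
the entries are in K. *)
Lemma diagonal_exists : exists Delta : {linear U -> tensor U U},
  forall h n m, eval2 n m (Delta h) = if n == m then iota h n else 0.
Proof.
have [B DB] := descent_span.
pose phi i j u := \sum_(n in N) iota u n * (B n i * B n j).
have phi_lin i j : linear (phi i j).
  move=> k u v; rewrite scaler_sumr -big_split; apply: eq_bigr => n _ /=.
  by rewrite iotaD mulrDl scalerAl.
have phiG i j (g : gal_of {:M}) u : g (phi i j u) = phi i j u.
  rewrite rmorph_sum [RHS](reindex_inj (conjg_inj (lam g))) /=.
  apply: eq_big => n; first by rewrite memN_lam.
  by move=> Nn; rewrite !rmorphM /= !(galois_dual_equivariant DB) ?(iota_eq _).2.
have lift ij : exists psi : {linear U -> K^o},
    forall u, (psi u : K)%:A = phi ij.1 ij.2 u.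
  apply: (@scalar_lift (linear_of (phi_lin ij.1 ij.2))) => g u.
  exact: phiG.
have [psi Dpsi] := fin_all_exists lift.
pose D u : tensor U U := \matrix_(i, j) (psi (i, j) u : K).
have D_lin : linear D.
  by move=> k u v; apply/matrixP => i j; rewrite !mxE linearP.
exists (linear_of D_lin) => h n m /=.
have [Nn | N'n] := boolP (n \in N); last first.
  rewrite (iota_eq _).1 // if_same /eval2 (@eq_tlift _ _ _ _ _ (fun _ _ => 0)).
    by rewrite /tlift big1 // => i _; rewrite big1 // => j _; rewrite scaler0.
  by move=> u v; rewrite (iota_eq u).1 ?mul0r.
have [Nm | N'm] := boolP (m \in N); last first.
  case: eqP N'm => [<- | _ N'm]; first by rewrite Nn.
  rewrite /eval2 (@eq_tlift _ _ _ _ _ (fun _ _ => 0)).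
    by rewrite /tlift big1 // => i _; rewrite big1 // => j _; rewrite scaler0.
  by move=> u v; rewrite (iota_eq v).1 ?mulr0.
rewrite /eval2 /tlift.
transitivity (\sum_i \sum_j \sum_(k in N) iota h k *
  ((B k i * iota (stdbasis i) n) * (B k j * iota (stdbasis j) m))).
  apply: eq_bigr => i _; apply: eq_bigr => j _; rewrite mxE.
  rewrite -mulr_algl Dpsi mulr_suml; apply: eq_bigr => k _.
  by rewrite /= -[LHS]mulrA (mulrACA (B k i)).
transitivity (\sum_(k in N) iota h k * ((k == n)%:R * (k == m)%:R)).
  rewrite -(eq_bigr _ (fun i _ => exchange_big _ _ _ _ _ _)) exchange_big.
  apply: eq_bigr => k Nk /=; rewrite -!DB // big_distrlr mulr_sumr.
  by apply: eq_bigr => i _; rewrite mulr_sumr.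
rewrite (bigD1 n) //= eqxx mul1r big1 ?addr0 => [|k /andP[_ /negPf->]].
  by case: eqP; rewrite ?mulr1 ?mulr0.
by rewrite mul0r mulr0.
Qed.

End Embedding.
End Descent.

(** * The Hopf algebra of Galois-fixed points of a group algebra *)

Section FixedAlgebra.
Variables (K : fieldType) (M : splittingFieldType K).
Variables (X : finGroupType) (N : {group X}) (lam : gal_of {:M} -> X).

Definition conv (c d : {ffun X -> M}) : {ffun X -> M} :=
  [ffun k => \sum_(n in N) \sum_(m in N | (m * n)%g == k) c n * d m].

Definition conv1 : {ffun X -> M} := [ffun n => (n == 1%g)%:R].

Lemma ffun_eval_linear n : linear (fun c : {ffun X -> M} => c n).
Proof. by move=> k c d; rewrite !ffunE. Qed.

Lemma equivariance_defect_linear (g : gal_of {:M}) n :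
  linear (fun c : {ffun X -> M} => c (n ^ lam g)%g - g (c n)).
Proof. by move=> k c d; rewrite !ffunE linearP scalerBr addrACA opprD. Qed.

Definition equivariant_space : {vspace {ffun X -> M}} :=
  ((\bigcap_(n | n \notin N) lker (linfun (linear_of (ffun_eval_linear n)))) :&:
   (\bigcap_g \bigcap_(n in N)
      lker (linfun (linear_of (equivariance_defect_linear g n)))))%VS.

Lemma equivariant_spaceP c :
  reflect (equivariant N lam c) (c \in equivariant_space).
Proof.
rewrite memv_cap; apply: (iffP andP) => -[].
  move=> /subv_bigcapP cN /subv_bigcapP cG.
  split=> [n N'n | g n Nn].
    by have := cN n N'n; rewrite -memvE memv_ker lfunE => /eqP.
  have /subv_bigcapP/(_ n Nn) := cG g isT.
  by rewrite -memvE memv_ker lfunE /= subr_eq0 => /eqP.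
move=> cN cG; split; apply/subv_bigcapP.
  by move=> n N'n; rewrite -memvE memv_ker lfunE /= cN.
move=> g _; apply/subv_bigcapP => n Nn.
by rewrite -memvE memv_ker lfunE /= cG ?subrr.
Qed.

Lemma convE (c d : {ffun X -> M}) k : (forall n, n \notin N -> d n = 0) ->
  conv c d k = \sum_(n in N) c n * d (k * n^-1)%g.
Proof.
move=> dN; rewrite ffunE; apply: eq_bigr => n Nn.
have [Nk | N'k] := boolP ((k * n^-1)%g \in N).
  rewrite (big_pred1 (k * n^-1)%g) // => m /=.
  rewrite (canF_eq (mulgK n)); case: eqP => [->|]; rewrite ?andbF //.
  by rewrite Nk.
rewrite dN // mulr0 big_pred0 // => m; apply: contraNF N'k.
by case/andP=> Nm /eqP<-; rewrite mulgK.
Qed.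

Lemma conv_supp (c d : {ffun X -> M}) k : (forall n, n \notin N -> c n = 0) ->
  (forall n, n \notin N -> d n = 0) -> k \notin N -> conv c d k = 0.
Proof.
move=> cN dN N'k; rewrite convE // big1 // => n Nn.
by rewrite [d _]dN ?mulr0 // groupMr ?groupV.
Qed.

Lemma conv_equivariant (c d : {ffun X -> M}) : (forall g, lam g \in 'N(N)%g) ->
  equivariant N lam c -> equivariant N lam d -> equivariant N lam (conv c d).
Proof.
move=> lamN [cN cG] [dN dG]; split=> [|g k Nk]; first by move=> k; apply: conv_supp.
rewrite !convE // rmorph_sum (reindex_inj (conjg_inj (lam g))) /=.
apply: eq_big => n; first by rewrite memN_lam.
rewrite memN_lam // => Nn.
by rewrite rmorphM cG // -conjVg -conjMg dG // groupM ?groupV.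
Qed.

Lemma conv1_equivariant : equivariant N lam conv1.
Proof.
split=> [n N'n | g n Nn]; rewrite !ffunE.
  by case: eqP N'n => // ->; rewrite group1.
by rewrite rmorph_nat -{1}(conj1g (lam g)) (inj_eq (conjg_inj _)).
Qed.

(** The hypothesis that lam normalises N is an argument of the type, because the
product of two fixed points is fixed only under it and the ring structure must
be found by unification from the type alone. *)
Definition fixed_algebra of (forall g, lam g \in 'N(N)%g) :=
  subvs_of equivariant_space.

Hypothesis lamN : forall g, lam g \in 'N(N)%g.
Local Notation H := (fixed_algebra lamN).

HB.instance Definition _ := Vector.on H.

Definition fixed_coef (h : H) : {ffun X -> M} := vsval h.

Lemma fixed_coef_equivariant h : equivariant N lam (fixed_coef h).
Proof. by apply/equivariant_spaceP; apply: subvsP. Qed.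

Lemma fixed_coef_inj : injective fixed_coef. Proof. exact: subvs_inj. Qed.

Lemma fixed_coef_linear : linear fixed_coef. Proof. by []. Qed.

Lemma conv_mem (h k : H) : conv (fixed_coef h) (fixed_coef k) \in equivariant_space.
Proof.
apply/equivariant_spaceP.
by apply: conv_equivariant lamN _ _; apply: fixed_coef_equivariant.
Qed.

Lemma conv1_mem : conv1 \in equivariant_space.
Proof. exact/equivariant_spaceP/conv1_equivariant. Qed.

Definition fixed_mul (h k : H) : H := Subvs (conv_mem h k).
Definition fixed_one : H := Subvs conv1_mem.

Lemma fixed_mulE a b m : fixed_coef (fixed_mul a b) m =
  \sum_(n in N) fixed_coef a n * fixed_coef b (m * n^-1)%g.
Proof. by apply: convE; apply: (fixed_coef_equivariant b).1. Qed.

Fact fixed_mulA : associative fixed_mul.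
Proof.
move=> a b c; apply: fixed_coef_inj; apply/ffunP => k; rewrite !fixed_mulE.
under eq_bigr => n Nn do rewrite fixed_mulE mulr_sumr.
under [RHS]eq_bigr => n Nn do rewrite fixed_mulE mulr_suml.
rewrite [RHS]exchange_big; apply: eq_bigr => n Nn /=.
rewrite [RHS](reindex_inj (mulIg n)) /=.
apply: eq_big => m; first by rewrite groupMr.
by rewrite mulgK invMg !mulgA mulrA.
Qed.

Fact fixed_mul1l : left_id fixed_one fixed_mul.
Proof.
move=> a; apply: fixed_coef_inj; apply/ffunP => k.
rewrite fixed_mulE (bigD1 1%g) //= [fixed_coef fixed_one _]ffunE eqxx.
rewrite mul1r invg1 mulg1 big1 ?addr0 // => n /andP[_ /negPf n1].
by rewrite [fixed_coef fixed_one _]ffunE n1 mul0r.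
Qed.

Fact fixed_mul1r : right_id fixed_one fixed_mul.
Proof.
move=> a; apply: fixed_coef_inj; apply/ffunP => k.
have supp h := (fixed_coef_equivariant h).1.
rewrite fixed_mulE.
have [Nk | N'k] := boolP (k \in N); last first.
  rewrite supp // big1 // => n Nn; rewrite [fixed_coef fixed_one _]supp ?mulr0 //.
  by rewrite groupMr ?groupV.
rewrite (bigD1 k) //= [fixed_coef fixed_one _]ffunE mulgV eqxx mulr1.
rewrite big1 ?addr0 // => n /andP[_ /negPf nk].
by rewrite [fixed_coef fixed_one _]ffunE -eq_mulgV1 eq_sym nk mulr0.
Qed.

Fact fixed_mulDl : left_distributive fixed_mul +%R.
Proof.
move=> a b c; apply: fixed_coef_inj; apply/ffunP => k; rewrite !ffunE -big_split.
apply: eq_bigr => n _; rewrite -big_split; apply: eq_bigr => m _.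
by rewrite ffunE mulrDl.
Qed.

Fact fixed_mulDr : right_distributive fixed_mul +%R.
Proof.
move=> a b c; apply: fixed_coef_inj; apply/ffunP => k; rewrite !ffunE -big_split.
apply: eq_bigr => n _; rewrite -big_split; apply: eq_bigr => m _.
by rewrite ffunE mulrDr.
Qed.

Fact fixed_one_neq0 : fixed_one != 0.
Proof.
apply/eqP => /(congr1 (fun h => fixed_coef h 1%g)).
by rewrite [fixed_coef fixed_one _]ffunE ffunE eqxx => /eqP; rewrite oner_eq0.
Qed.

HB.instance Definition _ := GRing.Zmodule_isNzRing.Build H
  fixed_mulA fixed_mul1l fixed_mul1r fixed_mulDl fixed_mulDr fixed_one_neq0.

Fact fixed_scaleAl k (x y : H) : k *: (x * y) = (k *: x) * y.
Proof.
apply: fixed_coef_inj; apply/ffunP => m; rewrite !ffunE scaler_sumr.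
apply: eq_bigr => n _; rewrite scaler_sumr; apply: eq_bigr => i _.
by rewrite ffunE scalerAl.
Qed.

HB.instance Definition _ := GRing.Lmodule_isLalgebra.Build K H fixed_scaleAl.

Fact fixed_scaleAr k (x y : H) : k *: (x * y) = x * (k *: y).
Proof.
apply: fixed_coef_inj; apply/ffunP => m; rewrite !ffunE scaler_sumr.
apply: eq_bigr => n _; rewrite scaler_sumr; apply: eq_bigr => i _.
by rewrite ffunE scalerAr.
Qed.

HB.instance Definition _ := GRing.Lalgebra_isAlgebra.Build K H fixed_scaleAr.
HB.instance Definition _ := Algebra_isFalgebra.Build K H.

End FixedAlgebra.

Lemma tlift0 (K : fieldType) (U V : vectType K) (W : lmodType K)
    (T : tensor U V) : tlift (fun _ _ => 0 : W) T = 0.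
Proof. by rewrite /tlift big1 // => i _; rewrite big1 // => j _; rewrite scaler0. Qed.

Lemma tlift_trmx (K : fieldType) (U V : vectType K) (W : lmodType K)
    (f : U -> V -> W) (T : tensor U V) :
  tlift f T = tlift (fun v u => f u v) (T^T : tensor V U).
Proof.
rewrite /tlift exchange_big; apply: eq_bigr => j _; apply: eq_bigr => i _.
by rewrite mxE.
Qed.

Lemma lfun_inj_bij (K : fieldType) (U W : vectType K) (f : {linear U -> W}) :
  injective f -> dim U = dim W -> bijective f.
Proof.
move=> f_inj dimUW; pose F := linfun f.
have kerF : lker F == 0%VS by apply/lker0P => x y; rewrite !lfunE; apply: f_inj.
have limgF : limg F = fullv.
  by apply/eqP; rewrite eqEdim subvf limg_dim_eq ?(eqP kerF) ?capv0 // !dimvf dimUW /=.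
exists (F^-1)%VF => x.
  by rewrite -[f x](lfunE f) lker0_lfunK.
by rewrite -[f _](lfunE f) limg_lfunVK // limgF memvf.
Qed.

Section FixedHopfAlgebra.
Variables (K : fieldType) (M : splittingFieldType K).
Hypothesis galM1 : galois 1 {:M}.
Variables (X : finGroupType) (N : {group X}) (lam : gal_of {:M} -> X).
Hypothesis lamN : forall g, lam g \in 'N(N)%g.
Hypothesis lamM : forall g h, lam (g * h)%g = (lam g * lam h)%g.

Local Notation H := (fixed_algebra lamN).
Local Notation iota := (linear_of (@fixed_coef_linear K M X N lam lamN)).

Lemma fixed_coef_eqN (u v : H) : {in N, fixed_coef u =1 fixed_coef v} -> u = v.
Proof.
move=> uv; apply: fixed_coef_inj; apply/ffunP => n.
have [/uv // | N'n] := boolP (n \in N).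
by rewrite !(fixed_coef_equivariant _).1.
Qed.

Lemma fixed_coef_full c : equivariant N lam c -> exists u : H, fixed_coef u = c.
Proof. by move/equivariant_spaceP=> Hc; exists (Subvs Hc). Qed.

Lemma fixed_coef_mul (a b : H) k :
  fixed_coef (a * b) k = \sum_(n in N) fixed_coef a n * fixed_coef b (k * n^-1)%g.
Proof. exact: fixed_mulE. Qed.

Lemma fixed_coef_tlift (U V : vectType K) (f : U -> V -> H) T n :
  fixed_coef (tlift f T) n = tlift (fun a b => fixed_coef (f a b) n) T.
Proof. exact: (linear_tlift (iota_at iota n)). Qed.

Let ev := eval2 iota.

Let ev_tens n m a b : ev n m (tens a b) = fixed_coef a n * fixed_coef b m.
Proof. exact: eval2_tens. Qed.

Let ev3_tens n m k a T : eval3 iota n m k (tens a T) = fixed_coef a n * ev m k T.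
Proof. exact: eval3_tens. Qed.

Lemma eval2_tlift (U V : vectType K) (f : U -> V -> tensor H H) T n m :
  ev n m (tlift f T) = tlift (fun a b => ev n m (f a b)) T.
Proof. exact: (linear_tlift (linear_of (eval2_linear iota n m))). Qed.

Lemma eval3_tlift (U V : vectType K) (f : U -> V -> tensor H (tensor H H)) T n m k :
  eval3 iota n m k (tlift f T) = tlift (fun a b => eval3 iota n m k (f a b)) T.
Proof. exact: (linear_tlift (linear_of (eval3_linear iota n m k))). Qed.

Lemma fixed_coefE1 n : fixed_coef (1 : H) n = (n == 1%g)%:R.
Proof. by rewrite [LHS]ffunE. Qed.

Lemma fixed_coefZ k (h : H) n : fixed_coef (k *: h) n = k *: fixed_coef h n.
Proof. by rewrite [LHS]ffunE. Qed.

Variables (Delta : {linear H -> tensor H H}) (eps : {linear H -> K^o}).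
Variable (anti : {linear H -> H}).
Hypothesis DeltaE : forall h n m, ev n m (Delta h) = if n == m then fixed_coef h n else 0.
Hypothesis epsE : forall h, (eps h : K)%:A = \sum_(n in N) fixed_coef h n :> M.
Hypothesis antiE : forall h n, fixed_coef (anti h) n = fixed_coef h n^-1%g.

Let eval2N_inj : forall T T' : tensor H H,
    (forall n m, ev n m T = ev n m T') -> T = T' :=
  eval2_inj (iota := iota) galM1 lamN lamM (@fixed_coef_inj _ _ _ _ _ lamN)
    (@fixed_coef_equivariant _ _ _ _ _ lamN).
Let eval3N_inj := eval3_inj (iota := iota) galM1 lamN lamM
  (@fixed_coef_inj _ _ _ _ _ lamN) (@fixed_coef_equivariant _ _ _ _ _ lamN).
Let sweedlerN F Phi :=
  sweedler (iota := iota) (N := N) DeltaE (F := F) (Phi := Phi).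

Lemma fixed_comulA h :
    tlift (fun a b => tlift (fun a1 a2 => tens a1 (tens a2 b)) (Delta a))
      (Delta h) =
    tlift (fun a b => tens a (Delta b)) (Delta h).
Proof.
apply: eval3N_inj => n m k; rewrite !eval3_tlift.
transitivity (tlift (fun a b => ev n m (Delta a) * fixed_coef b k) (Delta h)).
  apply: eq_tlift => a b; rewrite eval3_tlift -tlift_mulr.
  by apply: eq_tlift => a1 a2; rewrite ev3_tens ev_tens mulrA.
transitivity (if n == m then ev n k (Delta h) else 0).
  case: ifP => nm; last rewrite -[RHS](tlift0 _ (Delta h)).
    by apply: eq_tlift => a b; rewrite DeltaE nm.
  by apply: eq_tlift => a b; rewrite DeltaE nm mul0r.
transitivity (if m == k then ev n m (Delta h) else 0).
  rewrite !DeltaE; case: (n =P m) => [->|_]; last by rewrite if_same.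
  by [].
case: ifP => mk; first apply: eq_tlift => a b.
  by rewrite ev3_tens DeltaE mk.
rewrite -[LHS](tlift0 _ (Delta h)); apply: eq_tlift => a b.
by rewrite ev3_tens DeltaE mk mulr0.
Qed.

Lemma fixed_counitl h : tlift (fun a b => (eps a : K) *: b) (Delta h) = h.
Proof.
apply: fixed_coef_eqN => k Nk; rewrite fixed_coef_tlift.
rewrite (sweedlerN (Phi := fun _ m => (m == k)%:R)) => [|a b].
  rewrite (bigD1 k) //= eqxx mulr1 big1 ?addr0 // => n /andP[_ /negPf->].
  by rewrite mulr0.
rewrite fixed_coefZ -mulr_algl epsE mulr_suml; apply: eq_bigr => n _.
rewrite (bigD1 k) //= eqxx mulr1 big1 ?addr0 // => m /andP[_ /negPf->].
by rewrite mulr0.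
Qed.

Lemma fixed_cocommutative h : tlift (fun a b => tens b a) (Delta h) = Delta h.
Proof.
apply: eval2N_inj => n m; rewrite eval2_tlift.
transitivity (ev m n (Delta h)).
  by apply: eq_tlift => a b; rewrite ev_tens mulrC.
by rewrite !DeltaE eq_sym; case: eqP => // ->.
Qed.

Lemma fixed_counitr h : tlift (fun a b => (eps b : K) *: a) (Delta h) = h.
Proof.
apply: fixed_coef_eqN => k Nk; rewrite fixed_coef_tlift.
rewrite (sweedlerN (Phi := fun m _ => (m == k)%:R)) => [|a b].
  rewrite (bigD1 k) //= eqxx mulr1 big1 ?addr0 // => n /andP[_ /negPf->].
  by rewrite mulr0.
rewrite fixed_coefZ -mulr_algl epsE mulrC mulr_sumr.
rewrite [RHS](bigD1 k) //= [X in _ + X]big1 ?addr0 => [|n /andP[_ /negPf->]].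
  by apply: eq_bigr => n _; rewrite eqxx mulr1.
by rewrite big1 // => m _; rewrite mulr0.
Qed.

Lemma fixed_comul1 : Delta 1 = tens 1 1.
Proof.
apply: eval2N_inj => n m; rewrite DeltaE ev_tens !fixed_coefE1.
by case: (n =P 1%g) => [->|_]; rewrite ?mul0r ?if_same // mul1r eq_sym; case: eqP.
Qed.

Lemma fixed_comulM g h : Delta (g * h) =
    tlift (fun a b => tlift (fun c d => tens (a * c) (b * d)) (Delta h))
      (Delta g).
Proof.
apply: eval2N_inj => n m; rewrite DeltaE eval2_tlift.
rewrite (sweedlerN (Phi := fun k l => ev (n * k^-1)%g (m * l^-1)%g (Delta h))).
  rewrite fixed_coef_mul; case: eqP => [<-|nm].
    by apply: eq_bigr => k _; rewrite DeltaE eqxx.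
  rewrite big1 // => k _; rewrite DeltaE (inj_eq (mulIg _)).
  by case: eqP nm => // _ _; rewrite mulr0.
move=> a b; rewrite eval2_tlift.
transitivity (tlift (fun c d => \sum_(k in N) \sum_(l in N)
    fixed_coef a k * fixed_coef b l * (fixed_coef c (n * k^-1)%g *
      fixed_coef d (m * l^-1)%g)) (Delta h)).
  apply: eq_tlift => c d; rewrite ev_tens !fixed_coef_mul big_distrlr /=.
  by apply: eq_bigr => k _; apply: eq_bigr => l _; rewrite mulrACA.
rewrite tlift_sum; apply: eq_bigr => k _; rewrite tlift_sum.
by apply: eq_bigr => l _; rewrite tlift_mull.
Qed.

Lemma in_alg_inj : injective (fun k : K => k%:A : M).
Proof. exact: (fmorph_inj (in_alg M)). Qed.

Lemma fixed_counit1 : eps 1 = 1.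
Proof.
apply: in_alg_inj; rewrite epsE scale1r (bigD1 1%g) //= fixed_coefE1 eqxx.
by rewrite big1 ?addr0 // => n /andP[_ /negPf n1]; rewrite fixed_coefE1 n1.
Qed.

Lemma fixed_counitM g h : eps (g * h) = (eps g : K) * eps h.
Proof.
apply: in_alg_inj; rewrite epsE -[RHS]scalerA -mulr_algl !epsE mulr_suml.
under eq_bigr do rewrite fixed_coef_mul.
rewrite exchange_big; apply: eq_bigr => n Nn /=.
rewrite -mulr_sumr; congr (_ * _).
rewrite [LHS](reindex_inj (mulIg n)) /=; apply: eq_big => m.
  by rewrite groupMr.
by rewrite mulgK.
Qed.

Lemma fixed_antipodel h :
  tlift (fun a b => anti a * b) (Delta h) = (eps h : K) *: 1.
Proof.
apply: fixed_coef_eqN => k Nk; rewrite fixed_coef_tlift fixed_coefZ fixed_coefE1 -mulr_algl epsE.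
transitivity (\sum_(n in N) ev n^-1%g (k * n^-1)%g (Delta h)).
  rewrite -tlift_sum; apply: eq_tlift => a b; rewrite fixed_coef_mul.
  by apply: eq_bigr => n _; rewrite antiE.
rewrite (reindex_inj invg_inj) mulr_suml /=.
apply: eq_big => n; first by rewrite groupV.
move=> _; rewrite !invgK DeltaE -{1}(mul1g n) (inj_eq (mulIg n)) eq_sym.
by case: eqP; rewrite ?mulr1 ?mulr0.
Qed.

Lemma fixed_antipoder h :
  tlift (fun a b => a * anti b) (Delta h) = (eps h : K) *: 1.
Proof.
apply: fixed_coef_eqN => k Nk; rewrite fixed_coef_tlift fixed_coefZ fixed_coefE1 -mulr_algl epsE.
transitivity (\sum_(n in N) ev n (n * k^-1)%g (Delta h)).
  rewrite -tlift_sum; apply: eq_tlift => a b; rewrite fixed_coef_mul.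
  by apply: eq_bigr => n _; rewrite antiE invMg invgK.
rewrite mulr_suml; apply: eq_bigr => n _.
rewrite DeltaE -{1}(mulg1 n) (inj_eq (mulgI n)) eq_sym eq_invg1.
by case: eqP; rewrite ?mulr1 ?mulr0.
Qed.

Definition fixed_hopf : hopfAlgebra K :=
  HopfAlgebra fixed_comulA fixed_counitl fixed_counitr fixed_comul1
    fixed_comulM fixed_counit1 fixed_counitM fixed_antipodel fixed_antipoder.

End FixedHopfAlgebra.

(** * The action on the subfield *)

Section FixedAction.
Variables (K : fieldType) (M : splittingFieldType K) (L : {subfield M}).
Hypothesis galM1 : galois 1 {:M}.
Variables (X : finGroupType) (N : {group X}) (lam : gal_of {:M} -> X).
Hypothesis lamN : forall g, lam g \in 'N(N)%g.
Hypothesis lamM : forall g h, lam (g * h)%g = (lam g * lam h)%g.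
Variable rho : X -> gal_of {:M}.
Hypothesis rho1 : {in L, forall x, rho 1%g x = x}.
Hypothesis rho_lam : forall g n x, g \in 'Gal({:M} / L)%g -> n \in N -> x \in L ->
  g (rho n x) = rho (n ^ lam g)%g x.
Hypothesis rho_mul : forall n m x, n \in N -> m \in N -> x \in L ->
  rho n (rho m x) = rho (m ^ lam (rho n) * n)%g x.
Hypothesis rho_free : forall c : X -> M,
  (forall x, x \in L -> \sum_(n in N) c n * rho n x = 0) ->
  forall n, n \in N -> c n = 0.
Hypothesis cardN : #|N| = \dim L.

Local Notation H := (fixed_algebra lamN).
Local Notation iota := (linear_of (@fixed_coef_linear K M X N lam lamN)).
Local Notation LT := (subvs_of L).

(** The map rho sends n to an automorphism of M that restricts to L as the
embedding attached to n. *)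
Definition fixed_act (c : X -> M) (x : M) : M := \sum_(n in N) c n * rho n x.

Lemma fixed_act_mem (c : {ffun X -> M}) x :
  equivariant N lam c -> x \in L -> fixed_act c x \in L.
Proof.
move=> [_ cG] Lx.
have galML : galois L {:M} by apply: galoisS galM1; rewrite sub1v subvf.
rewrite -(galois_fixedField galML); apply/fixedFieldP; rewrite ?memvf // => g Gg.
rewrite rmorph_sum [RHS](reindex_inj (conjg_inj (lam g))) /=.
apply: eq_big => n; first by rewrite memN_lam.
by move=> Nn; rewrite rmorphM /= rho_lam // cG.
Qed.

Lemma fixed_act_conv (a b : {ffun X -> M}) x :
    equivariant N lam b -> x \in L ->
  fixed_act (conv N a b) x = fixed_act a (fixed_act b x).
Proof.
move=> [bN bG] Lx; rewrite /fixed_act.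
under eq_bigr => k Nk do rewrite convE // mulr_suml.
rewrite exchange_big; apply: eq_bigr => n Nn /=.
rewrite rmorph_sum mulr_sumr (reindex_inj (mulIg n)) /=.
rewrite (reindex_inj (conjg_inj (lam (rho n)))) /=.
apply: eq_big => m; first by rewrite groupMr // memN_lam.
rewrite groupMr // memN_lam // => Nm.
by rewrite mulgK bG // rmorphM /= rho_mul // mulrA.
Qed.

Definition act_subvs (h : H) (x : LT) : LT :=
  vsproj L (fixed_act (fixed_coef h) (vsval x)).

Lemma act_subvsE h x : vsval (act_subvs h x) = fixed_act (fixed_coef h) (vsval x).
Proof. by rewrite vsprojK // fixed_act_mem ?subvsP //; apply: fixed_coef_equivariant. Qed.

Lemma act_subvs_linear h : linear (act_subvs h).
Proof.
move=> k x y; rewrite -linearP; congr (vsproj _ _).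
rewrite scaler_sumr -big_split; apply: eq_bigr => n _ /=.
by rewrite !linearP /= mulrDr scalerAr.
Qed.

Definition act_lfun (h : H) : 'End(LT) := linfun (linear_of (act_subvs_linear h)).

Lemma act_lfunE h x : vsval (act_lfun h x) = fixed_act (fixed_coef h) (vsval x).
Proof. by rewrite lfunE act_subvsE. Qed.

Lemma act_lfun_linear : linear act_lfun.
Proof.
move=> k g h; apply/lfunP => x; apply: subvs_inj.
rewrite add_lfunE scale_lfunE [RHS]linearP /= !act_lfunE /fixed_act.
rewrite scaler_sumr -big_split; apply: eq_bigr => n _ /=.
by rewrite !ffunE mulrDl scalerAl.
Qed.

Lemma act_lfun1 : act_lfun 1 = \1%VF.
Proof.
apply/lfunP => x; apply: subvs_inj; rewrite act_lfunE id_lfunE /fixed_act.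
rewrite (bigD1 1%g) // (fixed_coefE1 lamN) eqxx /= mul1r rho1 ?subvsP // big1 ?addr0 //.
by move=> n /andP[_ /negPf n1]; rewrite (fixed_coefE1 lamN) n1 mul0r.
Qed.

Lemma act_lfunM g h : act_lfun (g * h) = (act_lfun g \o act_lfun h)%VF.
Proof.
apply/lfunP => x; apply: subvs_inj; rewrite comp_lfunE !act_lfunE.
by apply: fixed_act_conv; rewrite ?subvsP //; apply: fixed_coef_equivariant.
Qed.

Lemma eval_lfun_linear (x : LT) : linear (fun f : 'End(LT) => vsval (f x)).
Proof. by move=> k f g; rewrite add_lfunE scale_lfunE linearP. Qed.

(** Under M (x) H = M[N], the operator attached to a tensor is the combination of
the embeddings [rho n] of L with its coefficients; these are independent by
[rho_free]. *)
Lemma tensor_act_inj :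
  injective (tlift (fun x h => (amull x \o act_lfun h)%VF)
               : tensor LT H -> 'End(LT)).
Proof.
move=> S T eqST.
suffices: S^T = T^T by move/(congr1 trmx); rewrite !trmxK.
apply: (tensor_eq (iota := iota) galM1 lamN lamM (@fixed_coef_inj _ _ _ _ _ lamN)
  (@fixed_coef_equivariant _ _ _ _ _ lamN) (J := unit)
  (beta := fun _ => @vsval K M L)) => [v v0|n _].
  by apply: subvs_inj; rewrite v0 ?linear0.
pose C n (T : tensor LT H) : M := tlift (fun x h => fixed_coef h n * vsval x) T.
suffices: C n S = C n T by rewrite /C tlift_trmx (tlift_trmx _ T).
have [Nn | N'n] := boolP (n \in N); last first.
  by apply: etrans (esym _); rewrite /C (@eq_tlift _ _ _ _ _ (fun _ _ => 0)) ?tlift0 // => x h;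
    rewrite (fixed_coef_equivariant h).1 ?mul0r.
apply/eqP; rewrite -subr_eq0; apply/eqP.
apply: (rho_free (c := fun n => C n S - C n T)) Nn => x Lx.
have actE (R : tensor LT H) : \sum_(m in N) C m R * rho m x =
    vsval (tlift (fun x h => (amull x \o act_lfun h)%VF) R (vsproj L x)).
  rewrite -[RHS]/(linear_of (eval_lfun_linear (vsproj L x)) _) linear_tlift /=.
  transitivity (\sum_(m in N)
      tlift (fun y h => fixed_coef h m * vsval y * rho m x) R).
    by apply: eq_bigr => m _; rewrite tlift_mulr.
  rewrite -tlift_sum; apply: eq_tlift => y h.
  rewrite comp_lfunE lfunE /= act_lfunE vsprojK // mulr_sumr.
  by apply: eq_bigr => m _; rewrite mulrCA mulrA.
under eq_bigr do rewrite mulrBl.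
by rewrite sumrB !actE eqST subrr.
Qed.

Lemma tensor_act_bij :
  bijective (tlift (fun x h => (amull x \o act_lfun h)%VF)
               : tensor LT H -> 'End(LT)).
Proof.
pose F := linear_of (tlift_linear (fun x h => (amull x \o act_lfun h)%VF)).
apply: (lfun_inj_bij (f := F)); first exact: tensor_act_inj.
rewrite dim_matrix -[dim 'End(LT)]/(dim LT * dim LT)%N; congr (_ * _)%N.
rewrite (dim_descent (iota := iota) galM1 lamN lamM (@fixed_coef_inj _ _ _ _ _ lamN)
  (@fixed_coef_equivariant _ _ _ _ _ lamN) (@fixed_coef_full _ _ _ _ _ lamN)).
exact: cardN.
Qed.

Theorem fixed_hopfGalois : exists (S : hopfGalois LT)
    (coefS : {linear S -> {ffun X -> M}}),
  [/\ injective coefS /\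
      (forall c, (exists h, coefS h = c) <-> equivariant N lam c),
      (forall n, coefS 1 n = (n == 1%g)%:R) /\
      (forall g h k, coefS (g * h) k =
        \sum_(n in N) \sum_(m in N | (m * n)%g == k) coefS g n * coefS h m),
      (forall h n m, tlift (fun a b => coefS a n * coefS b m) (comul h) =
        if n == m then coefS h n else 0) /\
      (forall h, (counit h : K) *: (1 : M) = \sum_(n in N) coefS h n),
      forall h n, coefS (antipode h) n = coefS h n^-1%g &
      forall h x, vsval (hg_act h x) = \sum_(n in N) coefS h n * rho n (vsval x)].
Proof.
have [Delta DeltaE] := diagonal_exists galM1 lamN lamM (iota := iota)
  (@fixed_coef_inj _ _ _ _ _ lamN) (@fixed_coef_equivariant _ _ _ _ _ lamN) (@fixed_coef_full _ _ _ _ _ lamN).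
have phi_lin : linear (fun h : H => \sum_(n in N) fixed_coef h n).
  move=> k g h; rewrite scaler_sumr -big_split; apply: eq_bigr => n _ /=.
  by rewrite !ffunE.
have [|eps epsE] := @scalar_lift _ _ galM1 _ (linear_of phi_lin).
  move=> g h /=; rewrite rmorph_sum [RHS](reindex_inj (conjg_inj (lam g))) /=.
  apply: eq_big => n; first by rewrite memN_lam.
  by move=> Nn; rewrite (fixed_coef_equivariant h).2.
have anti_mem (h : H) : [ffun n => fixed_coef h n^-1%g] \in equivariant_space N lam.
  have [cN cG] := fixed_coef_equivariant h.
  apply/equivariant_spaceP; split=> [n N'n | g n Nn]; rewrite !ffunE.
    by rewrite cN ?groupV.
  by rewrite -conjVg cG ?groupV.
have anti_lin : linear (fun h : H => Subvs (anti_mem h) : H).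
  by move=> k g h; apply: fixed_coef_inj; apply/ffunP => n; rewrite !ffunE.
have antiE (h : H) n : fixed_coef (linear_of anti_lin h) n = fixed_coef h n^-1%g.
  by rewrite [LHS]ffunE.
pose HS := fixed_hopf galM1 lamM DeltaE epsE antiE.
have mod1 (h : HS) : act_lfun h 1 = (counit h : K) *: 1.
  apply: subvs_inj; rewrite act_lfunE linearZ /= algid1 [RHS]epsE.
  by apply: eq_bigr => n _; rewrite rmorph1 mulr1.
have modM (h : HS) x y :
  act_lfun h (x * y) = tlift (fun a b => act_lfun a x * act_lfun b y) (comul h).
  apply: subvs_inj; rewrite linear_tlift act_lfunE /=.
  pose Phi n m := rho n (vsval x) * rho m (vsval y).
  rewrite (sweedler (iota := iota) (N := N) DeltaE (Phi := Phi)) => [|a b].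
    by apply: eq_bigr => n _; rewrite /= rmorphM.
  rewrite !act_lfunE /fixed_act big_distrlr; apply: eq_bigr => n _.
  by apply: eq_bigr => m _; rewrite mulrACA.
exists (@HopfGalois K LT HS (linear_of act_lfun_linear)
   (fixed_cocommutative galM1 lamM DeltaE) act_lfun1 act_lfunM mod1 modM tensor_act_bij), iota.
split.
- split=> [|c]; first exact: fixed_coef_inj.
  split=> [[h <-] | /(fixed_coef_full lamN)//].
  exact: (@fixed_coef_equivariant _ _ _ _ _ lamN h).
- by split=> [n | g h k]; rewrite [LHS]ffunE.
- by split.
- exact: antiE.
exact: act_lfunE.
Qed.

End FixedAction.

(** * Recovering the structure from the group, and the group from the structure *)

Section Uniqueness.
Variables (K : fieldType) (M : splittingFieldType K) (L : {subfield M}).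
Hypothesis galM1 : galois 1 {:M}.
Variables (X : finGroupType) (N : {group X}) (lam : gal_of {:M} -> X).
Hypothesis lamN : forall g, lam g \in 'N(N)%g.
Hypothesis lamM : forall g h, lam (g * h)%g = (lam g * lam h)%g.
Variable rho : X -> gal_of {:M}.
Local Notation LT := (subvs_of L).

(** The coefficient map c identifies S with the Hopf Galois structure of the fixed
points of M[N]. *)
Definition presents (S : hopfGalois LT) (c : {linear S -> {ffun X -> M}}) : Prop :=
  [/\ injective c /\
      (forall d, (exists h, c h = d) <-> equivariant N lam d),
      (forall n, c 1 n = (n == 1%g)%:R) /\
      (forall g h k, c (g * h) k =
        \sum_(n in N) \sum_(m in N | (m * n)%g == k) c g n * c h m),
      (forall h n m, tlift (fun a b => c a n * c b m) (comul h) =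
        if n == m then c h n else 0) /\
      (forall h, (counit h : K) *: (1 : M) = \sum_(n in N) c h n),
      forall h n, c (antipode h) n = c h n^-1%g &
      forall h x, vsval (hg_act h x) = \sum_(n in N) c h n * rho n (vsval x)].

Arguments presents S c : clear implicits.

Lemma presents_equivariant (S : hopfGalois LT) (c : {linear S -> {ffun X -> M}}) h :
  presents S c -> equivariant N lam (c h).
Proof. by case=> [[_ im_c] _ _ _ _]; apply/im_c; exists h. Qed.

Lemma presents_transfer (S1 S2 : hopfGalois LT)
    (c1 : {linear S1 -> {ffun X -> M}}) (c2 : {linear S2 -> {ffun X -> M}}) :
  presents S1 c1 -> presents S2 c2 -> exists f : {linear S1 -> S2}, forall h, c2 (f h) = c1 h.
Proof.
move=> c1P [[inj2 im2] _ _ _ _].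
exists ((linfun c2)^-1 \o linfun c1)%VF => h.
rewrite /= comp_lfunE (lfunE c1) -[c2 _](lfunE c2) limg_lfunVK //.
have [h2 <-] := (im2 (c1 h)).2 (presents_equivariant h c1P).
by rewrite -[c2 _](lfunE c2) memv_img ?memvf.
Qed.

(** Both coefficient maps have the same image, and the transfer between the two
structures preserves whatever the coefficients determine. *)
Lemma presents_iso (S1 S2 : hopfGalois LT)
    (c1 : {linear S1 -> {ffun X -> M}}) (c2 : {linear S2 -> {ffun X -> M}}) :
  presents S1 c1 -> presents S2 c2 -> hg_iso S1 S2.
Proof.
move=> c1P c2P; have [f fE] := presents_transfer c1P c2P.
have [g gE] := presents_transfer c2P c1P.
have c2eq h := presents_equivariant h c2P.
have [[inj1 _] [one1 mul1] [com1 cou1] ant1 act1] := c1P.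
have [[inj2 _] [one2 mul2] [com2 cou2] ant2 act2] := c2P.
exists f; split.
- by exists g => h; [apply: inj1; rewrite gE fE | apply: inj2; rewrite fE gE].
- split=> [|a b]; apply: inj2; apply/ffunP => n; rewrite fE ?one1 ?one2 //.
  by rewrite mul1 mul2 !fE.
- move=> h; apply: (eval2_inj (iota := c2) galM1 lamN lamM inj2 c2eq) => n m.
  rewrite [LHS]com2 -[RHS]/(linear_of (eval2_linear c2 n m) _) linear_tlift /=.
  rewrite fE -com1; apply: eq_tlift => a b.
  by rewrite eval2_tens /= !fE.
- split=> h; last first.
    by apply: inj2; apply/ffunP => n; rewrite ant2 !fE ant1.
  apply: (@in_alg_inj _ M); rewrite [LHS]cou2 [RHS]cou1.
  by apply: eq_bigr => n _; rewrite fE.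
move=> h; apply/lfunP => x; apply: subvs_inj; rewrite act2 act1.
by apply: eq_bigr => n _; rewrite fE.
Qed.

End Uniqueness.

Arguments presents {K M L X} N lam rho S c.

Section GroupRecovery.
Variables (K : fieldType) (M : splittingFieldType K).
Hypothesis galM1 : galois 1 {:M}.
Variables (T : finType) (D : {set T}) (x0 : T) (N1 N2 : {group {perm T}}).
Variable lam : gal_of {:M} -> {perm T}.
Hypothesis lamN1 : forall g, lam g \in 'N(N1)%g.
Hypothesis lamM : forall g h, lam (g * h)%g = (lam g * lam h)%g.
Hypothesis x0D : x0 \in D.
Hypothesis N1D : N1 \subset perm.Sym D.
Hypothesis N2D : N2 \subset perm.Sym D.
Hypothesis N1tr : [transitive N1, on D | 'P].
Hypothesis N2tr : [transitive N2, on D | 'P].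
Hypothesis N1fr : 'C_N1[x0 | 'P]%g = 1%g.
Hypothesis N2fr : 'C_N2[x0 | 'P]%g = 1%g.

Variables (U : falgType K) (c1 c2 : {linear U -> {ffun {perm T} -> M}}).
Hypothesis c1_inj : injective c1.
Hypothesis c1_eq : forall u, equivariant N1 lam (c1 u).
Hypothesis c1_full : forall d, equivariant N1 lam d -> exists u, c1 u = d.
Hypothesis c2_eq : forall u, equivariant N2 lam (c2 u).
Hypothesis c1M : forall g h, c1 (g * h) = conv N1 (c1 g) (c1 h).
Hypothesis c2M : forall g h, c2 (g * h) = conv N2 (c2 g) (c2 h).
Hypothesis c12 : forall u, {in N1 & N2, forall n n' : {perm T},
  n^-1%g x0 = n'^-1%g x0 -> c1 u n = c2 u n'}.

Lemma perm_onVN (N : {group {perm T}}) (n : {perm T}) :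
  N \subset perm.Sym D -> n \in N -> perm_on D n^-1%g.
Proof. by move=> ND Nn; have := subsetP ND n^-1%g; rewrite groupV inE; apply. Qed.

Lemma regular_point (N : {group {perm T}}) A :
  [transitive N, on D | 'P] -> A \in D -> exists2 n : {perm T}, n \in N & n^-1%g x0 = A.
Proof.
move=> Ntr DA; have [n Nn ->] := atransP2 Ntr x0D DA.
by exists n^-1%g; rewrite ?groupV ?invgK.
Qed.

Lemma regular_inj (N : {group {perm T}}) : 'C_N[x0 | 'P]%g = 1%g ->
  {in N &, forall n m : {perm T}, n^-1%g x0 = m^-1%g x0 -> n = m}.
Proof.
move=> Nfr n m Nn Nm nm; apply/eqP; rewrite eq_mulVg1 -in_set1.
rewrite -[[set 1%g]]/(1%g : {set _}) -Nfr inE groupM ?groupV //=.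
by apply/astab1P; rewrite /= /aperm permM nm permKV.
Qed.

(** The combinations of the images of a basis of U with coefficients beta and gamma
are the basis elements a and b of M[N]; their product there is a single basis
element. *)
Lemma conv_dual (N : {group {perm T}}) (c : {linear U -> {ffun {perm T} -> M}})
    (beta gamma : 'I_(dim U) -> M) a b k :
    (forall u n, n \notin N -> c u n = 0) ->
    (forall g h, c (g * h) = conv N (c g) (c h)) ->
    (forall n, n \in N -> \sum_i beta i * c (stdbasis i) n = (a == n)%:R) ->
    (forall n, n \in N -> \sum_i gamma i * c (stdbasis i) n = (b == n)%:R) ->
    a \in N -> k \in N ->
  \sum_i \sum_j beta i * gamma j * c (stdbasis i * stdbasis j) k =
    ((b * a)%g == k)%:R.
Proof.
move=> cN cM betaE gammaE Na Nk.
transitivity (\sum_(n in N) (a == n)%:R * (b == (k * n^-1)%g)%:R : M).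
  transitivity (\sum_i \sum_j \sum_(n in N) (beta i * c (stdbasis i) n) *
      (gamma j * c (stdbasis j) (k * n^-1)%g)).
    apply: eq_bigr => i _; apply: eq_bigr => j _.
    rewrite cM convE => [|n]; last exact: cN.
    by rewrite mulr_sumr; apply: eq_bigr => n _; rewrite mulrACA.
  rewrite -(eq_bigr _ (fun i _ => exchange_big _ _ _ _ _ _)) exchange_big /=.
  apply: eq_bigr => n Nn; rewrite -betaE // -gammaE ?groupM ?groupV //.
  by rewrite big_distrlr.
rewrite (bigD1 a) //= eqxx mul1r big1 ?addr0 => [|n /andP[_ /negPf na]].
  by rewrite (canF_eq (mulgK a)).
by rewrite eq_sym na mul0r.
Qed.

(** The hypothesis [c12] says that an element u of U defines the same function on
the points of D, whichever of the two groups is used to label them.  Hence the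
same dual coefficients express a in N1 and the a' of N2 with the same label,
and the products of a, b and of a', b' have the same label as well.  Letting a
vary, this label runs over the images under b^-1 and b'^-1 of all points. *)
Lemma regular_recovery : N1 \subset N2.
Proof.
have [B DB] := descent_span lamN1 lamM c1_full.
have DB1 a n : a \in N1 -> n \in N1 ->
  \sum_i B a i * c1 (stdbasis i) n = (a == n)%:R by apply: DB.
have DB2 (a a' n : {perm T}) : a \in N1 -> a' \in N2 -> a^-1%g x0 = a'^-1%g x0 -> n \in N2 ->
  \sum_i B a i * c2 (stdbasis i) n = (a' == n)%:R.
  move=> N1a N2a' aa' N2n.
  have /(regular_point N1tr)[m N1m mn] : n^-1%g x0 \in D.
    by rewrite perm_closed // (perm_onVN N2D).
  transitivity ((a == m)%:R : M).
    rewrite -DB1 //; apply: eq_bigr => i _.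
    by rewrite (c12 _ N1m N2n mn).
  congr ((_ : bool)%:R); apply/eqP/eqP => [am | a'n].
    by apply: (regular_inj N2fr) => //; rewrite -aa' -mn am.
  by apply: (regular_inj N1fr) => //; rewrite aa' mn a'n.
apply/subsetP => b N1b.
have D_b : b^-1%g x0 \in D.
  by rewrite perm_closed // (perm_onVN N1D).
have [b' N2b' bb'] := regular_point N2tr D_b.
suffices -> : b = b' by [].
apply: invg_inj; apply/permP => A.
have [DA | D'A] := boolP (A \in D); last first.
  by rewrite (out_perm (perm_onVN N1D N1b)) // (out_perm (perm_onVN N2D N2b')) //.
have [a N1a aA] := regular_point N1tr DA.
have [a' N2a' a'A] := regular_point N2tr DA.
have N1ba : (b * a)%g \in N1 by rewrite groupM.
have /(regular_point N2tr)[k N2k kba] : (b * a)^-1%g x0 \in D.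
  by rewrite perm_closed // (perm_onVN N1D).
have := conv_dual (fun u => (c1_eq u).1) c1M (DB1 a ^~ N1a) (DB1 b ^~ N1b) N1a N1ba.
have := conv_dual (fun u => (c2_eq u).1) c2M
  (fun n => DB2 a a' n N1a N2a' (etrans aA (esym a'A)))
  (fun n => DB2 b b' n N1b N2b' (esym bb')) N2a' N2k.
under eq_bigr => i _ do under eq_bigr => j _ do rewrite -(c12 _ N1ba N2k (esym kba)).
move=> ->; rewrite eqxx; case: (_ =P k) => [Dk _|_ /eqP]; last by rewrite eq_sym oner_eq0.
by move: kba; rewrite -Dk !invMg !permM aA a'A => ->.
Qed.
End GroupRecovery.

(** * The action of the Galois group on the cosets *)

Section CosetAction.
Variables (K : fieldType) (M : splittingFieldType K) (L : {subfield M}).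

Local Notation Gal := 'Gal({:M} / 1)%g.
Local Notation Gal' := 'Gal({:M} / L)%g.
Local Notation point := {set gal_of {:M}}.
Local Notation pts := (gp_points L).
Local Notation lam := (gp_lambda L).
Local Notation x0 := (Gal' : point).

(** The subfield generated by the roots of the minimal polynomial of a primitive
element of L is normal and contains L, so it is M. *)
Lemma galois_normal_closure :
  separable 1 L -> normal_closure L -> galois 1 {:M}.
Proof.
move=> sepL ncL; set a := separable_generator 1 L.
have DL := eq_adjoin_separable_generator sepL (sub1v L).
have [r /eqP Dr] := splitting_field_normal 1 a.
have splitE : splittingFieldFor 1 (minPoly 1 a) <<1 & r>> by exists r; rewrite ?Dr ?eqpxx.
have galE : galois 1 <<1 & r>>.
  apply/splitting_galoisField; exists (minPoly 1 a).
  by split; [exact: minPolyOver | exact: separable_generatorP | ].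
have sLE : (L <= <<1 & r>>)%VS.
  rewrite DL; apply/FadjoinP; split; first exact: subv_adjoin_seq.
  by rewrite seqv_sub_adjoin // -root_prod_XsubC -Dr root_minPoly.
have /and3P[_ _ normE] := galE.
have /eqP <- : <<1 & r>>%VS == fullv by rewrite eqEsubv subvf ncL.
exact: galE.
Qed.

Lemma mem_ptsP A : reflect (exists g, A = Gal' :* g)%g (A \in pts).
Proof.
apply: (iffP rcosetsP) => [[g _ ->] | [g ->]]; first by exists g.
by exists g; rewrite ?mem_gal1.
Qed.

Lemma base_point : x0 \in pts.
Proof. by apply/mem_ptsP; exists 1%g; rewrite rcoset1. Qed.

Lemma gp_lambda_on g : perm_on pts (lam g).
Proof. exact: restr_perm_on. Qed.

Lemma gp_lambda_Sym g : lam g \in perm.Sym pts.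
Proof. by rewrite inE gp_lambda_on. Qed.

Lemma gp_lambdaE g A : A \in pts -> lam g A = (A :* g)%g.
Proof.
move=> ptsA; rewrite restr_permE ?actpermE //= ?rcosetE //.
rewrite !inE; apply/subsetP => _ /mem_ptsP[h ->].
rewrite !inE /= apermE actpermE /= rcosetE -rcosetM.
by apply/mem_ptsP; exists (h * g)%g.
Qed.

Lemma gp_lambdaM g h : lam (g * h)%g = (lam g * lam h)%g.
Proof.
apply/permP => A; rewrite permM; have [ptsA | ptsA'] := boolP (A \in pts).
  by rewrite [lam h _]gp_lambdaE ?(perm_closed _ (gp_lambda_on g)) // !gp_lambdaE // rcosetM.
by rewrite !(out_perm (gp_lambda_on _) ptsA').
Qed.

Lemma gp_lambda_transitive A B : A \in pts -> B \in pts -> exists g, lam g A = B.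
Proof.
move=> ptsA; have /mem_ptsP[g Dg] := ptsA; case/mem_ptsP=> h ->.
by exists (g^-1 * h)%g; rewrite gp_lambdaE // Dg -rcosetM mulKVg.
Qed.

Lemma gp_lambda_conj (s : {perm point}) g A : (s ^ lam g)%g (lam g A) = lam g (s A).
Proof. exact: permJ. Qed.

Lemma gp_lambda_fix g : g \in Gal' -> lam g x0 = x0.
Proof. by move=> Gg; rewrite gp_lambdaE ?base_point // rcoset_id. Qed.

Lemma coset_eval A g x : A \in pts -> g \in A -> x \in L -> repr A x = g x.
Proof.
move=> /mem_ptsP[a ->] /rcosetP[h1 Gh1 ->] Lx.
case: repr_rcosetP => h2 Gh2; rewrite !galM ?memvf //.
by rewrite (fixed_gal (subvf L) Gh1 Lx) (fixed_gal (subvf L) Gh2 Lx).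
Qed.

Lemma mem_repr_pts A : A \in pts -> repr A \in A.
Proof. by case/mem_ptsP=> a ->; apply: mem_repr_rcoset. Qed.

Section LambdaFaithful.
Hypothesis galM1 : galois 1 {:M}.

(** An automorphism acting trivially on the cosets fixes L; so the fixed field of
the kernel is a normal extension containing L, which is M. *)
Lemma gp_lambda_inj : normal_closure L -> injective lam.
Proof.
move=> ncL.
pose lam_morph := @Morphism _ _ [set: gal_of {:M}] lam (in2W gp_lambdaM).
suffices ker1 : 'ker lam_morph = 1%g.
  by move=> g h; move/injmP: (introT trivgP ker1); apply; rewrite inE.
have nsker : 'ker lam_morph <| 'Gal({:M} / 1)%g.
  have -> : 'Gal({:M} / 1)%g = [set: gal_of {:M}].
    by apply/setP => g; rewrite mem_gal1 inE.
  exact: ker_normal.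
have /and3P[_ _ normE] := normal_fixedField_galois galM1 nsker.
have sLE : (L <= fixedField ('ker lam_morph))%VS.
  apply/subvP => x Lx; apply/fixedFieldP; rewrite ?memvf // => g /mker/= lg1.
  apply: (fixed_gal (subvf L)) => //; have := gp_lambdaE g base_point.
  by rewrite lg1 perm1 => ->; rewrite rcoset_refl.
have := ncL [aspace of fixedField ('ker lam_morph)] sLE normE.
rewrite /= => sME; rewrite -(gal_fixedField ('ker lam_morph)%G) /=.
have -> : fixedField ('ker lam_morph) = {:M}%VS by apply/eqP; rewrite eqEsubv subvf.
by apply/trivgP/subsetP => g; rewrite gal_kHom // inE => /kAHomP gid;
  apply/gal_eqP => x Mx; rewrite gal_id gid.
Qed.

End LambdaFaithful.

Lemma card_pts : galois 1 {:M} -> #|pts| = \dim L.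
Proof.
move=> galM1.
have sGG : Gal' \subset Gal by apply: galS; apply: sub1v.
have galML : galois L {:M} by apply: galoisS galM1; rewrite sub1v subvf.
have := dim_fixed_galois galM1 sGG.
by rewrite (galois_fixedField galML) dimv1 divn1 => ->.
Qed.

Section Regular.
Variable N : {group {perm point}}.
Hypothesis galM1 : galois 1 {:M}.
Hypothesis Nreg : gp_regular L N.
Hypothesis Nnorm : gp_normalized L N.

Definition rho (n : {perm point}) : gal_of {:M} := repr (n^-1%g x0).

Lemma N_Sym : N \subset perm.Sym pts. Proof. by case: Nreg. Qed.

Lemma N_on n : n \in N -> perm_on pts n^-1%g.
Proof. exact: perm_onVN N_Sym. Qed.

Lemma N_pts n A : n \in N -> (n^-1%g A \in pts) = (A \in pts).
Proof. by move=> Nn; rewrite (perm_closed _ (N_on Nn)). Qed.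

Lemma N_free : 'C_N[x0 | 'P]%g = 1%g.
Proof. by case: Nreg => _ _; apply; apply: base_point. Qed.

Lemma N_inj : {in N &, forall n m : {perm point}, n^-1%g x0 = m^-1%g x0 -> n = m}.
Proof. exact: regular_inj N_free. Qed.

Lemma card_N : #|N| = \dim L.
Proof.
rewrite -card_pts // -(card_orbit_stab 'P N x0) N_free cards1 muln1.
by case: Nreg => _ Ntr _; rewrite (atransP Ntr) ?base_point.
Qed.

Lemma gp_lambda_norm g : lam g \in 'N(N)%g.
Proof. by apply: (subsetP Nnorm); apply: imset_f; apply: mem_gal1. Qed.

Lemma rhoE n : n \in N -> n^-1%g x0 = (Gal' :* rho n)%g.
Proof.
move=> Nn; have /mem_ptsP[a Da] : n^-1%g x0 \in pts by rewrite N_pts ?base_point.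
have : rho n \in n^-1%g x0 by rewrite mem_repr_pts // N_pts ?base_point.
by rewrite Da => /rcoset_eqP.
Qed.

Lemma rho1 : {in L, forall x, rho 1%g x = x}.
Proof.
move=> x Lx; rewrite /rho invg1 perm1.
by rewrite (coset_eval base_point (group1 _) Lx) gal_id.
Qed.

Lemma rho_lam g n x : g \in Gal' -> n \in N -> x \in L ->
  g (rho n x) = rho (n ^ lam g)%g x.
Proof.
move=> Gg Nn Lx; rewrite -galM ?memvf //; apply/esym/coset_eval => //.
  by rewrite N_pts ?base_point // memJ_norm ?gp_lambda_norm.
rewrite -conjVg -{1}(gp_lambda_fix Gg) gp_lambda_conj gp_lambdaE ?N_pts ?base_point //.
by rewrite rhoE // -rcosetM rcoset_refl.
Qed.

Lemma rho_mul n m x : n \in N -> m \in N -> x \in L ->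
  rho n (rho m x) = rho (m ^ lam (rho n) * n)%g x.
Proof.
move=> Nn Nm Lx; rewrite -galM ?memvf //; apply/esym/coset_eval => //.
  by rewrite N_pts ?base_point // groupM ?memJ_norm ?gp_lambda_norm.
rewrite invMg permM rhoE // -gp_lambdaE ?base_point // -conjVg gp_lambda_conj.
by rewrite gp_lambdaE ?N_pts ?base_point // rhoE // -rcosetM rcoset_refl.
Qed.

(** For x the trace of y from M to L, the relation becomes one between the
automorphisms of M, where g occurs with coefficient c n for the coset
[Gal' :* g] attached to n. *)
Lemma rho_free (c : {perm point} -> M) :
  (forall x, x \in L -> \sum_(n in N) c n * rho n x = 0) ->
  forall n, n \in N -> c n = 0.
Proof.
move=> c0 n0 Nn0.
have galML : galois L {:M} by apply: galoisS galM1; rewrite sub1v subvf.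
pose C g := \sum_(n in N | n^-1%g x0 == (Gal' :* g)%g) c n.
have C0 : forall g, predT g -> C g = 0.
  apply: (@gal_independent _ _ {:M}%AS) => y _.
  rewrite -[RHS](c0 _ (mem_galTrace galML (memvf y))).
  under eq_bigr do rewrite mulr_suml.
  rewrite (exchange_big_dep (mem N)) /= => [|g n _ /andP[]//].
  apply: eq_bigr => n Nn; rewrite rmorph_sum mulr_sumr.
  rewrite (reindex_inj (mulIg (rho n))) /=; apply: eq_big => g.
    rewrite Nn rhoE //=; apply/eqP/idP => [e | Gg]; last by rewrite rcosetM (rcoset_id Gg).
    have : (g * rho n)%g \in (Gal' :* rho n)%g by rewrite e rcoset_refl.
    by rewrite mem_rcoset mulgK.
  by rewrite galM ?memvf.
have := C0 (rho n0) isT; rewrite /C (big_pred1 n0) // => n.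
apply/andP/eqP => [[Nn /eqP nn0] | ->]; last by rewrite rhoE.
by apply: N_inj => //; rewrite nn0 -rhoE.
Qed.

End Regular.
End CosetAction.

(** * The Greither-Pareigis correspondence *)

Section Correspondence.
Variables (K : fieldType) (M : splittingFieldType K) (L : {subfield M}).
Hypothesis galM1 : galois 1 {:M}.

Local Notation Gal' := 'Gal({:M} / L)%g.
Local Notation point := {set gal_of {:M}}.
Local Notation pts := (gp_points L).
Local Notation lam := (gp_lambda L).
Local Notation x0 := (Gal' : point).
Local Notation rho := (rho L).
Implicit Type N : {group {perm point}}.

Lemma equivariantP N (c : {ffun {perm point} -> M}) :
  equivariant N lam c <->
  (forall n, n \notin N -> c n = 0) /\
    {in 'Gal({:M} / 1)%g & N, forall g n, c (n ^ lam g)%g = g (c n)}.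
Proof.
split=> -[cN cG]; split=> // g n; first by move=> _; apply: cG.
by apply: cG; apply: mem_gal1.
Qed.

Lemma gp_correspondsP N (S : hopfGalois (subvs_of L)) :
  gp_corresponds N S <-> exists c, presents N lam rho S c.
Proof.
split=> -[c [[c_inj c_im] cM ccom cant cact]]; exists c; split=> //;
  split=> // d; split.
- by move/c_im/equivariantP.
- by move/equivariantP/c_im.
- by move/c_im/equivariantP.
by move/equivariantP/c_im.
Qed.

Theorem gp_existence N : gp_regular L N -> gp_normalized L N ->
  exists S : hopfGalois (subvs_of L), gp_corresponds N S.
Proof.
move=> Nreg Nnorm.
have [S [c cP]] := fixed_hopfGalois galM1 (gp_lambda_norm Nnorm) (@gp_lambdaM _ _ L)
  (@rho1 _ _ L) (rho_lam Nreg Nnorm) (rho_mul Nreg Nnorm) (rho_free galM1 Nreg)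
  (card_N galM1 Nreg).
by exists S; apply/gp_correspondsP; exists c.
Qed.

Theorem gp_unique_structure N (S1 S2 : hopfGalois (subvs_of L)) :
    gp_regular L N -> gp_normalized L N ->
  gp_corresponds N S1 -> gp_corresponds N S2 -> hg_iso S1 S2.
Proof.
move=> Nreg Nnorm /gp_correspondsP[c1 c1P] /gp_correspondsP[c2 c2P].
exact: (presents_iso galM1 (gp_lambda_norm Nnorm) (@gp_lambdaM _ _ L) c1P c2P).
Qed.

Definition regular_at N (A : point) : {perm point} :=
  odflt 1%g [pick n : {perm point} in N | n^-1%g x0 == A].

Lemma regular_at_in N A : regular_at N A \in N.
Proof. by rewrite /regular_at; case: pickP => [n /andP[]|_ /=]. Qed.

Lemma regular_atK N A : gp_regular L N -> A \in pts -> (regular_at N A)^-1%g x0 = A.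
Proof.
move=> [_ Ntr _] ptsA; rewrite /regular_at; case: pickP => [n /andP[_ /eqP]|no] //=.
have [n Nn nA] := regular_point (base_point L) Ntr ptsA.
by have:= no n; rewrite /= Nn nA eqxx.
Qed.

(** Both sums are over the points, each of which contributes its own embedding of
L; embeddings attached to distinct points are independent. *)
Lemma regular_coef_eq N1 N2 (c d : {perm point} -> M) :
    gp_regular L N1 -> gp_regular L N2 ->
    (forall x, x \in L ->
       \sum_(n in N1) c n * rho n x = \sum_(n in N2) d n * rho n x) ->
  {in N1 & N2, forall n n' : {perm point}, n^-1%g x0 = n'^-1%g x0 -> c n = d n'}.
Proof.
move=> N1reg N2reg cd n n' N1n N2n' nn'.
pose s (m : {perm point}) := regular_at N2 (m^-1%g x0);
  pose t (m : {perm point}) := regular_at N1 (m^-1%g x0).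
have sE (m : {perm point}) : m \in N1 -> (s m)^-1%g x0 = m^-1%g x0.
  by move=> N1m; rewrite regular_atK // (N_pts N1reg) ?base_point.
have tE (m : {perm point}) : m \in N2 -> (t m)^-1%g x0 = m^-1%g x0.
  by move=> N2m; rewrite regular_atK // (N_pts N2reg) ?base_point.
have -> : n' = s n.
  by apply: (N_inj N2reg); rewrite ?regular_at_in // sE.
apply/eqP; rewrite -subr_eq0; apply/eqP.
apply: (rho_free galM1 N1reg (c := fun m => c m - d (s m))) N1n => x Lx.
under eq_bigr do rewrite mulrBl; rewrite sumrB cd //.
rewrite (reindex_onto s t) /= => [|m N2m]; last first.
  by apply: (N_inj N2reg); rewrite ?regular_at_in // sE ?tE ?regular_at_in.
rewrite [X in X - _](eq_bigl (mem N1)) => [|m]; last first.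
  rewrite /= regular_at_in /=; apply/eqP/idP => [<- | N1m].
    exact: regular_at_in.
  by apply: (N_inj N1reg); rewrite ?regular_at_in // tE ?regular_at_in ?sE.
apply/eqP; rewrite subr_eq0; apply/eqP; apply: eq_bigr => m N1m.
by rewrite /rho sE.
Qed.

Lemma gp_sub_group N1 N2 (S1 S2 : hopfGalois (subvs_of L)) :
    gp_regular L N1 -> gp_normalized L N1 -> gp_regular L N2 ->
    gp_corresponds N1 S1 -> gp_corresponds N2 S2 -> hg_iso S1 S2 ->
  N1 \subset N2.
Proof.
move=> N1reg N1norm N2reg /gp_correspondsP[c1 c1P] /gp_correspondsP[c2 c2P].
case=> f [f_bij [f1 fM] fcom _ fact].
have c1eq h := presents_equivariant h c1P; have c2eq h := presents_equivariant h c2P.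
have [[inj1 im1] [one1 mul1] _ _ act1] := c1P.
have [[inj2 im2] [one2 mul2] _ _ act2] := c2P.
have c2f_lin : linear (fun h => c2 (f h)) by move=> k g h; rewrite !linearP.
have [N1D N1tr _] := N1reg; have [N2D N2tr _] := N2reg.
apply: (regular_recovery (gp_lambda_norm N1norm) (@gp_lambdaM _ _ L) (base_point L) N1D N2D
  N1tr N2tr (N_free N1reg) (N_free N2reg) (c1 := c1) (c2 := linear_of c2f_lin)) => //.
- by move=> d /im1.
- by move=> h; apply: c2eq.
- by move=> g h; apply/ffunP => k; rewrite mul1 ffunE.
- by move=> g h; apply/ffunP => k; rewrite /= fM mul2 ffunE.
move=> h; apply: regular_coef_eq => // x Lx.
have := act1 h (vsproj L x); have := act2 (f h) (vsproj L x).
by rewrite fact vsprojK // => -> ->.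
Qed.

Theorem gp_unique_group N1 N2 (S1 S2 : hopfGalois (subvs_of L)) :
    gp_regular L N1 -> gp_normalized L N1 -> gp_regular L N2 ->
    gp_corresponds N1 S1 -> gp_corresponds N2 S2 -> hg_iso S1 S2 ->
  N1 = N2.
Proof.
move=> N1reg N1norm N2reg c1 c2 iso12; apply/val_inj/eqP.
by rewrite /= eqEcard (gp_sub_group N1reg N1norm N2reg c1 c2 iso12)
  (card_N galM1 N1reg) (card_N galM1 N2reg) leqnn.
Qed.

End Correspondence.

(** * Structures of dihedral type *)

Section Dihedral.
Variables (p : nat) (K : fieldType) (M : splittingFieldType K) (L : {subfield M}).
Hypotheses (p_pr : prime p) (p_odd : odd p) (dimL : (\dim L = 2 * p)%N).
Hypotheses (sepL : separable 1 L) (ncL : normal_closure L).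

Local Notation pts := (gp_points L).
Local Notation lam := (gp_lambda L).

Let galM1 : galois 1 {:M} := galois_normal_closure sepL ncL.
Let card_pts2 : #|pts| = (2 * p)%N. Proof. by rewrite card_pts. Qed.

Definition gp_lambda_morphism := @Morphism _ _ 'Gal({:M} / 1%VS) lam (in2W (@gp_lambdaM _ _ L)).
Definition gp_image := (gp_lambda_morphism @* 'Gal({:M} / 1%VS))%G.

Lemma gp_imageE : gp_image :=: [set lam g | g in 'Gal({:M} / 1%VS)].
Proof. by rewrite /= morphimEdom. Qed.

Lemma gp_image_Sym : gp_image \subset perm.Sym pts.
Proof. by rewrite gp_imageE; apply/subsetP => _ /imsetP[g _ ->]; apply: gp_lambda_Sym. Qed.

Lemma gp_image_transitive : [transitive gp_image, on pts | 'P].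
Proof.
apply/imsetP; exists ('Gal({:M} / L) : {set _}); first exact: base_point.
apply/setP => A; apply/idP/orbitP => [ptsA | [_ /morphimP[g _ _ ->] <-]]; last first.
  by rewrite /= /aperm (perm_closed _ (gp_lambda_on L g)) base_point.
have [g Dg] := gp_lambda_transitive (base_point L) ptsA.
exists (lam g); last exact: Dg.
by rewrite gp_imageE; apply: imset_f; apply: mem_gal1.
Qed.

Lemma gp_image_isog : 'Gal({:M} / 1%VS) \isog gp_image.
Proof.
apply: (@sub_isog _ _ _ gp_lambda_morphism) => //; apply/injmP => g h _ _.
exact: gp_lambda_inj galM1 ncL g h.
Qed.

Lemma dihedral_regularE N : dihedral_regular pts p gp_image N <->
  [/\ gp_regular L N, gp_normalized L N & N \isog 'D_(2 * p)].
Proof. by rewrite /dihedral_regular /gp_normalized gp_imageE. Qed.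

Lemma dihedral_typeE (S : hopfGalois (subvs_of L)) :
  dihedral_type p S <->
  exists2 N, dihedral_regular pts p gp_image N & gp_corresponds N S.
Proof.
split=> [[N [Nreg Nnorm NS isoN]] | [N /dihedral_regularE[Nreg Nnorm isoN] NS]].
  by exists N => //; apply/dihedral_regularE.
by exists N.
Qed.

Lemma dihedral_type_exists :
  (exists S : hopfGalois (subvs_of L), dihedral_type p S) <->
  exists N, dihedral_regular pts p gp_image N.
Proof.
split=> [[S /dihedral_typeE[N Nd _]] | [N Nd]]; first by exists N.
have /dihedral_regularE[Nreg Nnorm _] := Nd.
have [S NS] := gp_existence galM1 Nreg Nnorm.
by exists S; apply/dihedral_typeE; exists N.
Qed.

Lemma dihedral_type_count (N1 N2 : {group {perm {set gal_of {:M}}}}) :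
    N1 <> N2 -> dihedral_regular pts p gp_image N1 ->
    dihedral_regular pts p gp_image N2 ->
    (forall N, dihedral_regular pts p gp_image N -> N = N1 \/ N = N2) ->
  hg_count (@dihedral_type K M L p) 2.
Proof.
move=> N12 N1d N2d N_all.
have /dihedral_regularE[N1reg N1norm _] := N1d.
have /dihedral_regularE[N2reg N2norm _] := N2d.
have [S1 NS1] := gp_existence galM1 N1reg N1norm.
have [S2 NS2] := gp_existence galM1 N2reg N2norm.
have ord2 (i : 'I_2) : i = ord0 \/ i = ord_max.
  by case: i => [[|[|//]]] lt_i; [left | right]; apply: val_inj.
exists (fun i => if i == ord0 then S1 else S2); split=> [i | i j | S].
- by case: ifP => _; apply/dihedral_typeE; [exists N1 | exists N2].
- have [-> | ->] := ord2 i; have [-> | ->] := ord2 j => //= iso12; case: N12.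
    exact: (gp_unique_group galM1 N1reg N1norm N2reg NS1 NS2 iso12).
  exact/esym/(gp_unique_group galM1 N2reg N2norm N1reg NS2 NS1 iso12).
case/dihedral_typeE=> N Nd NS; have [DN | DN] := N_all N Nd; rewrite DN in NS.
  by exists ord0; apply: (gp_unique_structure galM1 N1reg N1norm NS NS1).
by exists ord_max; apply: (gp_unique_structure galM1 N2reg N2norm NS NS2).
Qed.

Lemma dihedral_structures (gT : finGroupType) (G : {group gT}) :
    G \isog 'Gal({:M} / 1%VS) ->
  ((exists S : hopfGalois (subvs_of L), dihedral_type p S) <->
   [\/ case_i p G, case_ii p G, case_iii p G | case_iv p G]) /\
  ([\/ case_i p G, case_ii p G, case_iii p G | case_iv p G] ->
   hg_count (@dihedral_type K M L p) 2).
Proof.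
move=> isoG; have isoGlam : G \isog gp_image := isog_trans isoG gp_image_isog.
have isolamG : gp_image \isog G by rewrite isog_sym.
have casesE : (exists C : {group {perm {set gal_of {:M}}}},
      semiregular_on pts p C /\ gp_image \subset 'N(C)) <->
    [\/ case_i p G, case_ii p G, case_iii p G | case_iv p G].
  split=> [[C [semiC nC]] | casesG].
    apply: (cases_isog isolamG).
    exact: (cases_of_semiregular p_pr p_odd card_pts2 gp_image_Sym gp_image_transitive semiC nC).
  apply: (semiregular_of_cases p_pr p_odd card_pts2 gp_image_Sym gp_image_transitive).
  exact: cases_isog isoGlam casesG.
split.
  apply: iff_trans casesE; apply: iff_trans dihedral_type_exists _.
  exact: (dihedral_regularP p_pr p_odd card_pts2 gp_image_Sym).
move/casesE=> [C [semiC nC]].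
have [N1 [N2 [N12 N1d N2d Nall]]] := dihedral_regular_count p_pr p_odd card_pts2
  gp_image_Sym gp_image_transitive semiC nC.
exact: dihedral_type_count N12 N1d N2d Nall.
Qed.

End Dihedral.

Theorem theorem11 (p : nat) (K : fieldType) (M : splittingFieldType K)
    (L : {subfield M}) (gT : finGroupType) (G : {group gT}) :
  prime p -> odd p ->
  \dim L = (2 * p)%N -> separable 1 L -> normal_closure L ->
  (G \isog 'Gal({:M} / 1))%g ->
  ((exists S : hopfGalois (subvs_of L), dihedral_type p S) <->
   [\/ case_i p G, case_ii p G, case_iii p G | case_iv p G]) /\
  ([\/ case_i p G, case_ii p G, case_iii p G | case_iv p G] ->
   hg_count (@dihedral_type K M L p) 2).
Proof.
move=> p_pr p_odd dimL sepL ncL; exact: dihedral_structures.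
Qed.
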